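(* Let $G$ be a finite simple graph with minimum degree $\delta(G)\ge 2$ and at most three vertices of degree $2$. Then $G$ contains a cycle whose length is divisible by $4$ if and only if $G$ is not isomorphic to one of the graphs $T_1,T_2,T_3,T_4,T_5$.
   Context: The graphs $T_1,\ldots,T_5$ (drawn in a figure in the paper) are as follows. $T_1=K_3$. $T_2$ has vertices $y_1,y_2,y_3,x_1,x_2,x_3,v$ and edges $y_1y_2,y_2y_3,y_3y_1$, $y_ix_i$ and $x_iv$ for $i=1,2,3$. $T_3$ has vertices $a,b,c,x,y,z,w$ and edges $ab,bc,ca,xy,yz,zx,yw,wa,zb$. $T_4$ is obtained from $T_2$ by adding a new vertex $m$ and edges $vm,mx_1$. $T_5$ is obtained from $T_2$ by adding a new vertex $m$ and edges $y_1m,mx_1$. *)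

(* Defs.v *)
From mathcomp Require Import all_boot.
Set Implicit Arguments. Unset Strict Implicit. Unset Printing Implicit Defensive.

Definition simple_graph (V : finType) (e : rel V) : Prop :=
  symmetric e /\ irreflexive e.

Definition deg (V : finType) (e : rel V) (x : V) : nat := #|[set y | e x y]|.

Definition is_cycle (V : finType) (e : rel V) (s : seq V) : Prop :=
  [/\ 3 <= size s, uniq s & cycle e s].

Definition edge_rel (n : nat) (E : seq (nat * nat)) : rel 'I_n :=
  fun x y => ((val x, val y) \in E) || ((val y, val x) \in E).

Definition iso_to (V : finType) (e : rel V) (n : nat) (E : seq (nat * nat)) : Prop :=
  exists f : V -> 'I_n, bijective f /\ forall x y, e x y = edge_rel E (f x) (f y).

Definition T1_E : seq (nat * nat) := [:: (0,1); (1,2); (0,2)].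
(* T2: y1,y2,y3 = 0,1,2 ; x1,x2,x3 = 3,4,5 ; v = 6 *)
Definition T2_E : seq (nat * nat) :=
  [:: (0,1); (1,2); (2,0); (0,3); (1,4); (2,5); (3,6); (4,6); (5,6)].
(* T3: a,b,c,x,y,z,w = 0,...,6 *)
Definition T3_E : seq (nat * nat) :=
  [:: (0,1); (1,2); (2,0); (3,4); (4,5); (5,3); (4,6); (6,0); (5,1)].
Definition T4_E : seq (nat * nat) := T2_E ++ [:: (6,7); (7,3)].
Definition T5_E : seq (nat * nat) := T2_E ++ [:: (0,7); (7,3)].

Definition is_T1 (V : finType) (e : rel V) := iso_to e 3 T1_E.
Definition is_T2 (V : finType) (e : rel V) := iso_to e 7 T2_E.
Definition is_T3 (V : finType) (e : rel V) := iso_to e 7 T3_E.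
Definition is_T4 (V : finType) (e : rel V) := iso_to e 8 T4_E.
Definition is_T5 (V : finType) (e : rel V) := iso_to e 8 T5_E.

(* Main.v *)
Require Import Defs.
From mathcomp Require Import all_boot.
From HB Require Import structures.
From Stdlib Require Import Classical.
From mathcomp Require Import zify.
Set Implicit Arguments. Unset Strict Implicit. Unset Printing Implicit Defensive.

(** A graph without cycles of length divisible by 4 is called zero-free, and a set [W] of vertices good
    if the induced graph G[W] is nonempty, has minimum degree at least 2 and at most three vertices of
    degree 2.  By induction on #|W|, every good [W] of a zero-free graph induces one of T1, ..., T5.

    Each T_i has exactly three vertices of degree 2, so in a minimal counterexample no proper subset of
    [W] with minimum degree 2 can have fewer.  This makes G[W] 2-connected, keeps its vertices of degree 2
    apart and gives them cubic neighbours, and leaves only four shapes for a side of a 2-cut with at most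
    one vertex of degree 2.

    Two paths joining the neighbours of a vertex of degree 2 form with it a theta graph in G[W].  As long
    as a known subdivision has a path with an interior vertex, the first interior vertex of that path
    either has degree 2 in G[W] or starts an ear leading elsewhere.  Zero-freeness sees only the path
    lengths modulo 4, so the possible subdivisions are multigraphs with edges labelled by residues.  The
    search through them is finite: it closes in graphs without interior vertices, which are then all of
    G[W] and isomorphic to T2 or T3. *)

(** Between any two of their vertices of degree 2, the exceptional graphs other than the triangle
    have paths of all four residues modulo 4; the triangle has lengths 1 and 2. So a smaller good
    piece in which two attachment vertices have degree 2 closes a cycle of length divisible by 4
    with a suitable path outside it. Most restrictions on a minimal counterexample come from this.

    The obstacle in the search is an ear that returns to the path it leaves, or to the ends of that
    path, since it says little about the rest of the graph. A fan argument sends the ear elsewhere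
    unless a 2-cut intervenes, and the cut then forces a triangle with a vertex of degree 2. The fan
    also reroutes the remainder of the path, whose residue is thereby lost.

    Single edges have a type of their own, apart from longer paths of residue 1, because only they
    need no further expansion. Soundness is proved for the checker of the search trees, not for the
    procedure that finds them. *)

(** Reduces distinctness of a sequence assembled from parts of a duplicate-free one to inequalities
    between multiplicities, which linear arithmetic settles; [uniq_by] packages this. *)
Lemma leq_count_uniq (T : eqType) (s1 s2 : seq T) :
  uniq s1 -> (forall x, count_mem x s2 <= count_mem x s1) -> uniq s2.
Proof.
move=> U le; elim: s2 le => //= x s IH le; apply/andP; split; last first.
  by apply: IH => y; apply: leq_trans (le y); apply: leq_addl.
rewrite -has_pred1 has_count -leqNgt; have := le x; rewrite eqxx (count_uniq_mem _ U).
by case: (x \in s1) => //=; lia.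
Qed.

(* [lia] is slow in the large contexts below, which [arith] first reduces to the arithmetical hypotheses. *)
Ltac arith := repeat match goal with H : ?T |- _ =>
  lazymatch T with is_true (leq _ _) => fail | @eq nat _ _ => fail | nat => fail | bool => fail | _ => clear H end end; lia.
Ltac count_tac := rewrite -?cats1 /= ?(count_cat, count_rev) /= ?(count_cat, count_rev) /=; clear; lia.
Ltac uniq_by H := refine (leq_count_uniq H _); let x := fresh in intro x; count_tac.

Lemma split_last_in (T : eqType) (A : pred T) x r : A x ->
  exists r1 u r2, [/\ x :: r = r1 ++ u :: r2, A u & {in r2, forall w, ~~ A w}].
Proof.
elim/last_ind: r => [|r w IH] Ax; first by exists [::], x, [::].
have [Aw|Aw] := boolP (A w); first by exists (x :: r), w, [::]; rewrite cats1.
have [r1 [u [r2 [E Au Hr]]]] := IH Ax.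
exists r1, u, (rcons r2 w); rewrite -rcons_cons E rcons_cat; split=> // y.
by rewrite mem_rcons inE => /predU1P [->//|/Hr].
Qed.

Lemma uniq_cat_notin (T : eqType) (s1 s2 : seq T) :
  uniq s1 -> uniq s2 -> {in s1, forall x, x \notin s2} -> uniq (s1 ++ s2).
Proof.
move=> U1 U2 D; rewrite cat_uniq U1 U2 andbT -all_predC; apply/allP => x xs2 /=.
by apply/negP => /D; rewrite xs2.
Qed.

(** * Two internally disjoint paths when no vertex separates *)

Section TwoPaths.
Variables (T : finType) (g : rel T).
Hypothesis gsym : symmetric g.

Definition avoid (y : T) := [rel u v | [&& u != y, v != y & g u v]].

(** [q1] and [q2] are the interiors of the paths. Both may be empty, so a single edge counts twice;
    this starts the induction in [two_paths]. *)
Definition linked_twice (x z : T) := exists q1 q2 : seq T,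
  [/\ path g x (rcons q1 z), path g x (rcons q2 z) & uniq (x :: z :: q1 ++ q2)].

(** The path from [x] to [z'] that avoids [z] leaves the two given paths for the last time at some
    [u]. One new path follows a given path from [x] to [u] and then goes on to [z']; the other takes
    the remaining given path to [z] and the edge from [z] to [z']. *)
Lemma linked_twice_step x z z' :
  linked_twice x z -> g z z' -> z' != x -> z' != z -> connect (avoid z) x z' -> linked_twice x z'.
Proof.
move=> [q1 [q2 [P1 P2 U]]] gzz' z'x z'z /connectP [r0 Pr0 Er0].
case/shortenP: Pr0 Er0 => r Pr Ur _ Er.
have zr : z \notin r.
  apply/negP => zr; case/splitPr: zr Pr => r1 r2; rewrite cat_path /= => /andP [_ /andP [/and3P [_]]].
  by rewrite eqxx.
have {}Pr : path g x r by apply: sub_path Pr => u v /and3P [].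
have [r1 [u [r2 [E Au Hr2]]]] := @split_last_in _ (mem (x :: q1 ++ q2)) x r (mem_head _ _).
have [Pu Eu] : path g u r2 /\ last u r2 = z'.
  case: r1 E => [|y r1] /= [xu E]; first by rewrite -xu -E.
  move: Pr Er; rewrite E cat_path last_cat /= => /andP [_ /andP [_ ->]] ->; by split.
have zx : z != x by move: U; rewrite /= inE negb_or eq_sym => /andP [/andP []].
have zr2 : z \notin r2.
  apply/negP => z2; have : z \in x :: r by rewrite E mem_cat inE z2 !orbT.
  by rewrite inE (negPf zx) (negPf zr).
have Ur2 : uniq r2.
  have : uniq (x :: r) by [].
  by rewrite E cat_uniq => /and3P [_ _ /andP []].
have {}U : uniq (r2 ++ (x :: z :: q1 ++ q2)).
  apply: uniq_cat_notin => // w wr.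
  have wz : w != z by apply: contraNneq zr2 => <-.
  have : w \notin x :: q1 ++ q2 by exact: Hr2.
  by rewrite !in_cons !negb_or wz => /andP [-> ->].
(* The given paths play symmetric roles: [p1] is the one that carries [u], and [u = x] is
   allowed. *)
have key p1 p2 : path g x (rcons p1 z) -> path g x (rcons p2 z) ->
    uniq (r2 ++ x :: z :: p1 ++ p2) -> u \in x :: p1 -> linked_twice x z'.
  move=> Q1 Q2 Up up.
  have Q2' : path g x (rcons (rcons p2 z) z') by rewrite rcons_path Q2 last_rcons.
  (* If [r2] is empty, then [u] is [z'] and lies on [p1], which is cut there. *)
  case: (lastP r2) Pu Eu Up => [|r2' w].
    rewrite cat0s => _ Eu Up; move: up; rewrite -[u]/(last u [::]) Eu inE (negPf z'x) /= => up.
    case/splitPr: up Q1 Up => a b + Up; rewrite rcons_cat cat_path /= => /and3P [Pa La _].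
    exists a, (rcons p2 z); split=> //; first by rewrite rcons_path Pa.
    uniq_by Up.
  rewrite last_rcons => + Ew Up; rewrite {}Ew in Up * => Pu'.
  move: up; rewrite inE => /predU1P [ux|up].
    by exists r2', (rcons p2 z); rewrite -ux; split=> //; [rewrite ux|rewrite ux; uniq_by Up].
  case/splitPr: up Q1 Up => a b + Up; rewrite rcons_cat cat_path /= => /and3P [Pa La _].
  exists (a ++ u :: r2'), (rcons p2 z); split=> //; last by uniq_by Up.
  by rewrite rcons_cat cat_path /= Pa La.
move: Au; rewrite /= inE mem_cat orbA => /orP [Au|Au]; first by apply: (key q1 q2).
by apply: (key q2 q1); rewrite // ?inE ?Au ?orbT //; uniq_by U.
Qed.

Lemma connect_avoid_sym y : connect_sym (avoid y).
Proof. by apply: sym_connect_sym => u v /=; rewrite gsym andbCA. Qed.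

(** Menger's theorem for two paths: [linked_twice x] is propagated along a path from [x] to [s]. The
    detour around the current vertex [z] goes from [x] to [s] by hypothesis, then back to the
    successor of [z] along the rest of the path. *)
Lemma two_paths x s : x != s -> connect g x s ->
  (forall y, y != x -> y != s -> connect (avoid y) x s) -> linked_twice x s.
Proof.
move=> xs /connectP [p0 Pp0 Ep0] cut; case/shortenP: Pp0 Ep0 => p Pp Up _ Ep.
case: p Pp Up Ep => [|z p] /=; first by move=> _ _ E; rewrite E eqxx in xs.
case/andP=> gxz Pp /andP [xzp Uzp] Ep.
have {gxz} : linked_twice x z.
  exists [::], [::]; split; rewrite /= ?gxz // andbT inE.
  by move: xzp; rewrite inE negb_or => /andP [].
elim: p z Pp xzp Uzp Ep => [|z' p IH] z /=; first by move=> _ _ _ ->.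
case/andP=> gzz' Pp xzp /andP [zp Up] Ep L.
have xzp' : x \notin z' :: p by move: xzp; rewrite in_cons => /norP [].
apply: (IH z') => //.
move: (xzp) (zp); rewrite !inE !negb_or => /and3P [xz xz' xp] /andP [zz' zp'].
apply: linked_twice_step L gzz' _ _ _; rewrite 1?eq_sym //.
have zs : z != s by rewrite Ep; apply: contraNneq zp => ->; exact: mem_last.
apply: connect_trans (cut z _ zs) _; first by rewrite eq_sym.
rewrite connect_avoid_sym Ep; apply/connectP; exists p => //.
have : all (fun w => z != w) (z' :: p).
  by rewrite /= zz'; apply/allP => w wp; apply: contraNneq zp' => ->.
elim: p z' Pp {zz' zp' zp Up Ep xzp xzp' xz' xp IH} => //= w p IH z' /andP [gw Pp] /and3P [zz' zw A].
by rewrite gw andbT [z' == _]eq_sym zz' [w == _]eq_sym zw IH //= zw.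
Qed.

End TwoPaths.

(** * Fans from a vertex to two sets *)

Section Fan.
Variables (V : finType) (e : rel V).
Hypothesis e_sym : symmetric e.

Definition inside (A : {set V}) := [rel u v | [&& u \in A, v \in A & e u v]].

Lemma inside_sym A : symmetric (inside A).
Proof. by move=> u v /=; rewrite e_sym andbCA. Qed.

Lemma connect_inside_sym A : connect_sym (inside A).
Proof. exact/sym_connect_sym/inside_sym. Qed.

Lemma path_inside (A : {set V}) x p : x \in A -> path (inside A) x p = path e x p && all (mem A) p.
Proof.
elim: p x => //= y p IH x xA; rewrite xA /=; have [yA|] := boolP (y \in A); last by rewrite andbF.
by rewrite IH //= andbA.
Qed.

Lemma connect_insideP (A : {set V}) x y : x \in A ->
  reflect (exists p, [/\ path e x p, all (mem A) p, last x p = y & uniq (x :: p)])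
          (connect (inside A) x y).
Proof.
move=> xA; apply: (iffP connectP) => [[p Pp ->]|[p [Pp Ap <- _]]]; last first.
  by exists p; rewrite ?path_inside ?Pp.
by case/shortenP: Pp => q Pq Uq _; exists q; move: Pq; rewrite path_inside // => /andP [].
Qed.

(* Two new vertices stand for [P] and [Q] and a third one is joined to both, so that two disjoint paths
   from a vertex of [K] to that third vertex are a fan from it to [P] and [Q]. *)
Definition fan_graph (K P Q : {set V}) (u v : V + option bool) : bool := match u, v with
  | inl u, inl v => inside K u v
  | inl u, inr (Some c) | inr (Some c), inl u => (u \in K) && (u \in if c then P else Q)
  | inr (Some _), inr None | inr None, inr (Some _) => true
  | _, _ => false end.

Lemma fan_graph_sym K P Q : symmetric (fan_graph K P Q).
Proof. by move=> [u|[c|]] [v|[d|]] //=; rewrite e_sym andbCA. Qed.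

Lemma fan_graph_path K P Q q x : path (fan_graph K P Q) (inl x) (rcons q (inr None)) ->
  exists p c q', [/\ q = map inl p ++ inr (Some c) :: q', path e x p, all (mem K) p &
     last x p \in if c then P else Q].
Proof.
elim: q x => [|[y|[c|]] q IH] x //=.
  case/andP => /and3P [xK yK exy] /IH [p [c [q' [-> Pp Kp L]]]].
  by exists (y :: p), c, q'; rewrite /= exy yK.
by case/andP => /andP [xK xc] _; exists [::], c, q.
Qed.

(** Menger in [fan_graph]. Deleting one marker leaves the route through the other, deleting a vertex
    outside [K] destroys no edge inside [K], and the hypothesis handles the remaining vertices. The
    two paths use distinct markers because they are disjoint. *)
Lemma fan (K P Q : {set V}) x p0 q0 : x \in K ->
  p0 \in P -> connect (inside K) x p0 -> q0 \in Q -> connect (inside K) x q0 ->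
  (forall y, y \in K -> y != x -> exists2 z, z \in P :|: Q & connect (inside (K :\ y)) x z) ->
  exists p1 p2, [/\ path e x p1, path e x p2, all (mem K) (p1 ++ p2),
    last x p1 \in P /\ last x p2 \in Q & uniq (x :: p1 ++ p2)].
Proof.
move=> xK p0P cp q0Q cq cut; pose g := fan_graph K P Q.
have inK (A : {set V}) z : A \subset K -> x \in A -> connect (inside A) x z -> z \in K.
  move=> sAK xA /(connect_insideP _ xA) [p [_ Ap <- _]].
  by apply: (subsetP sAK); have := mem_last x p; rewrite inE => /predU1P [->|/(allP Ap)].
have lift (A : {set V}) (r : rel (V + option bool)) z : (forall u v, inside A u v -> r (inl u) (inl v)) ->
    connect (inside A) x z -> connect r (inl x) (inl z).
  move=> hr /connectP [p Pp ->]; apply/connectP; exists (map inl p); last by rewrite last_map.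
  by rewrite path_map; apply: sub_path Pp => u v /hr.
have end_ (r : rel (V + option bool)) z c : r (inl z) (inr (Some c)) -> r (inr (Some c)) (inr None) ->
    connect r (inl z) (inr None).
  by move=> r1 r2; apply: connect_trans (connect1 r1) (connect1 r2).
have xz : inl x != inr None :> V + option bool by [].
have [|y|q1 [q2 [P1 P2 U]]] := @two_paths _ g (@fan_graph_sym K P Q) _ _ xz.
- apply: connect_trans (lift _ g _ _ cp) (end_ _ _ true _ _) => //=.
  by rewrite (inK K) ?subxx.
- case: y => [y|[c|]] // yx _.
  + have [yK|yK] := boolP (y \in K); last first.
      apply: connect_trans (lift K _ _ _ cp) (end_ _ _ true _ _) => //=; last first.
        have p0K : p0 \in K by apply: inK cp.
        by rewrite p0P p0K !andbT; apply/eqP => -[E]; rewrite -E p0K in yK.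
      move=> u v /and3P [uK vK euv] /=; rewrite uK vK euv !andbT.
      by apply/andP; split; apply/eqP => -[E]; rewrite -E ?uK ?vK in yK.
    have yx' : y != x by apply: contraNneq yx => ->.
    have [z zPQ cz] := cut y yK yx'.
    have xKy : x \in K :\ y by rewrite !inE eq_sym yx'.
    have zK : z \in K by apply: inK cz => //; apply: subD1set.
    have zy : z != y.
      move: cz => /(connect_insideP _ xKy) [p [_ Ap <- _]].
      have := mem_last x p; rewrite inE => /predU1P [->|/(allP Ap)]; first by rewrite eq_sym.
      by rewrite !inE => /andP [].
    apply: connect_trans (lift (K :\ y) _ _ _ cz) _.
      move=> u v; rewrite /= !inE => /and3P [/andP [uy uK] /andP [vy vK] euv].
      by rewrite uK vK euv !andbT; apply/andP; split; apply/eqP => -[] /eqP; apply/negP.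
    have zy' : inl z != inl y :> V + option bool by apply: contraNneq zy => -[->].
    move: zPQ; rewrite inE => /orP [zP|zQ].
      by apply: (end_ _ _ true) => //=; rewrite zy' zK zP.
    by apply: (end_ _ _ false) => //=; rewrite zy' zK zQ.
  + case: c {yx}.
      apply: connect_trans (lift K _ _ _ cq) (end_ _ _ false _ _) => //=.
      by rewrite q0Q (inK K).
    apply: connect_trans (lift K _ _ _ cp) (end_ _ _ true _ _) => //=.
    by rewrite p0P (inK K).
have [p1 [c1 [q1' [E1 Pp1 Kp1 L1]]]] := fan_graph_path P1.
have [p2 [c2 [q2' [E2 Pp2 Kp2 L2]]]] := fan_graph_path P2.
have Um : uniq (inl x :: map inl p1 ++ inr (Some c1) :: map inl p2 ++ [:: inr (Some c2)] : seq (V + option bool)).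
  move: U; rewrite E1 E2 => U; uniq_by U.
have c12 : c1 != c2.
  apply/eqP => E; rewrite E in Um.
  have : uniq [:: inr (Some c2); inr (Some c2) : V + option bool] by uniq_by Um.
  by rewrite /= inE eqxx.
have Up : uniq (x :: p1 ++ p2).
  rewrite -(map_inj_uniq (f := inl : V -> V + option bool)); last by move=> ? ? [].
  rewrite map_cons map_cat; uniq_by Um.
case: c1 c2 L1 L2 c12 {E1 E2 Um} => [] [] // L1 L2 _.
  by exists p1, p2; split=> //; rewrite all_cat Kp1.
exists p2, p1; split=> //; first by rewrite all_cat Kp1 Kp2.
uniq_by Up.
Qed.
End Fan.

(** * Finite checks on the exceptional graphs *)

Definition adjE (E : seq (nat * nat)) : rel nat := fun i j => ((i, j) \in E) || ((j, i) \in E).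
Definition degE (g : nat * seq (nat * nat)) i := count (adjE g.2 i) (iota 0 g.1).
Definition exceptional : seq (nat * seq (nat * nat)) :=
  [:: (3, T1_E); (7, T2_E); (7, T3_E); (8, T4_E); (8, T5_E)].

Fixpoint simple_paths fuel (g : nat * seq (nat * nat)) vis i : seq (seq nat) :=
  if fuel is fuel'.+1 then
    [::] :: flatten [seq [seq j :: s | s <- simple_paths fuel' g (j :: vis) j]
                    | j <- iota 0 g.1 & adjE g.2 i j && (j \notin vis)]
  else [::].
(** Every candidate of [simple_paths] is checked again here, so nothing has to be proved about the
    enumeration. *)
Definition has_path g i j r := has (fun s => [&& path (adjE g.2) i s, last i s == j, uniq (i :: s),
  all (fun k => k < g.1) s & size s %% 4 == r]) (simple_paths g.1 g [:: i] i).

Lemma exceptional_deg2 : all (fun g => count (fun i => degE g i == 2) (iota 0 g.1) == 3) exceptional.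
Proof. by vm_compute. Qed.

(** These residues let a path inside an exceptional graph be chosen so that it completes an outside
    path to length 0 modulo 4. The triangle offers only lengths 1 and 2. *)
Lemma exceptional_paths :
  all (fun g => all (fun i => all (fun j => all (fun r =>
     if [&& i != j, degE g i == 2, degE g j == 2 & (r \in [:: 1; 2]) || (3 < g.1)]
     then has_path g i j r else true)
     (iota 0 4)) (iota 0 g.1)) (iota 0 g.1)) exceptional.
Proof. by vm_compute. Qed.

Definition add_vertex (g : nat * seq (nat * nat)) i j := (g.1.+1, [:: (i, g.1), (j, g.1) & g.2]).
(** [s] lists, for each vertex of [h], the vertex of [g] in its place. *)
Definition relabelled (g h : nat * seq (nat * nat)) (s : seq nat) :=
  if g.1 == h.1 then perm_eq s (iota 0 g.1) &&
    all (fun i => all (fun j => adjE h.2 i j == adjE g.2 (nth 0 s i) (nth 0 s j)) (iota 0 g.1)) (iota 0 g.1) else false.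
(* Joining a new vertex to one of degree 2 and one of larger degree closes a cycle of length divisible by 4,
   through a path of length 2 modulo 4, or leads to some T_i again, by one of the listed renumberings. *)
Lemma exceptional_extension :
  all (fun g => all (fun i => all (fun j =>
     if [&& degE g i != 2 & degE g j == 2] then if has_path g i j 2 then true else
       has (fun h => has (relabelled (add_vertex g i j) h)
        [:: [:: 0; 1; 2; 3; 4; 5; 6; 7]; [:: 1; 2; 0; 4; 5; 3; 6; 7]; [:: 2; 0; 1; 5; 3; 4; 6; 7];
         [:: 5; 4; 3; 1; 6; 7; 0; 2]; [:: 1; 0; 2; 5; 6; 7; 4; 3]]) exceptional else true)
      (iota 0 g.1)) (iota 0 g.1)) exceptional.
Proof. by vm_compute. Qed.

(* With at most 8 vertices, only cycles of length 4 and 8 have to be excluded; they extend a vertex by 3 and 7. *)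
Fixpoint no_closed_extension m (g : nat * seq (nat * nat)) first cur vis :=
  if m is m'.+1 then
    all (fun j => if adjE g.2 cur j && (j \notin vis) then no_closed_extension m' g first j (j :: vis) else true) (iota 0 g.1)
  else ~~ adjE g.2 cur first.
Lemma exceptional_acyclic :
  all (fun g => all (fun i => no_closed_extension 3 g i i [:: i] && no_closed_extension 7 g i i [:: i])
     (iota 0 g.1)) exceptional.
Proof. by vm_compute. Qed.

Lemma no_closed_extensionP m g i j vis s :
  no_closed_extension m g i j vis -> all (fun k => k < g.1) s -> size s = m ->
  path (adjE g.2) j s -> uniq s -> {in s, forall k, k \notin vis} -> ~~ adjE g.2 (last j s) i.
Proof.
elim: m j vis s => [|m IH] j vis [|k s] //= N /andP [kg sg] [sm] /andP [ejk P] /andP [ks U] D.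
have kv := D k (mem_head _ _).
move/allP: N => /(_ k); rewrite mem_iota kg ejk kv => /(_ erefl)/= N.
apply: IH N sg sm P U _ => l ls; rewrite inE negb_or D ?inE ?ls ?orbT // andbT.
by apply: contraNneq ks => <-.
Qed.

(** * Induced subgraphs with numbered vertices *)

Section Models.
Variables (V : finType) (e : rel V).
Hypotheses (e_sym : symmetric e) (e_irr : irreflexive e).

Definition nbh (W : {set V}) x := [set y in W | e x y].
Definition dg (W : {set V}) x := #|nbh W x|.
Definition deg2s (W : {set V}) := [set x in W | dg W x == 2].

Definition models (W : {set V}) (g : nat * seq (nat * nat)) (f : nat -> V) :=
  [/\ uniq (map f (iota 0 g.1)), W =i map f (iota 0 g.1) &
    forall i j, i < g.1 -> j < g.1 -> e (f i) (f j) = adjE g.2 i j].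
Definition is_exc W := exists g f, g \in exceptional /\ models W g f.

Lemma models_mem W g f x : models W g f -> reflect (exists2 i, i < g.1 & x = f i) (x \in W).
Proof.
case=> _ -> _; apply: (iffP mapP) => [[i]|[i ig ->]]; last by exists i; rewrite ?mem_iota.
by rewrite mem_iota => ig ->; exists i.
Qed.

Lemma models_inj W g f i j : models W g f -> i < g.1 -> j < g.1 -> f i = f j -> i = j.
Proof.
case=> U _ _ ig jg; have nthf k : k < g.1 -> f k = nth (f 0) (map f (iota 0 g.1)) k.
  by move=> kg; rewrite (nth_map 0) ?size_iota // nth_iota.
rewrite (nthf i) // (nthf j) // => /eqP; rewrite nth_uniq ?size_map ?size_iota // => /eqP.
by [].
Qed.

Lemma models_card W g f : models W g f -> #|W| = g.1.
Proof.
case=> U WE _; have -> : #|W| = #|map f (iota 0 g.1)| by apply: eq_card.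
by rewrite (card_uniqP U) size_map size_iota.
Qed.

Lemma models_count W g f (P : pred V) : models W g f ->
  #|[set x in W | P x]| = count (fun i => P (f i)) (iota 0 g.1).
Proof.
move=> [U WE _]; rewrite -count_map -size_filter -(card_uniqP (filter_uniq _ U)).
by apply: eq_card => x; rewrite inE mem_filter WE andbC.
Qed.

Lemma models_dg W g f i : models W g f -> i < g.1 -> dg W (f i) = degE g i.
Proof.
move=> M ig; rewrite /dg (models_count _ M); apply: eq_in_count => j; rewrite mem_iota => jg.
by case: M => _ _ ->.
Qed.

Lemma exc_deg2 W : is_exc W -> #|deg2s W| = 3.
Proof.
move=> [g [f [gT M]]]; rewrite (models_count _ M).
have /eqP <- := allP exceptional_deg2 g gT.
by apply: eq_in_count => i; rewrite mem_iota => /= ig; rewrite (models_dg M).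
Qed.

Lemma models_has_path W g f i j r : models W g f -> i < g.1 -> has_path g i j r ->
  exists s, [/\ path e (f i) s, last (f i) s = f j, all (mem W) s, uniq (f i :: s) & size s %% 4 = r].
Proof.
move=> M ig /hasP [s _ /and5P [P /eqP L U S /eqP Z]].
exists (map f s); rewrite size_map last_map L; split=> //.
- elim: s i ig P S {L U Z} => //= j' s IH i ig /andP [eij P] /andP [jg S].
  by rewrite (IH j') // andbT; case: M => _ _ ->.
- by rewrite all_map; apply/allP => k /(allP S) kg /=; apply/(models_mem _ M); exists k.
- rewrite -map_cons map_inj_in_uniq // => k l /= ks ls; apply: (models_inj M).
    by move: ks; rewrite inE => /predU1P [->|/(allP S)].
  by move: ls; rewrite inE => /predU1P [->|/(allP S)].
Qed.

Lemma exc_path W x y r : is_exc W -> x \in deg2s W -> y \in deg2s W -> x != y -> r < 4 ->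
  (r \in [:: 1; 2]) || (3 < #|W|) ->
  exists s, [/\ path e x s, last x s = y, all (mem W) s, uniq (x :: s) & size s %% 4 = r].
Proof.
move=> [g [f [gT M]]]; rewrite !inE => /andP [/(models_mem _ M) [i ig ->] di].
case/andP => /(models_mem _ M) [j jg ->] dj xy r4 C; apply: (models_has_path M) => //.
have := allP exceptional_paths g gT; move/allP/(_ i); rewrite mem_iota => /(_ ig).
move/allP/(_ j); rewrite mem_iota => /(_ jg); move/allP/(_ r); rewrite mem_iota => /(_ r4).
rewrite -(models_dg M ig) -(models_dg M jg) di dj !inE -(models_card M) C.
by have -> : i != j by apply: contraNneq xy => ->.
Qed.

Lemma models_relabelled W g f h s : models W g f -> relabelled g h s -> models W h (fun i => f (nth 0 s i)).
Proof.
move=> [U WE M]; rewrite /relabelled; case: eqP => // gh /andP [ps A].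
have ss : size s = h.1 by rewrite (perm_size ps) size_iota.
have E : map (fun i => f (nth 0 s i)) (iota 0 h.1) = map f s.
  by rewrite map_comp -ss -/(mkseq (nth 0 s) (size s)) mkseq_nth.
have sl i : i < h.1 -> nth 0 s i < g.1.
  by move=> ih; have := perm_mem ps (nth 0 s i); rewrite mem_nth ?ss // mem_iota => /esym.
split; first by rewrite E (perm_uniq (perm_map f ps)).
  by move=> x; rewrite E (perm_mem (perm_map f ps)).
move=> i j ih jh; rewrite M ?sl //; apply/esym/eqP.
by move/allP: A => /(_ i); rewrite mem_iota gh => /(_ ih) /allP /(_ j); rewrite mem_iota => /(_ jh).
Qed.

Lemma exc_extension W t p q : is_exc W -> t \notin W -> p \in W -> q \in deg2s W -> p \notin deg2s W ->
  (forall y, y \in W -> e t y = (y == p) || (y == q)) ->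
  (exists s, [/\ path e p s, last p s = q, all (mem W) s, uniq (p :: s) & size s %% 4 = 2]) \/ is_exc (t |: W).
Proof.
move=> [g [f [gT M]]] tW /(models_mem _ M) [i ig ->]; rewrite !inE.
case/andP => /(models_mem _ M) [j jg ->] dj; rewrite negb_and.
have -> /= : f i \in W by apply/(models_mem _ M); exists i.
move=> di tN; move: (allP exceptional_extension g gT) => /allP/(_ i); rewrite mem_iota => /(_ ig).
move/allP/(_ j); rewrite mem_iota => /(_ jg); rewrite -(models_dg M ig) -(models_dg M jg) ifT ?di ?dj //.
case: ifP => [|_ /hasP [h hT /hasP [s _ R]]]; first by move=> hp _; left; apply: models_has_path M _ hp.
(* The new vertex receives the first free number [g.1]. *)
right; exists h; pose f' k := if k == g.1 then t else f k; exists (fun i => f' (nth 0 s i)); split=> //.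
apply: models_relabelled R; have Ef : map f' (iota 0 g.1) = map f (iota 0 g.1).
  by apply/eq_in_map => k; rewrite mem_iota /f' => /andP [_ kg]; rewrite ltn_eqF.
have Ef' : map f' (iota 0 g.1.+1) = rcons (map f (iota 0 g.1)) t.
  by rewrite -addn1 iotaD map_cat Ef add0n /= cats1 /f' eqxx.
have [U WE Me] := M; split.
- by rewrite -[(add_vertex g i j).1]/(g.1.+1) Ef' rcons_uniq U -WE tW.
- by move=> x; rewrite -[(add_vertex g i j).1]/(g.1.+1) Ef' mem_rcons !inE WE.
move=> k l; rewrite /= !ltnS /f' /adjE !inE !xpair_eqE => kg lg.
(* The edge lists mention only numbers below [g.1], so no old edge involves the new vertex. *)
have ng m : (g.1, m) \in g.2 = false /\ (m, g.1) \in g.2 = false.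
  have : all (fun g => all (fun x => (x.1 < g.1) && (x.2 < g.1)) g.2) exceptional by [].
  move/allP/(_ g gT)/allP => B; split; apply/negP => /B /= /andP []; by rewrite ltnn.
have eft m : m < g.1 -> e t (f m) = (m == i) || (m == j).
  move=> mg; rewrite tN; last by apply/(models_mem _ M); exists m.
  by congr (_ || _); apply/eqP/eqP => [/(models_inj M)|->] //; apply.
case: ltngtP kg => // [kg|->] _; case: ltngtP lg => // [lg|->] _.
- by rewrite Me // !andbF.
- by rewrite e_sym eft // !andbT !andbF; case: (ng k) => -> ->; rewrite !orbF.
- by rewrite eft // !andbT !andbF; case: (ng l) => -> ->; rewrite !orbF.
by rewrite e_irr ![g.1 == _]eq_sym !(ltn_eqF ig, ltn_eqF jg); case: (ng g.1) => -> _.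
Qed.

(** There are at most eight vertices, so a length divisible by 4 is 4 or 8, the cases of
    [exceptional_acyclic]. *)
Lemma models_no_cycle W g f s : g \in exceptional -> models W g f -> all (mem W) s ->
  is_cycle e s -> ~~ (4 %| size s).
Proof.
move=> gT M sW [s3 Us Cs]; apply/negP => d4.
have [r [Er rg]] : exists r, s = map f r /\ all (fun k => k < g.1) r.
  elim: s sW {s3 Us Cs d4} => [|x s IH] /=; first by exists [::].
  case/andP=> /(models_mem _ M) [i ig ->] /IH [r [-> rg]]; exists (i :: r); split=> //=; by rewrite ig.
have [U WE Me] := M.
have Ur : uniq r by move: Us; rewrite Er; apply: map_uniq.
have sr : size s = size r by rewrite Er size_map.
have rn : size r <= g.1.
  rewrite -[g.1](size_iota 0); apply: uniq_leq_size => // k /(allP rg); by rewrite mem_iota.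
have g8 : g.1 <= 8 by have : all (fun g => g.1 <= 8) exceptional by []; move/allP; apply.
case: r Er rg Ur rn sr => [|i r] Er /=; first by move=> _ _ _ E; rewrite E in s3.
case/andP=> ig rg /andP [ir Ur] rn sr.
have P : path (adjE g.2) i r /\ adjE g.2 (last i r) i.
  move: Cs; rewrite Er /= rcons_path last_map => /andP [P L].
  have lg : last i r < g.1 by have := mem_last i r; rewrite inE => /predU1P [->//|/(allP rg)].
  rewrite -Me // L; split=> //; elim: r i ig rg P {Er ir Ur rn sr L lg} => //= k r IH i ig /andP [kg rg] /andP [E P].
  by rewrite -Me // E IH.
have D : {in r, forall k, k \notin [:: i]} by move=> k kr; rewrite inE; apply: contraNneq ir => <-.
move/allP: exceptional_acyclic => /(_ g gT) /allP /(_ i); rewrite mem_iota => /(_ ig) /andP [N3 N7].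
have : size r = 3 \/ size r = 7.
  have le8 : (size r).+1 <= 8 by apply: leq_trans g8.
  move: d4 s3 le8; rewrite sr => /dvdnP [k Ek] _.
  by case: k Ek => [|[|[|k]]] //; [case=> ->; left|case=> ->; right|move=> ->; rewrite !mulSn].
case=> z; [have := no_closed_extensionP N3 rg z | have := no_closed_extensionP N7 rg z];
  by case: P => P L => /(_ P Ur D); rewrite L.
Qed.
End Models.

(** * The search *)

(* In [(u, v, t) : edge] the type [t] of a path of length l from [u] to [v] is l modulo 4, except that
   t = 4 if l = 1; hence t = 1 means l >= 5.  A state has the vertices 0, ..., sn - 1; [sT] collects those
   of degree 2 in G[W] and [sC] some of degree 3. *)
Definition edge := (nat * nat * nat)%type.
Record state := State { sn : nat; sE : seq edge; sT : seq nat; sC : seq nat }.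

Definition lab t := if eqn t 4 then 1 else t.
(* [memn] and [eqn] reduce faster in the kernel than the generic [_ \in _] and [_ == _]. *)
Fixpoint memn x (s : seq nat) := if s is y :: s' then if eqn x y then true else memn x s' else false.

(* A set of residues modulo 4. *)
Inductive quad := Quad of bool & bool & bool & bool.
Definition getq '(Quad a b c d) k := match k with 0 => a | 1 => b | 2 => c | _ => d end.
Definition orq '(Quad a b c d) '(Quad a' b' c' d') := Quad (a || a') (b || b') (c || c') (d || d').
Definition rotq k '(Quad a b c d) :=
  match k with 0 => Quad a b c d | 1 => Quad d a b c | 2 => Quad c d a b | _ => Quad b c d a end.
Definition addq k q := orq q (rotq k (Quad true false false false)).
Definition add4 k t := match k + t with 4 => 0 | 5 => 1 | 6 => 2 | r => r end.

Definition step := (nat * nat * nat)%type.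
Definition entry := (nat * nat * seq nat)%type.
Fixpoint steps_from v j (E : seq edge) : seq step := if E is (a, b, t) :: E' then
    if eqn a v then (b, lab t, j) :: steps_from v j.+1 E'
    else if eqn b v then (a, lab t, j) :: steps_from v j.+1 E' else steps_from v j.+1 E'
  else [::].
(* The simple paths from a vertex, as triples of the end, the length modulo 4 and the edges used. *)
Fixpoint dfs fuel (A : seq (seq step)) vis v k ids (acc : seq entry) {struct fuel} : seq entry :=
  if fuel is fuel'.+1 then
    (fix go (l : seq step) acc := if l is (w, x, j) :: l' then
       go l' (if memn w vis then acc else dfs fuel' A (w :: vis) w (add4 k x) (j :: ids) acc)
       else acc) (nth [::] A v) ((v, k, ids) :: acc)
  else acc.
Definition entries n E u := dfs n [seq steps_from v 0 E | v <- iota 0 n] [:: u] u 0 [::] [::].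
Definition buckets n (l : seq entry) := [seq [seq (x.1.2, x.2) | x <- l & eqn x.1.1 w] | w <- iota 0 n].
Definition residues (l : seq (nat * seq nat)) := foldr (fun x m => addq x.1 m) (Quad false false false false) l.
Definition residues_off j (l : seq (nat * seq nat)) :=
  foldr (fun x m => if memn j x.2 then m else addq x.1 m) (Quad false false false false) l.
(* The types of a path that closes no cycle of length divisible by 4 with paths of the given residues. *)
Definition allowed '(Quad a b c d) :=
  let l := if b then [::] else [:: 3] in
  let l := if c then l else 2 :: l in
  let l := if d then l else [:: 1, 4 & l] in
  if a then l else 0 :: l.
(* The types of the two parts of a path of type [t] cut at an interior vertex; in [rests], of the second
   part when the cut is at the first interior vertex. *)
Definition pieces t : seq (nat * nat) := match t with
 | 0 => [:: (0,0); (1,3); (4,3); (2,2); (3,1); (3,4)]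
 | 1 => [:: (0,1); (0,4); (1,0); (4,0); (2,3); (3,2)]
 | 2 => [:: (0,2); (2,0); (1,1); (1,4); (4,1); (4,4); (3,3)]
 | 3 => [:: (0,3); (3,0); (1,2); (4,2); (2,1); (2,4)] | _ => [::] end.
Definition rests t := match t with 0 => [:: 3] | 1 => [:: 0] | 2 => [:: 1; 4] | _ => [:: 2] end.
(** Length 1 has type 4, so type 1 begins with length 5 and four interior vertices. *)
Definition least_interior t := match t with 0 => 3 | 1 => 4 | 2 => 1 | 3 => 2 | _ => 0 end.
Definition sdeg (E : seq edge) v :=
  foldr (fun '(a, b, _) d => if eqn a v then d.+1 else if eqn b v then d.+1 else d) 0 E.
Fixpoint remove_nth A i (l : seq A) :=
  if l is x :: l' then if i is i'.+1 then x :: remove_nth i' l' else l' else [::].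
(* Neighbours of vertices of degree 2 are cubic. *)
Definition forced T (E : seq edge) := flatten [seq (let: (u, v, t) := x in if eqn t 4 then
  (if memn u T then [:: v] else [::]) ++ (if memn v T then [:: u] else [::]) else [::]) | x <- E].
Definition mark n E T C := State n E T (forced T E ++ C).
(* All edges of G[W] at [w] are already present. *)
Definition saturated s w :=
  if memn w (sT s) then true else if memn w (sC s) then 3 <= sdeg (sE s) w else false.

(* The conditions under which [strong_exposure] applies: the ear then avoids [en] and [o], at the price
   of a new path to [o] of unknown type. *)
Definition strong_at s en o (rest : seq edge) :=
  (5 <= sn s + sumn [seq least_interior x.2 | x <- rest]) &&
  all (fun v => memn v (sT s) || (2 <= sdeg rest v)) [:: en; o].
(** A rerouted tail can have any type that closes no cycle of length divisible by 4 with a known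
    walk between [en] and [o]; the 1 accounts for the edge from [en] to [x]. The original tail has a
    type given by [rests]. *)
Definition tail_types s t en o rest so := if strong_at s en o rest
  then [seq q <- [:: 0; 1; 2; 3; 4] | ~~ getq (rotq 1 (rotq (lab q) so)) 0] else rests t.
(* Let [x] be the first interior vertex of a path of type [t] from [en] to [o], and [rest] the other edges.
   The path continues from [x] to [o] with type [q].  The possible events are
     [:: 0; q]                 x has degree 2;
     [:: 1; q; w; et]          an ear of type et from x to the vertex w;
     [:: 2; q; j; p; r; et]    an ear from x to an interior vertex of the j-th edge of rest, which it
                               divides into paths of types p and r;
     [:: 3; q; p; r; et]       an ear from x to an interior vertex of the path from x to o;
     [:: 4; q]                 x lies in a triangle with a vertex of degree 2, and q is the type of the
                               path from the third vertex of the triangle to o. *)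
Definition options_at s t en o (rest : seq edge) : seq (seq nat) :=
  let n := sn s in
  let strong := strong_at s en o rest in
  let budget := size (sT s) <= 2 in
  let ba := buckets n (entries n rest en) in let bb := buckets n (entries n rest o) in
  let so := residues (nth [::] ba o) in
  let mv := [seq (w, residues (nth [::] ba w), residues (nth [::] bb w)) | w <- iota 0 n &
     if saturated s w then false else if strong then ~~ (eqn w en || eqn w o) else true] in
  let mj := [seq (let: (c, d, t) := nth (0,0,4) rest j in
       (j, t, (residues_off j (nth [::] ba c), residues_off j (nth [::] bb c)),
              (residues_off j (nth [::] ba d), residues_off j (nth [::] bb d))))
       | j <- iota 0 (size rest) & ~~ eqn (nth (0,0,4) rest j).2 4] in
  (if budget && ~~ memn en (sT s) then
     [seq [:: 0; q] | q <- rests t & ~~ (eqn q 4 && memn o (sT s))] else [::]) ++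
  flatten [seq (let lq := lab q in
    flatten [seq (let: (w, m1, m2) := x in
       [seq [:: 1; q; w; et] | et <- allowed (orq (rotq 1 m1) (rotq lq m2)) &
          ~~ (eqn et 4 && (eqn w en || (eqn w o && eqn q 4)))]) | x <- mv] ++
    flatten [seq (let: (j, t, (c1, c2), (d1, d2)) := x in
       let mc := orq (rotq 1 c1) (rotq lq c2) in let md := orq (rotq 1 d1) (rotq lq d2) in
       flatten [seq [seq [:: 2; q; j; pr.1; pr.2; et] |
            et <- allowed (orq (rotq (lab pr.1) mc) (rotq (lab pr.2) md))] | pr <- pieces t]) | x <- mj] ++
    (if strong then [::] else
      flatten [seq [seq [:: 3; q; pr.1; pr.2; et] |
          et <- allowed (addq (lab pr.1) (rotq 1 (rotq (lab pr.2) so))) & ~~ (eqn et 4 && eqn pr.1 4)]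
        | pr <- pieces q]))
   | q <- tail_types s t en o rest so] ++
  (if strong && budget then
     [seq [:: 4; q] | q <- [:: 0; 1; 2; 3; 4] &
        ~~ (getq (rotq 2 (rotq (lab q) so)) 0 || getq (rotq 3 (rotq (lab q) so)) 0)] else [::]).

Definition child s en o rest (op : seq nat) : state :=
  let x := sn s in let T := sT s in let C := sC s in
  match op with
  | [:: 0; q] => mark x.+1 [:: (en, x, 4), (x, o, q) & rest] (x :: T) C
  | [:: 1; q; w; et] => mark x.+1 [:: (x, w, et), (en, x, 4), (x, o, q) & rest] T C
  | [:: 2; q; j; p; r; et] => let: (c, d, _) := nth (0,0,4) rest j in
     mark x.+2 [:: (x, x.+1, et), (en, x, 4), (x, o, q), (c, x.+1, p), (x.+1, d, r) & remove_nth j rest] T C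
  | [:: 3; q; p; r; et] => mark x.+2 [:: (x, x.+1, et), (en, x, 4), (x, x.+1, p), (x.+1, o, r) & rest] T C
  | [:: 4; q] => mark x.+3 [:: (en, x, 4), (x, x.+1, 4), (x, x.+2, 4), (x.+2, x.+1, 4), (x.+1, o, q) & rest]
                   (x.+2 :: T) [:: x, x.+1 & C]
  | _ => s
  end.

Definition sides s i (side : bool) : nat * nat :=
  let br := nth (0,0,4) (sE s) i in if side then (br.1.1, br.1.2) else (br.1.2, br.1.1).
Definition options s i side :=
  let: (en, o) := sides s i side in options_at s (nth (0,0,4) (sE s) i).2 en o (remove_nth i (sE s)).
Definition next s i side op :=
  let: (en, o) := sides s i side in child s en o (remove_nth i (sE s)) op.

(** Only single edges matter: parallel paths with interior vertices contribute distinct neighbours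
    to their ends. *)
Definition parallel (x y : edge) := let: (a, b, t) := x in let: (c, d, t') := y in
  if eqn t 4 then if eqn t' 4 then if eqn a c then eqn b d else if eqn a d then eqn b c else false else false else false.
Fixpoint no_parallel (E : seq edge) :=
  if E is x :: E' then if has (parallel x) E' then false else no_parallel E' else true.
(** Tested by [verify] at every node, so [child] need not be shown to preserve it. *)
Definition well_formed s :=
  [&& all (fun '(u, v, _) => [&& u < sn s, v < sn s & ~~ eqn u v]) (sE s), no_parallel (sE s) &
      all (fun t => 2 <= sdeg (sE s) t) (sT s)].

Definition underlying s : nat * seq (nat * nat) := (sn s, [seq x.1 | x <- sE s]).
(* The vertices of [T] are placed at the vertices of degree 2 of [h], those of [R] at the others. *)
Definition arrangement h (T R : seq nat) := foldr (fun i k T R => if eqn (degE h i) 2 then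
   head 0 T :: k (behead T) R else head 0 R :: k T (behead R)) (fun _ _ => [::]) (iota 0 h.1) T R.
Definition exceptional_state s := let g := underlying s in
  has (fun h => if eqn g.1 h.1 then has (relabelled g h)
    [seq arrangement h T R | T <- permutations (sT s), R <- permutations [seq w <- iota 0 (sn s) | ~~ memn w (sT s)]]
    else false) exceptional.
Definition final s :=
  [&& all (fun x => eqn x.2 4) (sE s),
      all (fun w => saturated s w && ((if memn w (sT s) then 2 else 3) <= degE (underlying s) w)) (iota 0 (sn s)) &
      exceptional_state s].

(* [Node i side ts] expands the [i]-th edge from the end given by [side]; the [ts] follow [options]. *)
Inductive tree := Leaf | Node of nat & bool & seq tree.
Fixpoint verify fuel t s := if fuel is fuel'.+1 then if well_formed s then
   match t with
   | Leaf => final s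
   | Node i side ts => if i < size (sE s) then if eqn (nth (0,0,4) (sE s) i).2 4 then false else
       all2 (fun t op => verify fuel' t (next s i side op)) ts (options s i side) else false
   end else false else false.

(* An expansion with the fewest options. *)
Definition choice s := foldl (fun best i => if eqn (nth (0,0,4) (sE s) i).2 4 then best else
    foldl (fun best side => match best with
       | Some (0, _, _) => best
       | Some (k, _, _) => let k' := size (options s i side) in if k <= k' then best else Some (k', i, side)
       | None => Some (size (options s i side), i, side) end) best [:: true; false]) None (iota 0 (size (sE s))).
Fixpoint search fuel s : tree := if fuel is fuel'.+1 then
   match choice s with
   | None => Leaf
   | Some (_, i, side) => Node i side [seq search fuel' (next s i side op) | op <- options s i side] end
  else Leaf.

(** The theta graph of a vertex of degree 2, numbered 2, its neighbours 0 and 1, and two paths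
    between these. *)
Definition start p q := mark 3 [:: (0, 1, p); (0, 1, q); (0, 2, 4); (2, 1, 4)] [:: 2] [::].
(* The pairs of types of two paths that close no cycle of length divisible by 4 with each other or with a
   path of length 2. *)
Definition starts := [seq start x.1 x.2 | x <- [:: (0,1); (0,3); (0,4); (1,1); (1,4); (3,3)]].

(* The search runs once, here; [verified] checks its result. *)
Definition trees := Eval vm_compute in [seq search 20 s | s <- starts].

Lemma verified : all2 (verify 20) trees starts.
Proof. by vm_compute. Qed.

(** * Soundness of the arithmetic on types and residues *)

Definition quad_bits '(Quad a b c d) := (a, b, c, d).
Definition bits_quad '(a, b, c, d) := Quad a b c d.
Lemma quad_bitsK : cancel quad_bits bits_quad. Proof. by case. Qed.
HB.instance Definition _ := Equality.copy quad (can_type quad_bitsK).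

Lemma memnE x s : memn x s = (x \in s).
Proof. by elim: s => //= y s ->; rewrite inE -eqnE; case: eqn. Qed.

Lemma add4E k t : k < 4 -> t < 4 -> add4 k t = (k + t) %% 4.
Proof. by case: k => [|[|[|[|k]]]] //; case: t => [|[|[|[|t]]]]. Qed.

Lemma lab_lt4 t : t < 5 -> lab t < 4.
Proof. by case: t => [|[|[|[|[|t]]]]]. Qed.

Lemma getq_orq k m1 m2 : getq (orq m1 m2) k = getq m1 k || getq m2 k.
Proof. by case: m1 m2 => [a b c d] [a' b' c' d']; case: k => [|[|[|k]]]. Qed.

Lemma getq_rotq j k m : j < 4 -> k < 4 -> getq (rotq j m) k = getq m ((k + (4 - j)) %% 4).
Proof. by case: m => a b c d; case: j => [|[|[|[|j]]]] //; case: k => [|[|[|[|k]]]]. Qed.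

Lemma getq_addq j k m : j < 4 -> k < 4 -> getq (addq j m) k = getq m k || (k == j).
Proof. by case: m => a b c d; case: j => [|[|[|[|j]]]] //; case: k => [|[|[|[|k]]]] //= _ _; rewrite ?orbT ?orbF. Qed.

(** One direction is enough: a set [m] that misses residues satisfying [P] merely leaves more
    options to the search. *)
Definition sound (m : quad) (P : nat -> Prop) := forall k, k < 4 -> getq m k -> P k.

Lemma sound_orq m1 m2 P : sound m1 P -> sound m2 P -> sound (orq m1 m2) P.
Proof. by move=> s1 s2 k k4; rewrite getq_orq => /orP [/s1|/s2]; apply. Qed.

Lemma sound_rotq j m (P P' : nat -> Prop) : j < 4 -> sound m P ->
  (forall k, k < 4 -> P k -> P' ((k + j) %% 4)) -> sound (rotq j m) P'.
Proof.
move=> j4 s H k k4; rewrite getq_rotq // => /s /(H _); rewrite ltn_mod => /(_ isT)/(_ isT).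
have -> // : ((k + (4 - j)) %% 4 + j) %% 4 = k.
by rewrite modnDml -addnA subnK 1?ltnW // modnDr modn_small.
Qed.

Lemma sound_addq j m (P : nat -> Prop) : j < 4 -> sound m P -> P j -> sound (addq j m) P.
Proof. by move=> j4 s Pj k k4; rewrite getq_addq // => /orP [/s|/eqP ->]; [apply|]. Qed.

Lemma sound_residues (l : seq (nat * seq nat)) (P : nat -> Prop) : (forall x, x \in l -> x.1 < 4 /\ P x.1) -> sound (residues l) P.
Proof.
elim: l => [|x l IHl] H /=; first by case=> [|[|[|k]]].
have [x4 Px] := H x (mem_head _ _); apply: sound_addq => //; apply: IHl => y yl.
by apply: H; rewrite inE yl orbT.
Qed.

Lemma sound_residues_off j (l : seq (nat * seq nat)) (P : nat -> Prop) : (forall x, x \in l -> j \notin x.2 -> x.1 < 4 /\ P x.1) ->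
  sound (residues_off j l) P.
Proof.
elim: l => [|x l IHl] H /=; first by case=> [|[|[|k]]].
have IH : sound (residues_off j l) P by apply: IHl => y yl; apply: H; rewrite inE yl orbT.
rewrite -/(residues_off j l) memnE; case jx: (j \in x.2) => //.
by have [x4 Px] := H x (mem_head _ _) (negbT jx); apply: sound_addq.
Qed.

(* [p] lists the interior vertices of the path. *)
Definition ty_of (V : Type) (p : seq V) := if p is [::] then 4 else (size p).+1 %% 4.

Lemma ty_of_lt5 (V : Type) (p : seq V) : ty_of p < 5.
Proof. by case: p => //= x p; apply: ltnW; rewrite ltnS ltn_mod. Qed.

Lemma ty_of4 (V : Type) (p : seq V) : (ty_of p == 4) = nilp p.
Proof. by case: p => //= x p; apply/eqP => E; have := ltn_pmod (size p).+2 (isT : 0 < 4); rewrite E. Qed.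

Lemma lab_ty (V : Type) (p : seq V) : lab (ty_of p) = (size p).+1 %% 4.
Proof. by rewrite /lab eqnE ty_of4; case: p. Qed.

Lemma ty_rev (V : Type) (p : seq V) : ty_of (rev p) = ty_of p.
Proof. by have := size_rev p; case: (rev p) => [|y r]; case: p => [|x p] //= [->]. Qed.

(** A type [t] is ruled out only if [m] contains the residue that completes [lab t] to 0 modulo
    4. *)
Lemma allowedP (V : Type) (c : seq V) m :
  sound m (fun k => (k + (size c).+1) %% 4 != 0) -> ty_of c \in allowed m.
Proof.
move=> s; have := lab_ty c; have := ty_of_lt5 c.
have {}s k : k < 4 -> getq m k -> (k + lab (ty_of c)) %% 4 != 0.
  by move=> k4 /(s k k4); rewrite lab_ty modnDmr.
have := s 0 isT; have := s 1 isT; have := s 2 isT; have := s 3 isT.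
case: m {s} => a b d g /=; case: (ty_of c) => [|[|[|[|[|]]]]] //= h3 h2 h1 h0 _ _.
- by case: a h0 => // /(_ isT).
- by case: g h3 => [/(_ isT)|] //; case: a {h0}; rewrite // !inE.
- by case: d h2 => [/(_ isT)|] //; case: g {h3}; case: a {h0}; rewrite // !inE.
- by case: b h1 => [/(_ isT)|] //; case: d {h2}; case: g {h3}; case: a {h0}; rewrite // !inE.
- by case: g h3 => [/(_ isT)|] //; case: a {h0}; rewrite // !inE.
Qed.

(** The lengths of the parts add up, so the type of the whole is determined by theirs and 25 pairs
    remain to be compared with the table. *)
Lemma piecesP (V : Type) (P1 P2 : seq V) z : (ty_of P1, ty_of P2) \in pieces (ty_of (P1 ++ z :: P2)).
Proof.
have E : ty_of (P1 ++ z :: P2) = (lab (ty_of P1) + lab (ty_of P2)) %% 4.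
  rewrite !lab_ty modnDm; case: P1 => [|y P1] /=; last by rewrite size_cat /= addSn.
  by rewrite addnC addn1.
rewrite E; have := ty_of_lt5 P1; have := ty_of_lt5 P2.
by case: (ty_of P1) => [|[|[|[|[|i]]]]] //; case: (ty_of P2) => [|[|[|[|[|j]]]]].
Qed.

Lemma restsP (V : Type) x (p : seq V) : ty_of p \in rests (ty_of (x :: p)).
Proof.
have -> : ty_of (x :: p) = (lab (ty_of p)).+1 %% 4 by rewrite lab_ty /= -[in RHS]addn1 modnDml addn1.
by have := ty_of_lt5 p; case: (ty_of p) => [|[|[|[|[|i]]]]].
Qed.

Lemma least_interiorP (V : Type) (p : seq V) : least_interior (ty_of p) <= size p.
Proof.
have le4 t : least_interior t <= 4 by case: t => [|[|[|[|t]]]].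
by case: p => //= x p; case: (size p) => [|[|[|n]]] //; apply: leq_trans (le4 _) _.
Qed.

Lemma remove_nth_perm (T : eqType) (x0 : T) i l : i < size l -> perm_eq l (nth x0 l i :: remove_nth i l).
Proof.
elim: l i => [|x l IHl] [|i] //= il; apply/permP => a; have /permP/(_ a) /= -> := IHl i il.
by rewrite addnCA.
Qed.

Lemma map_remove_nth (T U : Type) (h : T -> U) i l : map h (remove_nth i l) = remove_nth i (map h l).
Proof. by elim: l i => [|x l IHl] [|i] //=; rewrite IHl. Qed.

Lemma remove_nth_sub (T : eqType) i (l : seq T) : subseq (remove_nth i l) l.
Proof. by elim: l i => [|x l IHl] [|i] //=; [exact: subseq_cons|rewrite eqxx IHl]. Qed.

Section Graph.
Variables (V : finType) (e : rel V).
Hypotheses (e_sym : symmetric e) (e_irr : irreflexive e).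
Hypothesis zero_free : forall s, is_cycle e s -> ~~ (4 %| size s).

Notation nbh := (nbh e).
Notation dg := (dg e).
Notation deg2s := (deg2s e).
Notation is_exc := (is_exc e).
Notation inside := (inside e).

Lemma path_flip x p y : path e x (rcons p y) -> path e y (rcons (rev p) x).
Proof.
move=> P; have := rev_path e x (rcons p y); rewrite last_rcons belast_rcons rev_cons => ->.
by apply: sub_path P => u v; rewrite /= e_sym.
Qed.

(** [p] ends with [y] while [q] omits it, so [x :: p ++ q] has each vertex of the cycle once. A
    positive multiple of 4 is automatically at least 3. *)
Lemma no_zero_cycle x p y q : path e x p -> last x p = y -> path e x (rcons q y) ->
  uniq (x :: p ++ q) -> (size p + size q).+1 %% 4 != 0.
Proof.
move=> Pp Lp Pq U; apply/negP => Z.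
have s3 : 3 <= (size p + size q).+1.
  by move: Z; case: (_ + _) => [|[|k]].
have := zero_free (s := x :: p ++ rev q); rewrite /= size_cat size_rev -/(dvdn 4 _) /dvdn Z => /(_ _)/negP; apply=> //.
split.
- by rewrite /= size_cat size_rev.
- uniq_by U.
have := path_flip Pq; rewrite /= rcons_cat cat_path Pp Lp.
by [].
Qed.


Definition good (W : {set V}) :=
  [/\ W != set0, forall x, x \in W -> 2 <= dg W x & #|deg2s W| <= 3].

Lemma sub_nbh (A B : {set V}) x : A \subset B -> (forall y, y \in B -> e x y -> y \in A) -> nbh A x = nbh B x.
Proof.
move=> sAB H; apply/setP => y; rewrite !inE; apply/andP/andP => -[yA exy]; split=> //.
  exact: (subsetP sAB).
exact: H.
Qed.

Lemma nbh_mem (A : {set V}) x y : (y \in nbh A x) = (y \in A) && e x y.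
Proof. by rewrite inE. Qed.

Lemma dg2P (A : {set V}) x y : dg A x = 2 -> y \in A -> e x y ->
  exists z, [/\ z \in A, e x z, z != y & nbh A x = [set y; z]].
Proof.
move=> d yA exy; have yN : y \in nbh A x by rewrite inE yA.
have /eqP/cards1P [z E] : #|nbh A x :\ y| = 1 by move: d; rewrite /dg (cardsD1 y) yN => -[].
have : z \in nbh A x :\ y by rewrite E inE.
rewrite !inE => /and3P [zy zA exz]; exists z; split=> //.
by rewrite -(setD1K yN) E.
Qed.

Lemma dg3P (A : {set V}) x y z : dg A x = 3 -> y \in A -> e x y -> z \in A -> e x z -> z != y ->
  exists w, [/\ w \in A, e x w, w != y, w != z & nbh A x = [set y; z; w]].
Proof.
move=> d yA exy zA exz zy; have yN : y \in nbh A x by rewrite inE yA.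
have zN : z \in nbh A x :\ y by rewrite !inE zA zy.
have /eqP/cards1P [w E] : #|nbh A x :\ y :\ z| = 1.
  by move: d; rewrite /dg (cardsD1 y) yN (cardsD1 z) zN => -[].
have : w \in nbh A x :\ y :\ z by rewrite E inE.
rewrite !inE => /and4P [wz wy wA exw]; exists w; split=> //.
by rewrite -(setD1K yN) -(setD1K zN) E setUA.
Qed.

(** * The structure of a minimal counterexample *)

Section Minimal.
Variable W : {set V}.
Hypothesis Wgood : good W.
Hypothesis IH : forall W', good W' -> #|W'| < #|W| -> is_exc W'.
Hypothesis not_exc : ~ is_exc W.

Lemma W2 x : x \in W -> 2 <= dg W x. Proof. by case: Wgood => _ H _; apply: H. Qed.

Lemma small_good W' : good W' -> #|W'| < #|W| -> #|deg2s W'| = 3.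
Proof. by move=> g l; apply: exc_deg2; apply: IH. Qed.

Lemma small_few W' (D : {set V}) : W' != set0 -> W' \proper W -> (forall x, x \in W' -> 2 <= dg W' x) ->
  deg2s W' \subset D -> #|D| <= 2 -> False.
Proof.
move=> n0 p d2 sD D2; have le2 := leq_trans (subset_leq_card sD) D2.
have gd : good W' by split=> //; apply: leq_trans le2 _.
by have := small_good gd (proper_card p) => E; rewrite E in le2.
Qed.

(** Two disjoint sides with two vertices of degree 2 each would need four in [W]. *)
Lemma few_sides (A B : {set V}) : [disjoint A & B] ->
  #|A :&: deg2s W| <= 1 \/ #|B :&: deg2s W| <= 1.
Proof.
move=> dAB; have [_ _ W3] := Wgood.
have : #|(A :&: deg2s W) :|: (B :&: deg2s W)| <= 3.
  by apply: leq_trans W3; apply: subset_leq_card; rewrite -setIUl subsetIr.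
rewrite cardsU; have -> : (A :&: deg2s W) :&: (B :&: deg2s W) = set0.
  apply/setP => x; rewrite !inE; case xA: (x \in A) => //=.
  by rewrite (disjointFr dAB xA) andbF.
rewrite cards0; case: (leqP #|A :&: deg2s W| 1) => [|lA]; first by left.
by case: (leqP #|B :&: deg2s W| 1) => [|lB]; [right|arith].
Qed.

Lemma deg2s_mem (A : {set V}) x : (x \in deg2s A) = (x \in A) && (dg A x == 2).
Proof. by rewrite inE. Qed.

(** If [c] has two neighbours in [A], then [c |: A] is a smaller good set with at most two vertices
    of degree 2; if it has none, [A] is one. If it has a single neighbour [c'], either [A] still
    works or [c'] has degree 2 and takes over the role of [c] for the smaller side [A :\ c']. *)
Lemma pendant_side (A : {set V}) c : A != set0 -> A \subset W -> c \in W -> c \notin A ->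
  (forall x y, x \in A -> y \in W -> e x y -> y \in c |: A) ->
  #|A :&: deg2s W| <= 1 -> c |: A \proper W -> False.
Proof.
have [n] := ubnP #|A|; elim: n A c => // n IHn A c ltn A0 sA cW cA clo few p.
have sc : c |: A \subset W by apply: proper_sub.
have dA x : x \in A -> nbh (c |: A) x = nbh W x.
  by move=> xA; apply: sub_nbh => // y; apply: clo.
case: (leqP 2 (dg (c |: A) c)) => [dc|].
  apply: (@small_few _ (c |: (A :&: deg2s W)) _ p) => //.
  - by apply/set0Pn; exists c; rewrite !inE eqxx.
  - move=> x; rewrite !inE => /predU1P [->//|xA].
    by rewrite /dg dA //; apply/W2/(subsetP sA).
  - apply/subsetP => x; rewrite deg2s_mem !inE => /andP [/predU1P [->|xA]]; first by rewrite eqxx.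
    by rewrite /dg dA // xA (subsetP sA) // => ->; rewrite orbT.
  - by rewrite cardsU1; case: (_ \notin _); arith.
have pA : A \proper W by apply: sub_proper_trans p; apply: subsetUr.
have clA x : x \in A -> ~~ e x c -> nbh A x = nbh W x.
  move=> xA nxc; apply: sub_nbh => // y yW exy; have := clo x y xA yW exy.
  by rewrite !inE => /predU1P [E|//]; rewrite -E exy in nxc.
case d0 : (dg (c |: A) c) => [|[|//]] _.
  have dAc x : x \in A -> ~~ e x c.
    move=> xA; apply/negP => exc; have : x \in nbh (c |: A) c by rewrite !inE xA orbT e_sym.
    by move: (cards0_eq d0) => ->; rewrite inE.
  apply: (@small_few A (A :&: deg2s W)) => //.
  - by move=> x xA; rewrite /dg clA ?dAc //; apply/W2/(subsetP sA).
  - apply/subsetP => x; rewrite deg2s_mem => /andP [xA].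
    by rewrite /dg clA ?dAc // !inE xA (subsetP sA).
  - exact: leq_trans few _.
have /eqP/cards1P [c' Ec'] := d0.
have : c' \in nbh (c |: A) c by rewrite Ec' inE.
rewrite !inE => /andP [/predU1P [E|c'A] ecc']; first by rewrite E e_irr in ecc'.
have nec x : x \in A -> x != c' -> ~~ e x c.
  move=> xA xc'; apply/negP => exc; have : x \in nbh (c |: A) c by rewrite !inE xA orbT e_sym.
  by rewrite Ec' inE (negPf xc').
have dc' : dg W c' = (dg A c').+1.
  rewrite /dg -dA // (cardsD1 c) !inE eqxx e_sym ecc' /=; congr _.+1; apply: eq_card => y.
  by rewrite !inE; case: eqP => // ->; rewrite (negPf cA).
have c'W : c' \in W by apply: (subsetP sA).
case: (leqP 2 (dg A c')) => [d2|d1].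
  apply: (@small_few A (c' |: (A :&: deg2s W))) => //.
  - move=> x xA; have [->//|xc'] := eqVneq x c'; rewrite /dg clA ?nec //; exact/W2/(subsetP sA).
  - apply/subsetP => x; rewrite deg2s_mem => /andP [xA]; rewrite !inE.
    have [->//|xc'] := eqVneq x c'; by rewrite /dg clA ?nec // xA (subsetP sA).
  - by rewrite cardsU1; case: (_ \notin _); arith.
have dW : dg W c' = 2 by have := W2 c'W; rewrite dc' => ?; arith.
have c'2 : c' \in A :&: deg2s W by rewrite !inE c'A c'W dW eqxx.
have [z [zW ec'z zc _]] : exists z, [/\ z \in W, e c' z, z != c & nbh W c' = [set c; z]].
  by apply: dg2P => //; rewrite e_sym.
have zA : z \in A by have := clo c' z c'A zW ec'z; rewrite !inE (negPf zc).
have zc' : z != c' by apply: contraTneq ec'z => ->; rewrite e_irr.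
apply: (IHn (A :\ c') c') => //.
- by move: ltn; rewrite (cardsD1 c') c'A.
- by apply/set0Pn; exists z; rewrite !inE zc'.
- exact: subset_trans (subD1set _ _) sA.
- by rewrite !inE eqxx.
- move=> x y; rewrite !inE => /andP [xc' xA] yW exy; have := clo x y xA yW exy.
  rewrite !inE => /predU1P [E|->]; last by rewrite andbT orbN.
  by have := nec x xA xc'; rewrite -E exy.
- by apply: leq_trans _ few; apply/subset_leq_card/setSI/subD1set.
- by rewrite setD1K.
Qed.

Lemma isolated_side (A : {set V}) : A != set0 -> A \proper W ->
  (forall x y, x \in A -> y \in W -> e x y -> y \in A) -> #|A :&: deg2s W| <= 1 -> False.
Proof.
move=> A0 pA clo few; have sA := proper_sub pA.
have dA x : x \in A -> dg A x = dg W x.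
  by move=> xA; rewrite /dg (@sub_nbh A W) // => y; apply: clo.
apply: (@small_few A (A :&: deg2s W)) => //.
- by move=> x xA; rewrite dA //; apply/W2/(subsetP sA).
- by apply/subsetP => x; rewrite deg2s_mem => /andP [xA]; rewrite dA // !inE xA (subsetP sA).
- exact: leq_trans few _.
Qed.

Definition component (A : {set V}) x := [set y in A | connect (inside A) x y].

Lemma component_closed (A : {set V}) x y z : y \in component A x -> z \in A -> e y z -> z \in component A x.
Proof.
rewrite !inE => /andP [yA cy] zA eyz; rewrite zA; apply: connect_trans cy (connect1 _).
by rewrite /= yA zA.
Qed.

Lemma W_connected x y : x \in W -> y \in W -> connect (inside W) x y.
Proof.
move=> xW yW; apply/negPn/negP => nxy; pose A := component W x.
have xA : x \in A by rewrite inE xW connect0.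
have yA : y \notin A by rewrite inE yW.
have sA : A \subset W by apply/subsetP => z; rewrite inE => /andP [].
have clo u v : u \in A -> v \in W -> e u v -> v \in A by apply: component_closed.
have dAB : [disjoint A & W :\: A] by rewrite disjoint_sym disjoints_subset; apply/subsetP => z; rewrite !inE => /andP [].
case: (few_sides dAB) => few.
  apply: isolated_side few => //; first by apply/set0Pn; exists x.
  by rewrite properE sA; apply/subsetPn; exists y.
apply: isolated_side few => //; first by apply/set0Pn; exists y; rewrite in_setD yA.
  by rewrite properE subsetDl; apply/subsetPn; exists x; rewrite // in_setD xA.
move=> u v; rewrite !in_setD => /andP [uA uW] vW euv; rewrite vW andbT; apply: contra uA => vA.
by apply: clo vA uW _; rewrite e_sym.
Qed.

(** A component of [W :\ c] and the union of the others would be two sides attached at [c]; one of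
    them has at most one vertex of degree 2, which [pendant_side] excludes. *)
Lemma W_minus_connected c x y : x \in W -> y \in W -> x != c -> y != c -> connect (inside (W :\ c)) x y.
Proof.
move=> xW yW xc yc; case cW: (c \in W); last first.
  have -> : W :\ c = W by apply/setP => z; rewrite !inE; case: eqP => // ->; rewrite cW.
  exact: W_connected.
apply/negPn/negP => nxy; pose A := component (W :\ c) x; pose B := (W :\ c) :\: A.
have xA : x \in A by rewrite !inE xc xW connect0.
have yA : y \notin A by rewrite !inE yc yW.
have yB : y \in B by rewrite /B in_setD yA !inE yc yW.
have xB : x \notin B by rewrite /B in_setD xA.
have sA : A \subset W :\ c by apply/subsetP => z; rewrite inE => /andP [].
have sB : B \subset W :\ c by apply: subsetDl.
have sW : W :\ c \subset W by apply: subD1set.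
have nc (S : {set V}) : S \subset W :\ c -> c \notin S.
  by move=> sS; apply/negP => /(subsetP sS); rewrite !inE eqxx.
have cloA u v : u \in A -> v \in W -> e u v -> v \in c |: A.
  move=> uA vW euv; rewrite in_setU1; have [//|vc] := eqVneq v c.
  by apply: component_closed uA _ euv; rewrite !inE vc.
have cloB u v : u \in B -> v \in W -> e u v -> v \in c |: B.
  rewrite in_setU1 /B in_setD => /andP [uA uWc] vW euv; have [//|vc] := eqVneq v c.
  have vWc : v \in W :\ c by rewrite in_setD1 vc.
  rewrite in_setD vWc andbT /=; apply: contra uA => vA.
  by apply: component_closed vA uWc _; rewrite e_sym.
have dAB : [disjoint A & B] by rewrite disjoint_sym disjoints_subset; apply/subsetP => z; rewrite in_setC in_setD => /andP [].
have pr (S : {set V}) z : S \subset W :\ c -> z \in W -> z != c -> z \notin S -> c |: S \proper W.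
  move=> sS zW zc zS; rewrite properE subUset sub1set cW (subset_trans sS sW) /=.
  by apply/subsetPn; exists z; rewrite // in_setU1 negb_or zc.
case: (few_sides dAB) => few.
  apply: (pendant_side (A := A) (c := c)) few _ => //; first by apply/set0Pn; exists x.
  - exact: subset_trans sA sW.
  - exact: nc.
  - exact: (pr A y).
apply: (pendant_side (A := B) (c := c)) few _ => //; first by apply/set0Pn; exists y.
- exact: subset_trans sB sW.
- exact: nc.
- exact: (pr B x).
Qed.

Lemma connect_closed (A S : {set V}) x y : connect (inside A) x y -> x \in S ->
  (forall u v, u \in S -> v \in A -> e u v -> v \in S) -> y \in S.
Proof.
move=> /connectP [p Pp ->] xS clo; elim: p x xS Pp => //= z p IHp x xS /andP [/and3P [_ zA exz] Pp].
by apply: IHp Pp; apply: clo exz.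
Qed.

Lemma no_cut_vertex (S : {set V}) c x y : x \in S -> x \in W -> c \notin S -> y \in W -> y \notin S -> y != c ->
  (forall u v, u \in S -> v \in W -> e u v -> v \in c |: S) -> False.
Proof.
move=> xS xW cS yW yS yc clo; have xc : x != c by apply: contraNneq cS => <-.
have := connect_closed (W_minus_connected xW yW xc yc) xS; rewrite (negPf yS) => H.
suff: false by []. apply: H => u v uS; rewrite in_setD1 => /andP [vc vW] euv.
by have := clo u v uS vW euv; rewrite in_setU1 (negPf vc).
Qed.

Lemma dgD (S : {set V}) x : S \subset W -> dg (W :\: S) x + dg S x = dg W x.
Proof.
move=> sS; rewrite /dg -(cardsID (nbh S x) (nbh W x)) addnC; congr (_ + _); apply: eq_card => y; rewrite !inE.
  by case yS: (y \in S); rewrite /= ?andbF // (subsetP sS) // andbb.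
by case yS: (y \in S) => //=; case: (y \in W); case: (e x y).
Qed.

Lemma dgU1 t (S : {set V}) x : t \notin S -> dg (t |: S) x = e x t + dg S x.
Proof.
move=> tS; rewrite /dg (cardsD1 t) !inE eqxx /=; congr (_ + _); apply: eq_card => y; rewrite !inE.
by case: eqP => //= ->; rewrite (negPf tS).
Qed.

Lemma dg_set1 t x : dg [set t] x = e x t.
Proof.
have := @dgU1 t set0 x; rewrite setU0 inE => /(_ isT) ->; rewrite /dg.
by have -> : nbh set0 x = set0; [apply/setP => y; rewrite !inE|rewrite cards0 addn0].
Qed.

Lemma dgD1 t x : t \in W -> dg (W :\ t) x + e x t = dg W x.
Proof.
move=> tW; rewrite -(@dgD [set t]) ?sub1set //; congr (_ + _).
rewrite /dg; case ext: (e x t).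
  by apply/esym/eqP/cards1P; exists t; apply/setP => y; rewrite !inE; case: eqP => // ->.
by apply/esym/eqP; rewrite cards_eq0; apply/eqP/setP => y; rewrite !inE; case: eqP => // ->.
Qed.

Lemma card_le3_eq (D : {set V}) x y z : x \in D -> y \in D -> z \in D -> x != y -> x != z -> y != z ->
  #|D| <= 3 -> D = [set x; y; z].
Proof.
move=> xD yD zD xy xz yz D3; apply/esym/eqP; rewrite eqEcard; apply/andP; split.
  by rewrite !subUset !sub1set xD yD zD.
by apply: leq_trans D3 _; rewrite setUC cardsU1 cards2 xy !inE negb_or ![z == _]eq_sym xz yz.
Qed.

Lemma triangle_exc x y z : e x y -> e y z -> e z x -> W = [set x; y; z] -> is_exc W.
Proof.
move=> exy eyz ezx WE; exists (3, T1_E), (nth x [:: x; y; z]); split=> //.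
have xy : x != y by apply: contraTneq exy => ->; rewrite e_irr.
have yz : y != z by apply: contraTneq eyz => ->; rewrite e_irr.
have zx : z != x by apply: contraTneq ezx => ->; rewrite e_irr.
split.
- by rewrite /= !inE negb_or xy eq_sym zx yz.
- by move=> u; rewrite WE !inE orbA.
by move=> [|[|[|i]]] [|[|[|j]]] //= _ _; rewrite ?e_irr // ?exy ?eyz ?ezx // e_sym ?exy ?eyz ?ezx.
Qed.

Lemma deg2s_sub (x : V) : x \in deg2s W -> x \in W.
Proof. by rewrite deg2s_mem => /andP []. Qed.

Lemma deg2s_dg (x : V) : x \in deg2s W -> dg W x = 2.
Proof. by rewrite deg2s_mem => /andP [_ /eqP]. Qed.

Lemma edge_neq x y : e x y -> x != y.
Proof. by apply: contraTneq => ->; rewrite e_irr. Qed.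

(** The path [p], [t1], [t2] takes up all vertices of degree 2. If the outer neighbour [p'] of [p]
    is [q], then [q] is a cut vertex; otherwise deleting the path leaves minimum degree 2, with
    degree 2 at most at [q] and [p']. *)
Lemma adjacent_deg2_aux t1 t2 p q : t1 \in deg2s W -> t2 \in deg2s W -> nbh W t1 = [set t2; p] ->
  nbh W t2 = [set t1; q] -> p != t2 -> q != t1 -> p != q -> p \in deg2s W -> False.
Proof.
move=> t1D t2D N1 N2 pt2 qt1 pq pD; have [_ _ W3] := Wgood.
have : t2 \in nbh W t1 by rewrite N1 !inE eqxx.
rewrite nbh_mem => /andP [t2W e12].
have : p \in nbh W t1 by rewrite N1 !inE eqxx orbT.
rewrite nbh_mem => /andP [pW e1p].
have : q \in nbh W t2 by rewrite N2 !inE eqxx orbT.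
rewrite nbh_mem => /andP [qW e2q].
have n12 := edge_neq e12. have n1p := edge_neq e1p. have n2q := edge_neq e2q.
have D3 : deg2s W = [set t1; t2; p] by apply: card_le3_eq => //; rewrite eq_sym.
have [p' [p'W epp' p't1 Np]] : exists z, [/\ z \in W, e p z, z != t1 & nbh W p = [set t1; z]].
  by apply: dg2P; rewrite ?deg2s_dg ?(deg2s_sub t1D) // e_sym.
have p't2 : p' != t2.
  apply: contraNneq pq => E; have : p \in nbh W t2 by rewrite nbh_mem pW e_sym -E.
  by rewrite N2 !inE eq_sym (negPf n1p).
have p'p := edge_neq epp'.
have nD x : x \in W -> x \notin [set t1; t2; p] -> 3 <= dg W x.
  move=> xW; rewrite -D3 deg2s_mem xW /= => x2; have := W2 xW; rewrite leq_eqVlt eq_sym (negPf x2).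
  by [].
have qn : q \notin [set t1; t2; p] by rewrite !inE !negb_or qt1 eq_sym n2q eq_sym.
have t1W := deg2s_sub t1D.
have [E|p'q] := eqVneq p' q.
  have [y yW] : exists2 y, y \in W & [&& e q y, y != t2 & y != p].
    have := nD q qW qn; rewrite /dg (cardsD1 t2) (cardsD1 p) => H.
    have /card_gt0P [y] : 0 < #|nbh W q :\ t2 :\ p| by arith.
    by rewrite !inE => /and4P [yp yt yW eqy]; exists y => //; rewrite eqy yt.
  case/and3P => eqy yt2 yp; have yt1 : y != t1.
    apply: contraTneq eqy => ->; rewrite e_sym; apply/negP => e1q.
    have : q \in nbh W t1 by rewrite nbh_mem qW.
    by rewrite N1 !inE [q == t2]eq_sym (negPf n2q) eq_sym (negPf pq).
  apply: (@no_cut_vertex [set t1; t2; p] q t1 y) => //; rewrite ?inE ?eqxx //.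
  - by rewrite !negb_or yt1 yt2 yp.
  - by rewrite eq_sym edge_neq.
  move=> u v; rewrite !inE => /orP [/orP [] /eqP ->|/eqP ->] vW euv.
  - have : v \in nbh W t1 by rewrite nbh_mem vW.
    by rewrite N1 !inE => /orP [] ->; rewrite ?orbT.
  - have : v \in nbh W t2 by rewrite nbh_mem vW.
    by rewrite N2 !inE => /orP [] ->; rewrite ?orbT.
  - have : v \in nbh W p by rewrite nbh_mem vW.
    by rewrite Np !inE E => /orP [] ->; rewrite ?orbT.
have sS : [set t1; t2; p] \subset W by rewrite !subUset !sub1set t1W t2W.
have p'n : p' \notin [set t1; t2; p] by rewrite !inE !negb_or p't1 p't2 eq_sym.
have dS x : x \in W :\: [set t1; t2; p] -> dg [set t1; t2; p] x = (x == q) + (x == p').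
  rewrite in_setD => /andP [xS xW].
  rewrite /dg; have -> : nbh [set t1; t2; p] x = (if x == q then [set t2] else set0) :|: (if x == p' then [set p] else set0).
    apply/setP => y; rewrite nbh_mem; apply/andP/idP => [[]|].
      rewrite !inE => /orP [/orP [] /eqP ->|/eqP ->]; rewrite e_sym => ex.
      + have : x \in nbh W t1 by rewrite nbh_mem xW.
        by rewrite N1 => H; case/negP: xS; move: H; rewrite !inE => /orP [] ->; rewrite ?orbT.
      + have : x \in nbh W t2 by rewrite nbh_mem xW.
        rewrite N2 !inE => /orP [] /eqP E; first by rewrite E !inE eqxx in xS.
        by rewrite E eqxx inE eqxx.
      + have : x \in nbh W p by rewrite nbh_mem xW.
        rewrite Np !inE => /orP [] /eqP E; first by rewrite E !inE eqxx in xS.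
        by rewrite E eqxx inE eqxx orbT.
    rewrite in_setU => /orP []; case: eqP; rewrite ?inE // => -> /eqP ->; rewrite ?inE eqxx ?orbT; split=> //; by rewrite e_sym.
  by case: (x == q); case: (x == p'); rewrite ?setU0 ?set0U ?cards0 ?cards1 // cards2 eq_sym pt2.
apply: (@small_few (W :\: [set t1; t2; p]) [set q; p']).
- by apply/set0Pn; exists q; rewrite in_setD qn.
- by rewrite properE subsetDl; apply/subsetPn; exists t1; rewrite // !inE eqxx.
- move=> x xS; have := dgD x sS; rewrite dS //; move: xS; rewrite in_setD => /andP [xn xW].
  have := nD x xW xn; case: (eqVneq x q) => [->|_]; case: eqVneq => [E|_] /=; rewrite ?E ?eqxx // in p'q *; arith.
- apply/subsetP => x; rewrite deg2s_mem => /andP [xS /eqP d2]; have := dgD x sS; rewrite dS // d2.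
  move: xS; rewrite in_setD !inE => /andP [xn xW]; have := nD x xW; rewrite !inE xn => /(_ isT).
  by case: (x == q); case: (x == p') => //=; arith.
by rewrite cards2; case: (_ != _).
Qed.

(** The graph left over is exceptional and has exactly three vertices of degree 2, while [D] has at
    most three elements. So every vertex that may have dropped to degree 2 has done so. *)
Lemma deg2s_remove (S D : {set V}) : S \subset W -> S != set0 -> W :\: S != set0 ->
  (forall x, x \in W :\: S -> 2 <= dg (W :\: S) x) -> deg2s (W :\: S) \subset D -> #|D| <= 3 ->
  is_exc (W :\: S) /\ D = deg2s (W :\: S).
Proof.
move=> sS S0 n0 d2 sD D3.
have gd : good (W :\: S) by split=> //; apply: leq_trans D3; apply: subset_leq_card.
have lt : #|W :\: S| < #|W|.
  apply: proper_card; rewrite properE subsetDl; case/set0Pn: S0 => x xS.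
  by apply/subsetPn; exists x; rewrite ?(subsetP sS) // in_setD xS.
have exc := IH gd lt; split=> //; apply/esym/eqP; rewrite eqEcard sD.
by rewrite (exc_deg2 exc).
Qed.

(** If the other neighbours [p] and [q] coincide, [p] is a cut vertex or [W] a triangle. Otherwise
    deleting [t1] and [t2] leaves an exceptional graph in which [p] and [q] have degree 2; it joins
    them by a path of length 1 modulo 4, which the path of length 3 through [t1] and [t2] closes. *)
Lemma adjacent_deg2 t1 t2 : t1 \in deg2s W -> t2 \in deg2s W -> ~~ e t1 t2.
Proof.
move=> t1D t2D; apply/negP => e12; have [_ _ W3] := Wgood.
have t1W := deg2s_sub t1D; have t2W := deg2s_sub t2D.
have e21 : e t2 t1 by rewrite e_sym.
have n12 := edge_neq e12.
have [p [pW e1p pt2 N1]] := dg2P (deg2s_dg t1D) t2W e12.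
have [q [qW e2q qt1 N2]] := dg2P (deg2s_dg t2D) t1W e21.
have n1p := edge_neq e1p; have n2q := edge_neq e2q.
have sS : [set t1; t2] \subset W by rewrite subUset !sub1set t1W.
have clo u v : u \in [set t1; t2] -> v \in W -> e u v -> v \in [set t1; t2; p; q].
  rewrite !inE => /orP [] /eqP -> vW euv.
    have : v \in nbh W t1 by rewrite nbh_mem vW.
    by rewrite N1 !inE => /orP [] ->; rewrite ?orbT.
  have : v \in nbh W t2 by rewrite nbh_mem vW.
  by rewrite N2 !inE => /orP [] ->; rewrite ?orbT.
have [E|pq] := eqVneq p q.
  apply: not_exc; apply: (@triangle_exc t1 t2 p) => //; first by rewrite E.
    by rewrite e_sym.
  apply/eqP; rewrite eqEsubset !subUset !sub1set t1W t2W pW !andbT; apply/subsetP => y yW.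
  apply/negPn/negP; rewrite !inE !negb_or => /andP [/andP [y1 y2] yp].
  apply: (@no_cut_vertex [set t1; t2] p t1 y) => //; rewrite ?inE ?eqxx ?negb_or ?y1 //.
    by rewrite eq_sym n1p.
  move=> u v uS vW euv; have := clo u v uS vW euv; rewrite -E !inE.
  by case: (v == t1); case: (v == t2); case: (v == p).
have pD : p \notin deg2s W by apply/negP => pD; apply: (adjacent_deg2_aux t1D t2D N1 N2).
have qD : q \notin deg2s W.
  by apply/negP => qD; apply: (adjacent_deg2_aux t2D t1D N2 N1); rewrite // eq_sym.
have d3 x : x \in W -> x \notin deg2s W -> 3 <= dg W x.
  move=> xW; rewrite deg2s_mem xW /= => x2; have := W2 xW; rewrite leq_eqVlt eq_sym (negPf x2).
  by [].
have dS x : x \in W :\: [set t1; t2] -> dg [set t1; t2] x = (x == p) + (x == q).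
  rewrite in_setD !inE => /andP [/norP [x1 x2] xW].
  rewrite dgU1 ?inE // dg_set1.
  congr (nat_of_bool _ + nat_of_bool _).
    have : x \in nbh W t1 = (x \in [set t2; p]) by rewrite N1.
    by rewrite nbh_mem xW !inE (negPf x2) e_sym.
  have : x \in nbh W t2 = (x \in [set t1; q]) by rewrite N2.
  by rewrite nbh_mem xW !inE (negPf x1) e_sym.
have pS : p \in W :\: [set t1; t2] by rewrite in_setD !inE negb_or eq_sym n1p pt2.
have qS : q \in W :\: [set t1; t2] by rewrite in_setD !inE negb_or qt1 eq_sym n2q.
have [|||||exc D] := @deg2s_remove [set t1; t2] (p |: (q |: (deg2s W :\: [set t1; t2]))) sS.
- by apply/set0Pn; exists t1; rewrite !inE eqxx.
- by apply/set0Pn; exists p.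
- move=> x xS; have := dgD x sS; rewrite dS //.
  have xW : x \in W by move: xS; rewrite in_setD => /andP [].
  have [xp|_] := eqVneq x p; have [xq|_] := eqVneq x q => /=; have := W2 xW; try arith.
  + by move: pq; rewrite -xp -xq eqxx.
  + by have := d3 x xW; rewrite xp => /(_ pD); arith.
  + by have := d3 x xW; rewrite xq => /(_ qD); arith.
- apply/subsetP => x; rewrite deg2s_mem => /andP [xS /eqP d2]; have := dgD x sS; rewrite dS // d2.
  rewrite !in_setU1; case: (x == p) => //; case: (x == q) => //= /esym d2W.
  by rewrite in_setD deg2s_mem; move: xS; rewrite in_setD => /andP [-> ->]; rewrite d2W.
- have : #|deg2s W :\: [set t1; t2]| <= 1.
    have := cardsID [set t1; t2] (deg2s W); have -> : deg2s W :&: [set t1; t2] = [set t1; t2].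
      by apply/setIidPr; rewrite subUset !sub1set t1D.
    by rewrite cards2 n12; arith.
  rewrite !cardsU1; case: (p \notin _); case: (q \notin _); arith.
have pD' : p \in deg2s (W :\: [set t1; t2]) by rewrite -D !inE eqxx.
have qD' : q \in deg2s (W :\: [set t1; t2]) by rewrite -D !inE eqxx orbT.
have [s [Ps Ls As Us Zs]] : exists s, [/\ path e p s, last p s = q, all (mem (W :\: [set t1; t2])) s, uniq (p :: s) & size s %% 4 = 1].
  by apply: (exc_path exc).
have nt t : t \in [set t1; t2] -> t \notin p :: s.
  move=> tS; apply/negP; rewrite inE => /predU1P [E|/(allP As)]; last by rewrite /= in_setD tS.
  by move: pS; rewrite -E in_setD tS.
have Pq : path e p (rcons [:: t1; t2] q) by rewrite /= e12 e2q e_sym e1p.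
have U : uniq ((p :: s) ++ [:: t1; t2]).
  apply: uniq_cat_notin => //; first by rewrite /= inE n12.
  by move=> x; apply: contraL => xt; apply: nt; move: xt; rewrite !inE.
by have := no_zero_cycle Ps Ls Pq U; rewrite addn2 -addn3 -modnDml Zs.
Qed.

(** If [p] had degree at least 4, deleting [t] would leave an exceptional graph in which the other
    neighbour [q] of [t] has degree 2 and [p] has not. By [exc_extension], restoring [t] closes a
    cycle of length divisible by 4 or makes [W] exceptional. *)
Lemma deg2_nbr_cubic t p : t \in deg2s W -> p \in W -> e t p -> dg W p = 3.
Proof.
move=> tD pW etp; have [_ _ W3] := Wgood; have tW := deg2s_sub tD.
have [q [qW etq qp N]] := dg2P (deg2s_dg tD) pW etp.
have nD y : e t y -> y \notin deg2s W.
  by move=> ety; apply/negP => yD; have := adjacent_deg2 tD yD; rewrite ety.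
have d3 x : x \in W -> x \notin deg2s W -> 3 <= dg W x.
  move=> xW; rewrite deg2s_mem xW /= => x2; have := W2 xW; rewrite leq_eqVlt eq_sym (negPf x2).
  by [].
apply/eqP/negPn/negP => dp; have dp4 : 4 <= dg W p.
  by have := d3 p pW (nD p etp); rewrite leq_eqVlt eq_sym (negPf dp).
have ext x : x \in W -> e x t = (x == p) || (x == q).
  move=> xW; have : x \in nbh W t = (x \in [set p; q]) by rewrite N.
  by rewrite nbh_mem xW !inE e_sym.
have tp := edge_neq etp; have tq := edge_neq etq.
have pS : p \in W :\ t by rewrite in_setD1 eq_sym tp.
have qS : q \in W :\ t by rewrite in_setD1 eq_sym tq.
have sS : [set t] \subset W by rewrite sub1set.
have [|||||exc D] := @deg2s_remove [set t] (q |: (deg2s W :\ t)) sS.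
- by apply/set0Pn; exists t; rewrite !inE eqxx.
- by apply/set0Pn; exists p.
- move=> x; rewrite in_setD1 => /andP [xt xW]; have := dgD1 x tW; rewrite ext //.
  have [->|_] := eqVneq x p; first by arith.
  have [->|_] := eqVneq x q => /=; last by have := W2 xW; arith.
  by have := d3 q qW (nD q etq); arith.
- apply/subsetP => x; rewrite deg2s_mem in_setD1 => /andP [/andP [xt xW] /eqP d2].
  have := dgD1 x tW; rewrite ext // d2 in_setU1 in_setD1 xt deg2s_mem xW /=.
  by have [->|_] := eqVneq x p; [arith|case: (x == q) => //= <-].
- by have := cardsD1 t (deg2s W); rewrite tD cardsU1; case: (q \notin _); arith.
have qD : q \in deg2s (W :\ t) by rewrite -D !inE eqxx.
have pD : p \notin deg2s (W :\ t).
  rewrite deg2s_mem pS /=; apply/eqP => d2; have := dgD1 p tW; rewrite d2 e_sym etp; arith.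
have tn : t \notin W :\ t by rewrite !inE eqxx.
have [|[s [Ps Ls As Us Zs]]|] := exc_extension e_sym e_irr exc tn pS qD pD.
- by move=> y; rewrite in_setD1 => /andP [_ yW]; rewrite e_sym ext.
- have Pq : path e p (rcons [:: t] q) by rewrite /= etq e_sym etp.
  have U : uniq ((p :: s) ++ [:: t]).
    apply: uniq_cat_notin => // x xs; rewrite inE; apply: contraTneq xs => ->.
    by rewrite inE negb_or tp; apply/negP => /(allP As); rewrite /= in_setD1 eqxx.
  by have := no_zero_cycle Ps Ls Pq U; rewrite addn1 -addn2 -modnDml Zs.
by rewrite setD1K.
Qed.

(** Otherwise delete a vertex of degree 3: its neighbours become the vertices of degree 2 of an
    exceptional graph, and a path of length 2 modulo 4 between two of them closes through the
    deleted vertex. If no vertex has degree 3, deleting any vertex leaves none of degree 2. *)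
Lemma exists_deg2 : exists t, t \in deg2s W.
Proof.
apply/set0Pn/negP => /eqP D0; have [W0 _ _] := Wgood.
have d3 x : x \in W -> 3 <= dg W x.
  move=> xW; have : x \notin deg2s W by rewrite D0 inE.
  rewrite deg2s_mem xW /= => x2; have := W2 xW; rewrite leq_eqVlt eq_sym (negPf x2).
  by [].
have rm v : v \in W -> W :\ v != set0.
  move=> vW; have /card_gt0P [y] : 0 < #|nbh W v| by have := d3 v vW; rewrite /dg; arith.
  by rewrite nbh_mem => /andP [yW /edge_neq vy]; apply/set0Pn; exists y; rewrite in_setD1 eq_sym vy.
have d2 v x : v \in W -> x \in W :\ v -> 2 <= dg (W :\ v) x.
  move=> vW; rewrite in_setD1 => /andP [_ xW]; have := dgD1 x vW; have := d3 x xW.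
  by case: (e x v); arith.
have sub v : v \in W -> deg2s (W :\ v) \subset nbh W v.
  move=> vW; apply/subsetP => x; rewrite deg2s_mem in_setD1 => /andP [/andP [_ xW] /eqP E].
  rewrite nbh_mem xW e_sym; have := dgD1 x vW; have := d3 x xW; rewrite E.
  by case: (e x v) => //=; arith.
have [v /andP [vW /eqP dv]|no3] := pickP [pred v in W | dg W v == 3]; last first.
  case/set0Pn: W0 => v vW; apply: (@small_few (W :\ v) set0); rewrite ?cards0 ?rm //.
  - exact: properD1.
  - by move=> x; apply: d2.
  apply/subsetP => x; rewrite deg2s_mem in_setD1 => /andP [/andP [_ xW] /eqP E].
  have := dgD1 x vW; have := d3 x xW; rewrite E; have := no3 x; rewrite /= xW /=.
  by case: (e x v) => /=; arith.
have [||||||exc D] := @deg2s_remove [set v] (nbh W v).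
- by rewrite sub1set.
- by apply/set0Pn; exists v; rewrite !inE eqxx.
- exact: rm.
- by move=> x; apply: d2.
- exact: sub.
- by move: dv; rewrite /dg => ->.
have /card_gt0P [p pN] : 0 < #|nbh W v| by move: dv; rewrite /dg => ->.
have /card_gt0P [q] : 0 < #|nbh W v :\ p| by move: dv; rewrite /dg (cardsD1 p) pN add1n => -[->].
rewrite in_setD1 => /andP [qp qN].
have [s [Ps Ls As Us Zs]] : exists s, [/\ path e p s, last p s = q, all (mem (W :\ v)) s, uniq (p :: s) & size s %% 4 = 2].
  by apply: (exc_path exc); rewrite -?D // eq_sym.
move: pN qN; rewrite !nbh_mem => /andP [pW evp] /andP [qW evq].
have Pq : path e p (rcons [:: v] q) by rewrite /= evq e_sym evp.
have U : uniq ((p :: s) ++ [:: v]).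
  apply: uniq_cat_notin => // x xs; rewrite inE; apply: contraTneq xs => ->.
  by rewrite inE negb_or (edge_neq evp); apply/negP => /(allP As); rewrite /= in_setD1 eqxx.
by have := no_zero_cycle Ps Ls Pq U; rewrite addn1 -addn2 -modnDml Zs.
Qed.

Lemma deg_ge3 x : x \in W -> x \notin deg2s W -> 3 <= dg W x.
Proof.
move=> xW; rewrite deg2s_mem xW /= => x2; have := W2 xW; rewrite leq_eqVlt eq_sym (negPf x2).
by [].
Qed.

(** * Sides of a 2-cut *)

(** [a] and [y] are the ends of the cut. In a fork, [t] forms a triangle with [u] and one end, [y]
    for [R] and [a] for [L]; in [SideTriangle] the triangle lies inside [S]. *)
Variant side_shape (S : {set V}) (a y : V) : Prop :=
| SideVertex t of t \in deg2s W & S = [set t] & e a t & e t y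
| SideForkR u t of t \in deg2s W & S = [set u; t] & e u t & e u y & e t y & e a u
| SideForkL u t of t \in deg2s W & S = [set u; t] & e u t & e u a & e t a & e u y
| SideTriangle u v t of t \in deg2s W & S = [set u; v; t] & e a u & e u v & e u t & e v t & e v y.

Lemma side_shape_sym S a y : side_shape S a y -> side_shape S y a.
Proof.
case=> [t tD SE eat ety|u t tD SE eut euy ety eau|u t tD SE eut eua eta euy|u v t tD SE eau euv eut evt evy].
- by apply: (SideVertex tD SE); rewrite e_sym.
- by apply: (SideForkL tD SE) => //; rewrite e_sym.
- by apply: (SideForkR tD SE) => //; rewrite e_sym.
- by apply: (@SideTriangle _ _ _ v u t) => //; rewrite 1?e_sym // SE [[set v; u]]setUC.
Qed.

Lemma side_shape_deg2 S a y : side_shape S a y -> exists2 t, t \in S & t \in deg2s W.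
Proof.
by case=> [t tD SE ? ?|u t tD SE ? ? ? ?|u t tD SE ? ? ? ?|u v t tD SE ? ? ? ? ?]; exists t; rewrite // SE !inE eqxx ?orbT.
Qed.

Lemma few_nbrs3 x p q r : nbh W x \subset [set p; q; r] -> 3 <= dg W x -> [/\ e x p, e x q & e x r].
Proof.
move=> sN d3; have E : nbh W x = [set p; q; r].
  apply/eqP; rewrite eqEcard sN; apply: leq_trans d3.
  by rewrite setUC cardsU1 cards2; case: (_ \notin _); case: (_ != _).
have H z : z \in [set p; q; r] -> e x z by rewrite -E nbh_mem => /andP [].
by split; apply: H; rewrite !inE eqxx ?orbT.
Qed.

Lemma two_nbrs t x y v : dg W t = 2 -> x \in W -> y \in W -> x != y -> e t x -> e t y -> v \in W -> e t v ->
  (v == x) || (v == y).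
Proof.
move=> dt xW yW xy etx ety vW etv; have [z [_ _ _ N]] := dg2P dt xW etx.
have : y \in nbh W t by rewrite nbh_mem yW.
rewrite N !inE eq_sym (negPf xy) /= => /eqP ->.
by have : v \in nbh W t; [rewrite nbh_mem vW|rewrite N !inE].
Qed.

Lemma three_nbrs t x y z v : dg W t = 3 -> x \in W -> y \in W -> z \in W -> x != y -> x != z -> y != z ->
  e t x -> e t y -> e t z -> v \in W -> e t v -> [|| v == x, v == y | v == z].
Proof.
move=> dt xW yW zW xy xz yz etx ety etz vW etv.
have yx : y != x by rewrite eq_sym.
have [w [_ _ _ _ N]] := dg3P dt xW etx yW ety yx.
have : z \in nbh W t by rewrite nbh_mem zW.
rewrite N !inE ![z == _]eq_sym (negPf xz) (negPf yz) /= eq_sym => /eqP ->.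
by have : v \in nbh W t; [rewrite nbh_mem vW|rewrite N !inE orbA].
Qed.

(** Otherwise [y] alone would separate [S] from [a]. *)
Lemma cut_nbr (S : {set V}) a y : S \subset W -> S != set0 -> a \in W -> a \notin S -> y \notin S -> a != y ->
  (forall u v, u \in S -> v \in W -> e u v -> v \in a |: (y |: S)) -> exists2 x, x \in S & e a x.
Proof.
move=> sS /set0Pn [x xS] aW aS yS ay clo; 
case: (pickP [pred x in S | e a x]) => [z /andP [zS eaz]|H]; first by exists z.
exfalso; apply: (@no_cut_vertex S y x a) => //; first exact: (subsetP sS).
move=> u v uS vW euv; have := clo u v uS vW euv; rewrite in_setU1 => /predU1P [E|//].
by have := H u; rewrite /= uS e_sym -E euv.
Qed.

Lemma cut_complement (S : {set V}) a y u v : a \in W -> y \in W ->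
  (forall u v, u \in S -> v \in W -> e u v -> v \in a |: (y |: S)) ->
  u \in W :\: (a |: (y |: S)) -> v \in W -> e u v -> v \in a |: (y |: (W :\: (a |: (y |: S)))).
Proof.
move=> aW yW clo; rewrite !inE !negb_or => /andP [/and3P [ua uy uS] uW] vW euv.
case: (v == a) => //; case: (v == y) => //=; rewrite vW andbT; apply: contra uS => vS.
by have := clo v u vS uW; rewrite e_sym euv !inE (negPf ua) (negPf uy) => /(_ isT).
Qed.

(** Start at a neighbour of [a] in [R] and go to [y] without [a]: the path can leave [R] only at
    [y]. *)
Lemma cut_path (R : {set V}) a y : R \subset W -> R != set0 -> a \in W -> y \in W -> a \notin R -> y \notin R -> a != y ->
  (forall u v, u \in R -> v \in W -> e u v -> v \in a |: (y |: R)) ->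
  exists q, [/\ path e a (rcons q y), all (mem R) q & uniq q].
Proof.
move=> sR R0 aW yW aR yR ay clo; have [r rR ear] := cut_nbr sR R0 aW aR yR ay clo.
have rW := subsetP sR _ rR; have ra : r != a by rewrite eq_sym edge_neq.
have rWa : r \in W :\ a by rewrite in_setD1 ra.
have /(connect_insideP e _ rWa) [p [Pp Ap Lp Up]] : connect (inside (W :\ a)) r y.
  by apply: W_minus_connected => //; rewrite eq_sym.
suff [q [Eq Aq]] : exists q, p = rcons q y /\ all (mem R) q.
  exists (r :: q); split; rewrite /= ?rR ?Aq // ?ear -?Eq //.
  by move: Up; rewrite Eq -rcons_cons rcons_uniq => /andP [].
elim: p r rR Pp Ap Lp Up {ear rW ra rWa} => [|z p IHp] r rR /=.
  by move=> _ _ E; rewrite -E rR in yR.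
case/andP=> erz Pp /andP [zWa Ap] Lp /andP [_ Up].
move: (zWa); rewrite /= in_setD1 => /andP [za zW].
have := clo r z rR zW erz; rewrite !in_setU1 (negPf za) /= => /predU1P [zy|zR].
  exists [::]; split=> //; case: p Lp Up {Pp Ap IHp} => [|w p] /=; first by rewrite zy.
  by move=> L /andP [zp _]; case/negP: zp; rewrite zy -L; apply: mem_last.
by have [q [-> Aq]] := IHp z zR Pp Ap Lp Up; exists (z :: q); rewrite /= zR.
Qed.

(** The side together with its ends is good and smaller, hence exceptional, with [a] and [y] of
    degree 2. It has more than three vertices, so it offers a path of whatever residue closes a path
    through the complement. *)
Lemma side_both (S : {set V}) a y : a \in W -> y \in W -> a != y -> S \subset W -> a \notin S -> y \notin S ->
  (forall u v, u \in S -> v \in W -> e u v -> v \in a |: (y |: S)) -> #|S :&: deg2s W| <= 1 ->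
  a |: (y |: S) \proper W -> 2 <= dg S a -> 2 <= dg S y -> False.
Proof.
move=> aW yW ay sS aS yS clo few p da dy; set W' := a |: (y |: S).
have sSW' : S \subset W' by apply/subsetP => x xS; rewrite !in_setU1 xS !orbT.
have dS x : x \in S -> dg W' x = dg W x.
  by move=> xS; rewrite /dg (@sub_nbh W' W) ?(proper_sub p) // => z; apply: clo.
have dmono x : dg S x <= dg W' x.
  by apply/subset_leq_card/subsetP => z; rewrite !nbh_mem => /andP [/(subsetP sSW') -> ->].
pose D := a |: (y |: (S :&: deg2s W)).
have D3 : #|D| <= 3 by rewrite !cardsU1; case: (_ \notin _); case: (_ \notin _); arith.
have sD : deg2s W' \subset D.
  apply/subsetP => x; rewrite deg2s_mem !in_setU1 => /andP [/predU1P [->|/predU1P [->|xS]]]; rewrite ?eqxx ?orbT //.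
  by rewrite dS // in_setI xS deg2s_mem (subsetP sS) // => ->; rewrite !orbT.
have gd : good W'.
  split; first by apply/set0Pn; exists a; rewrite in_setU1 eqxx.
    move=> x; rewrite !in_setU1 => /predU1P [->|/predU1P [->|xS]]; [exact: leq_trans (dmono _)|exact: leq_trans (dmono _)|].
    by rewrite dS //; apply/W2/(subsetP sS).
  by apply: leq_trans D3; apply: subset_leq_card.
have exc := IH gd (proper_card p).
have DE : deg2s W' = D by apply/eqP; rewrite eqEcard sD (exc_deg2 exc).
have W'4 : 3 < #|W'|.
  rewrite /W' cardsU1 in_setU1 negb_or ay aS cardsU1 yS /=.
  have : dg S a <= #|S| by apply/subset_leq_card/subsetP => z; rewrite nbh_mem => /andP [].
  by move: da; arith.
have R0 : W :\: W' != set0 by rewrite setD_eq0; case/andP: p.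
have [q [Pq Aq Uq]] : exists q, [/\ path e a (rcons q y), all (mem (W :\: W')) q & uniq q].
  apply: cut_path => //; rewrite ?subsetDl ?in_setD ?in_setU1 ?eqxx ?orbT //.
  by move=> u v; apply: cut_complement.
(* If l is the length of the outer path, 3l is congruent to -l modulo 4. *)
have [s [Ps Ls As Us Zs]] : exists s, [/\ path e a s, last a s = y, all (mem W') s, uniq (a :: s) &
    size s %% 4 = (3 * (size q).+1) %% 4].
  apply: (exc_path exc); rewrite ?DE ?in_setU1 ?eqxx ?orbT ?ltn_mod //.
  by rewrite W'4 orbT.
have U : uniq ((a :: s) ++ q).
  apply: uniq_cat_notin => // x xs; have xW' : x \in W'.
    by move: xs; rewrite inE => /predU1P [->|/(allP As)//]; rewrite in_setU1 eqxx.
  by apply/negP => /(allP Aq); rewrite /= in_setD xW'.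
have := no_zero_cycle Ps Ls Pq U; rewrite -addnS -modnDml Zs modnDml.
by rewrite -{2}[(size q).+1]mul1n -mulnDl modnMr.
Qed.

(** The only neighbour [b] of [a] in [S], or the next vertex [z] if [b] has degree 2, replaces [a]
    as an end of the cut, and [IHS] applies to what remains of [S]. *)
Lemma side_thin (S : {set V}) a y :
  (forall (S' : {set V}) a' y', #|S'| < #|S| -> a' \in W -> y' \in W -> a' != y' -> S' \subset W -> S' != set0 -> a' \notin S' -> y' \notin S' ->
    (forall u v, u \in S' -> v \in W -> e u v -> v \in a' |: (y' |: S')) -> #|S' :&: deg2s W| <= 1 ->
    a' |: (y' |: S') \proper W -> side_shape S' a' y') ->
  a \in W -> y \in W -> a != y -> S \subset W -> a \notin S -> y \notin S ->
  (forall u v, u \in S -> v \in W -> e u v -> v \in a |: (y |: S)) -> #|S :&: deg2s W| <= 1 ->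
  a |: (y |: S) \proper W -> dg S a = 1 -> side_shape S a y.
Proof.
move=> IHS aW yW ay sS aS yS clo few pr da.
have [b Nb] : exists b, nbh S a = [set b] by apply/cards1P/eqP.
have : b \in nbh S a by rewrite Nb inE.
rewrite nbh_mem => /andP [bS eab]; have bW := subsetP sS _ bS.
have eba : e b a by rewrite e_sym.
have aonly u : u \in S -> e u a -> u = b.
  by move=> uS eua; apply/eqP; have : u \in nbh S a by [rewrite nbh_mem uS e_sym]; rewrite Nb inE.
have bS' : #|S :\ b| < #|S| by rewrite [X in _ < X](cardsD1 b) bS.
have ab := edge_neq eab.
have by_ : b != y by apply: contraNneq yS => <-.
have [bD|bD] := boolP (b \in deg2s W).
  have [z [zW ebz za Nz]] := dg2P (deg2s_dg bD) aW eba.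
  have zb : z != b by rewrite eq_sym edge_neq.
  have bonly u : u \in W -> e u b -> (u == a) || (u == z).
    by move=> uW eub; have : u \in nbh W b by [rewrite nbh_mem uW e_sym]; rewrite Nz !inE.
  have [zy|zy] := eqVneq z y.
    have [S1|/set0Pn [w]] := eqVneq (S :\ b) set0.
      by apply: (SideVertex bD) => //; rewrite -?zy // -(setD1K bS) S1 setU0.
    rewrite in_setD1 => /andP [wb wS]; exfalso; have wW := subsetP sS _ wS.
    apply: (@no_cut_vertex (S :\ b) y w a); rewrite ?in_setD1 ?wb ?(negPf yS) ?(negPf aS) ?andbF //.
    move=> u v; rewrite !inE => /andP [ub uS] vW euv; have := clo u v uS vW euv; rewrite !inE.
    case/predU1P => [E|/orP [->//|vS]]; first by rewrite (aonly u) ?eqxx // -E in ub.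
    rewrite vS andbT orbC; apply/orP; left; apply: contraNneq aS => E.
    have := bonly u (subsetP sS _ uS); rewrite -E euv => /(_ isT) /orP [] /eqP uE; first by rewrite -uE.
    by rewrite uE zy (negPf yS) in uS.
  have zS : z \in S by have := clo b z bS zW ebz; rewrite !inE (negPf za) (negPf zy).
  have dz := deg2_nbr_cubic bD zW ebz.
  have ebz' : e z b by rewrite e_sym.
  have [w /and3P [wW ezw wb] wy] : exists2 w, [&& w \in W, e z w & w != b] & w != y.
    have : 1 < #|nbh W z :\ b|.
      by move: dz; rewrite /dg (cardsD1 b) nbh_mem bW ebz' add1n => -[->].
    rewrite (cardsD1 y) => H; have /card_gt0P [w] : 0 < #|nbh W z :\ b :\ y| by move: H; case: (_ \in _); arith.
    by rewrite !inE => /and4P [wy wb wW ezw]; exists w => //; rewrite wW ezw.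
  have wa : w != a by apply: contraNneq zb => E; apply/eqP/aonly => //; rewrite -E.
  have wS : w \in S by have := clo z w zS wW ezw; rewrite !inE (negPf wa) (negPf wy).
  (* [b] is the only vertex of degree 2 allowed in [S], but the side [S2] between [z] and [y] would
     need another one. *)
  exfalso; pose S2 := S :\: [set b; z].
  have S20 : #|S2 :&: deg2s W| = 0.
    have : b \in S :&: deg2s W by rewrite inE bS.
    move=> H; move: few; rewrite (cardsD1 b) H => few; apply/eqP; rewrite -leqn0.
    apply: leq_trans (_ : #|(S :&: deg2s W) :\ b| <= 0); last by move: few; arith.
    by apply/subset_leq_card/subsetP => x; rewrite !inE => /andP [/andP [/norP [-> _] ->] ->].
  have [] : exists2 t, t \in S2 & t \in deg2s W; last first.
    by move=> t tS tD; have := card0_eq (A := S2 :&: deg2s W) S20 t; rewrite !inE; move: tS; rewrite !inE => ->; move: tD; rewrite inE => ->.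
  apply: (@side_shape_deg2 S2 z y); apply: IHS => //.
  - apply: leq_ltn_trans bS'; apply/subset_leq_card/subsetP => x; rewrite !inE.
    by case/andP => /norP [-> _] ->.
  - by apply/subsetP => x; rewrite in_setD => /andP [_ /(subsetP sS)].
  - by apply/set0Pn; exists w; rewrite !inE negb_or wb wS andbT eq_sym edge_neq.
  - by rewrite !inE eqxx orbT.
  - by rewrite !inE (negPf yS) andbF.
  - move=> u v; rewrite !inE => /andP [/norP [ub uz] uS] vW euv; have := clo u v uS vW euv; rewrite !inE.
    case/predU1P => [E|/orP [->|vS]]; rewrite ?orbT //; first by rewrite (aonly u) ?eqxx // -E in ub.
    rewrite vS andbT negb_or; case: (v == z) => //=; case: (v == y) => //=; rewrite andbT.
    apply/eqP => E; have := bonly u (subsetP sS _ uS); rewrite -E euv => /(_ isT).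
    by rewrite (negPf uz) orbF => /eqP uE; rewrite uE (negPf aS) in uS.
  - by rewrite S20.
  rewrite properE; apply/andP; split.
    rewrite !subUset !sub1set zW yW /=; apply/subsetP => x; rewrite in_setD => /andP [_]; exact: (subsetP sS).
  by apply/subsetPn; exists a; rewrite // !inE eq_sym (negPf za) (negPf ay) (negPf aS) andbF.
have db := deg_ge3 bW bD.
have SE : S = b |: (S :\ b) by rewrite setD1K.
have bnb v : v \in W -> e b v -> v \in a |: (y |: (S :\ b)).
  move=> vW ebv; have := clo b v bS vW ebv; rewrite !inE.
  by have := edge_neq ebv; rewrite eq_sym => ->.
have shape : side_shape (S :\ b) b y.
  apply: IHS => //.
  - by apply/subsetP => x; rewrite in_setD1 => /andP [_ /(subsetP sS)].
  - have : 1 < #|nbh W b :\ a|.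
      by move: db; rewrite /dg (cardsD1 a) nbh_mem aW eba.
    rewrite (cardsD1 y) => H; have /card_gt0P [w] : 0 < #|nbh W b :\ a :\ y| by move: H; case: (_ \in _); arith.
    rewrite !inE => /and4P [wy wa wW ebw]; apply/set0Pn; exists w.
    by have := bnb w wW ebw; rewrite !inE (negPf wa) (negPf wy).
  - by rewrite !inE eqxx.
  - by rewrite !inE (negPf yS) andbF.
  - move=> u v; rewrite !inE => /andP [ub uS] vW euv; have := clo u v uS vW euv; rewrite !inE.
    case/predU1P => [E|/orP [->|vS]]; rewrite ?orbT //; first by rewrite (aonly u) ?eqxx // -E in ub.
    by rewrite vS andbT; case: (v == b); rewrite // orbT.
  - by apply: leq_trans few; apply/subset_leq_card/setSI/subD1set.
  rewrite properE; apply/andP; split.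
    by rewrite !subUset !sub1set bW yW /=; apply/subsetP => x; rewrite in_setD => /andP [_]; exact: (subsetP sS).
  by apply/subsetPn; exists a; rewrite // !inE (negPf ab) (negPf ay) (negPf aS) andbF.
(* Adding [b] turns a single vertex into a fork and a fork at [b] into a triangle. A fork at [y]
   would leave [y] no neighbour beyond [S], and a triangle would give the 4-cycle through [b], [u],
   [v] and [y]. *)
case: shape => [t tD S'E ebt ety|u t tD S'E eut euy ety ebu|u t tD S'E eut eub etb euy|u v t tD S'E ebu euv eut evt evy].
- have [_ eby _] : [/\ e b a, e b y & e b t].
    apply: few_nbrs3 db; apply/subsetP => v; rewrite nbh_mem => /andP [vW ebv].
    by have := bnb v vW ebv; rewrite S'E !inE orbA.
  apply: (@SideForkR _ _ _ b t) => //; first by rewrite SE S'E.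
- exfalso; have uS : u \in S by rewrite SE S'E !inE eqxx orbT.
  have tS : t \in S by rewrite SE S'E !inE eqxx !orbT.
  have tW := subsetP sS _ tS; have uW := subsetP sS _ uS.
  have yu : y != u by apply: contraNneq yS => ->.
  have yt : y != t by apply: contraNneq yS => ->.
  have ub : u != b by rewrite eq_sym edge_neq.
  have tb : t != b by have : t \in S :\ b; [rewrite S'E !inE eqxx orbT|rewrite !inE => /andP []].
  have ut := edge_neq eut.
  have [eby _ _] : [/\ e b y, e b a & e b u].
    apply: few_nbrs3 db; apply/subsetP => v; rewrite nbh_mem => /andP [vW ebv].
    have := bnb v vW ebv; rewrite S'E !inE; case: (v == y) => //; case: (v == a) => //.
    case: (v == u) => //= /eqP vt; rewrite vt in ebv.
    have := @two_nbrs t y u b (deg2s_dg tD) yW uW yu ety; rewrite e_sym eut bW e_sym ebv => /(_ isT isT isT).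
    by rewrite (negPf by_) eq_sym (negPf ub).
  have [r rR eyr] : exists2 r, r \in W :\: (y |: (a |: S)) & e y r.
    apply: (@cut_nbr _ y a) => //; rewrite ?subsetDl ?in_setD ?in_setU1 ?eqxx ?orbT //.
    - by rewrite setUCA setD_eq0; case/andP: pr.
    - by rewrite eq_sym.
    move=> u' v; apply: cut_complement => // u'' v' u''S v'W; rewrite setUCA; exact: clo.
  move: rR; rewrite !inE !negb_or => /andP [/and3P [ry ra rS] rW].
  have := @three_nbrs y u t b r (deg2_nbr_cubic tD yW ety) uW tW bW ut ub tb.
  rewrite e_sym euy e_sym ety e_sym eby rW eyr => /(_ isT isT isT isT isT) /or3P [] /eqP E; rewrite E in rS.
  + by rewrite uS in rS.
  + by rewrite tS in rS.
  + by rewrite bS in rS.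
- apply: (@SideTriangle _ _ _ b u t) => //; first (by rewrite SE S'E setUA); by rewrite e_sym.
- exfalso; have uS : u \in S by rewrite SE S'E !inE eqxx !orbT.
  have vS : v \in S by rewrite SE S'E !inE eqxx !orbT.
  have tS : t \in S by rewrite SE S'E !inE eqxx !orbT.
  have tW := subsetP sS _ tS; have uW := subsetP sS _ uS; have vW := subsetP sS _ vS.
  have yn x : x \in S -> y != x by move=> xS; apply: contraNneq yS => ->.
  have vb : v != b by have : v \in S :\ b; [rewrite S'E !inE eqxx ?orbT|rewrite !inE => /andP []].
  have tb : t != b by have : t \in S :\ b; [rewrite S'E !inE eqxx ?orbT|rewrite !inE => /andP []].
  have ub : u != b by have : u \in S :\ b; [rewrite S'E !inE eqxx ?orbT|rewrite !inE => /andP []].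
  have uv := edge_neq euv; have ut := edge_neq eut; have vt := edge_neq evt.
  have etv : e t v by rewrite e_sym.
  have [eby _ _] : [/\ e b y, e b a & e b u].
    apply: few_nbrs3 db; apply/subsetP => w; rewrite nbh_mem => /andP [wW ebw].
    have := bnb w wW ebw; rewrite S'E !inE; case: (w == y) => //; case: (w == a) => //.
    case: (w == u) => //= /orP [] /eqP wE; rewrite wE e_sym in ebw.
      have := @three_nbrs v u t y b (deg2_nbr_cubic tD vW etv) uW tW yW ut; rewrite eq_sym yn // eq_sym yn //.
      rewrite e_sym euv evt evy bW ebw => /(_ isT isT isT isT isT isT isT).
      by rewrite (negPf by_) eq_sym (negPf ub) eq_sym (negPf tb).
    have := @two_nbrs t u v b (deg2s_dg tD) uW vW uv; rewrite e_sym eut etv bW ebw => /(_ isT isT isT isT).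
    by rewrite eq_sym (negPf ub) eq_sym (negPf vb).
  have := @no_zero_cycle b [:: u; v; y] y [::]; rewrite /= ebu euv evy eby !inE !negb_or !andbT.
  rewrite ![b == _]eq_sym ub vb eq_sym by_ uv ![_ == y]eq_sym !yn //.
  by move=> /(_ isT erefl isT isT).
Qed.

Lemma two_cut (S : {set V}) a y : a \in W -> y \in W -> a != y -> S \subset W -> S != set0 -> a \notin S -> y \notin S ->
  (forall u v, u \in S -> v \in W -> e u v -> v \in a |: (y |: S)) -> #|S :&: deg2s W| <= 1 ->
  a |: (y |: S) \proper W -> side_shape S a y.
Proof.
have [n] := ubnP #|S|; elim: n S a y => // n IHn S a y ltn aW yW ay sS S0 aS yS clo few pr.
have IHS (S' : {set V}) a' y' : #|S'| < #|S| -> a' \in W -> y' \in W -> a' != y' -> S' \subset W -> S' != set0 -> a' \notin S' -> y' \notin S' ->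
    (forall u v, u \in S' -> v \in W -> e u v -> v \in a' |: (y' |: S')) -> #|S' :&: deg2s W| <= 1 ->
    a' |: (y' |: S') \proper W -> side_shape S' a' y'.
  by move=> lt; apply: IHn; apply: leq_trans lt _.
have clo' u v : u \in S -> v \in W -> e u v -> v \in y |: (a |: S) by rewrite setUCA; apply: clo.
have ya : y != a by rewrite eq_sym.
have pos b c : b \in W -> b \notin S -> c \notin S -> b != c ->
    (forall u v, u \in S -> v \in W -> e u v -> v \in b |: (c |: S)) -> 0 < dg S b.
  move=> bW bS cS bc clob; have [x xS ebx] := cut_nbr sS S0 bW bS cS bc clob.
  by apply/card_gt0P; exists x; rewrite nbh_mem xS.
have := pos a y aW aS yS ay clo; case da: (dg S a) => [|[|d]] // _; first exact: side_thin.
have := pos y a yW yS aS ya clo'; case dy: (dg S y) => [|[|d']] // _.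
  by apply: side_shape_sym; apply: side_thin => //; rewrite setUCA.
by exfalso; apply: (@side_both S a y) => //; rewrite ?da ?dy.
Qed.

(** * Ears leaving a known part of the graph *)

Lemma component_connected (A : {set V}) x u v : x \in A -> u \in component A x -> v \in component A x ->
  connect (inside (component A x)) u v.
Proof.
move=> xA.
have gen p y : y \in component A x -> path (inside A) y p -> path (inside (component A x)) y p.
  elim: p y => //= z p IHp y yC /andP [/and3P [yA zA eyz] Pp].
  have zC : z \in component A x by apply: component_closed yC zA eyz.
  by rewrite yC zC eyz IHp.
have H w : w \in component A x -> connect (inside (component A x)) x w.
  rewrite inE => /andP [_ /connectP [p Pp ->]]; apply/connectP; exists p => //.
  by apply: gen => //; rewrite inE xA connect0.
by move=> uC vC; apply: connect_trans (H v vC); rewrite (connect_inside_sym e_sym); apply: H.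
Qed.

Lemma exit_through (K S : {set V}) a y s p : (forall u v, u \in S -> v \in K -> e u v -> v \in a |: (y |: S)) ->
  a \notin K -> path e s p -> all (mem K) p -> s \in S -> last s p \notin S -> y \in p.
Proof.
move=> clo aK; elim: p s => [|z p IHp] s /=; first by move=> _ _ ->.
case/andP=> esz Pp /andP [zK Ap] sS L; rewrite inE.
have := clo s z sS zK esz; rewrite !inE => /or3P [/eqP E|/eqP ->|zS].
- by rewrite E (negPf aK) in zK.
- by rewrite eqxx.
- by rewrite (IHp z) ?orbT.
Qed.

Definition anchored (K : {set V}) c := c \in deg2s W \/ 2 <= #|nbh W c :\: K|.

(** A neighbour [c] of [t] is cubic, so it cannot have two neighbours in [K] and two outside. This
    excludes forks at the ends of the expanded path. *)
Lemma anchored_no_fork (K : {set V}) c t u : K \subset W -> c \in W -> anchored K c -> t \in deg2s W -> t \in K -> u \in K -> u != t ->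
  e t c -> e u c -> False.
Proof.
move=> sK cW an tD tK uK ut etc euc.
case: an => [cD|d2]; first by have := adjacent_deg2 tD cD; rewrite etc.
have := deg2_nbr_cubic tD cW etc; rewrite /dg -(cardsID K).
have : 2 <= #|nbh W c :&: K|.
  have <- : #|[set u; t]| = 2 by rewrite cards2 ut.
  by apply/subset_leq_card/subsetP => z; rewrite !inE => /orP [] /eqP ->; rewrite e_sym ?euc ?etc ?uK ?tK ?andbT (subsetP sK).
by move: d2; arith.
Qed.

(* A fan from [x] to [b] and the other vertices of [M] could fail only at a 2-cut, whose shape is known. *)
Lemma strong_exposure (M K : {set V}) a b x : M \subset W -> a \in M -> b \in M -> a != b -> 4 < #|M| ->
  K \subset W :\: M -> (forall u v, u \in K -> v \in W -> e u v -> v \in M :|: K) ->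
  (forall u v, u \in K -> v \in K -> connect (inside K) u v) ->
  x \in K -> e a x -> (exists2 b0, b0 \in K & e b0 b) -> x \notin deg2s W -> anchored K a -> anchored K b ->
  (exists p1 p2 r, [/\ path e x (rcons p1 b), path e x (rcons p2 r), [/\ r \in M, r != a & r != b],
     all (mem K) (p1 ++ p2) & uniq (x :: p1 ++ p2)]) \/
  (exists v t p, [/\ [/\ e x v, e x t & e t v], [/\ t \in deg2s W, dg W x = 3 & dg W v = 3],
     path e v (rcons p b), all (mem K) [:: v, t & p] & uniq [:: x, v, t & p]]).
Proof.
move=> sMW aM bM ab M5 sK clo con xK eax [b0 b0K eb0b] xD ana anb.
have sKW : K \subset W by apply: subset_trans sK (subsetDl _ _).
have KM u : u \in K -> u \notin M by move=> /(subsetP sK); rewrite in_setD => /andP [].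
have aW := subsetP sMW _ aM; have bW := subsetP sMW _ bM; have xW := subsetP sKW _ xK.
have aK : a \notin K by apply: contraL aM => /KM.
have bK : b \notin K by apply: contraL bM => /KM.
(* A fan from [x] to [P] and [Q] is a new path to [b] together with an ear to a vertex of [M] other
   than [a] and [b]. *)
pose P := [set u in K | e u b].
pose Q := [set u in K | [exists r in M, [&& r != a, r != b & e u r]]].
have b0P : b0 \in P by rewrite inE b0K.
(* If there is no fan, [a] and one vertex [y] cut off a part [S] of [K] that contains [x]; when [Q]
   is empty, [S] is [K] and [y] is [b]. *)
have [|[S [y [[xS sSK yS ya] [yW yKb] cloS]]]] :
  (exists p1 p2, [/\ path e x p1, path e x p2, all (mem K) (p1 ++ p2),
    last x p1 \in P /\ last x p2 \in Q & uniq (x :: p1 ++ p2)]) \/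
  (exists (S : {set V}) y, [/\ [/\ x \in S, S \subset K, y \notin S & y != a],
     y \in W /\ (y \in K \/ (y = b /\ S = K)) & forall u v, u \in S -> v \in W -> e u v -> v \in a |: (y |: S)]).
- have [Q0|/set0Pn [q0 q0Q]] := eqVneq Q set0.
    right; exists K, b; split; [by rewrite eq_sym|by split; [|right]|].
    move=> u v uK vW euv; have := clo u v uK vW euv; rewrite !inE => /orP [vM|->]; rewrite ?orbT //.
    case va: (v == a) => //=; case vb: (v == b) => //=; exfalso.
    have : u \in Q by rewrite inE uK; apply/exists_inP; exists v; rewrite // va vb.
    by rewrite Q0 inE.
  have q0K : q0 \in K by move: q0Q; rewrite inE => /andP [].
  pose cut y := (y \in K) && (y != x) && [forall z in P :|: Q, ~~ connect (inside (K :\ y)) x z].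
  case: (pickP cut) => [y /andP [/andP [yK yx] /forall_inP ycut]|nocut]; last first.
    left; apply: (fan e_sym xK b0P (con x b0 xK b0K) q0Q (con x q0 xK q0K)) => y yK yx.
    have := nocut y; rewrite /cut yK yx /= => /negbT; rewrite negb_forall_in => /exists_inP [z zPQ].
    by rewrite negbK => c; exists z.
  have xKy : x \in K :\ y by rewrite in_setD1 eq_sym yx.
  right; exists (component (K :\ y) x), y; split.
  - split; first by rewrite inE xKy connect0.
    + by apply/subsetP => z; rewrite inE in_setD1 => /andP [/andP []].
    + by rewrite inE in_setD1 eqxx.
    + by apply: contraNneq aK => <-.
  - by split; [apply: (subsetP sKW)|left].
  move=> u v uS vW euv; rewrite !in_setU1; case va: (v == a) => //=; case vy: (v == y) => //=.
  have uK : u \in K by move: uS; rewrite inE in_setD1 => /andP [/andP []].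
  have cu : connect (inside (K :\ y)) x u by move: uS; rewrite inE => /andP [].
  have := clo u v uK vW euv; rewrite in_setU => /orP [vM|vK]; last first.
    by apply: component_closed uS _ euv; rewrite in_setD1 vy.
  have : u \in P :|: Q; last by move/ycut; rewrite cu.
  rewrite in_setU; case vb: (v == b); first by rewrite inE uK -(eqP vb) euv.
  by apply/orP; right; rewrite inE uK; apply/exists_inP; exists v; rewrite // va vb.
- move=> [p1 [p2 [Pp1 Pp2 A [L1 L2] U]]]; left.
  move: L1 L2; rewrite !inE => /andP [_ e1] /andP [_ /exists_inP [r rM /and3P [ra rb er]]].
  by exists p1, p2, r; rewrite !rcons_path Pp1 Pp2 e1 er.
have aS : a \notin S by apply: contra aK => /(subsetP sSK).
have sSW := subset_trans sSK sKW.
pose R := W :\: (a |: (y |: S)).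
have sMR : M :\ a :\ y \subset R.
  apply/subsetP => m; rewrite !in_setD1 /R in_setD !in_setU1 => /and3P [my ma mM].
  by rewrite (negPf ma) (negPf my) (subsetP sMW) // andbT /=; apply: contraL mM => /(subsetP sSK) /KM.
have M1 : 3 < #|M :\ a| by move: M5; rewrite (cardsD1 a) aM.
have M2 : 2 < #|M :\ a :\ y| by move: M1; rewrite (cardsD1 y (M :\ a)); case: (_ \in _); arith.
have R3 := leq_trans M2 (subset_leq_card sMR).
have ay : a != y by rewrite eq_sym.
have prS : a |: (y |: S) \proper W.
  rewrite properE; apply/andP; split; first by rewrite !subUset !sub1set aW yW.
  by rewrite -setD_eq0 -card_gt0; apply: leq_trans R3.
have xn_t t : t \in deg2s W -> x == t = false by move=> tD; apply: contraNF xD => /eqP ->.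
(* A simple path in [K] from [y] to a neighbour of [b] cannot enter [S], which it could leave again
   only through [y]. *)
have toB : y \in K -> exists p, [/\ path e y (rcons p b), all (mem K) p, {in p, forall z, z \notin S} & uniq (y :: p)].
  move=> yK; have [p [Pp Ap Lp Up]] := connect_insideP e b0 yK (con y b0 yK b0K).
  exists p; split=> //; first by rewrite rcons_path Pp Lp.
  have b0S : b0 \notin S.
    apply/negP => b0S; have := cloS b0 b b0S bW eb0b; rewrite !inE eq_sym (negPf ab) /=.
    by case/orP => [/eqP E|/(subsetP sSK)]; [rewrite E yK in bK|rewrite (negPf bK)].
  move=> z zp; apply/negP => zS; case/splitPr: zp Pp Ap Lp Up => l1 l2.
  rewrite cat_path last_cat all_cat /= => /and3P [_ _ P2] /and3P [_ _ A2] L2 /andP [yl _].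
  have : y \in l2.
    apply: (@exit_through K S a y z l2) => //; last by rewrite L2.
    by move=> u v uS vK; apply: cloS => //; apply: (subsetP sKW).
  by move=> yl2; case/negP: yl; rewrite mem_cat inE yl2 !orbT.
(* If [S] has few vertices of degree 2, its shape is a fork at [y] or a triangle, which gives the
   second alternative. Otherwise the complement [R] has a known shape. *)
case: (leqP #|S :&: deg2s W| 1) => [few|many].
  have shape : side_shape S a y.
    by apply: two_cut => //; apply/set0Pn; exists x.
  right; case: shape => [t tD SE eat ety|u t tD SE eut euy ety eau|u t tD SE eut eua eta euy|u v t tD SE eau euv eut evt evy].
  - by move: xS; rewrite SE inE xn_t.
  - have [uS tS] : u \in S /\ t \in S by rewrite SE !inE !eqxx orbT.
    have xu : x = u by move: xS; rewrite SE !inE (xn_t t tD) orbF => /eqP.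
    have ut := edge_neq eut.
    case: yKb => [yK|[yb _]]; last first.
      exfalso; rewrite yb in ety euy.
      by apply: (anchored_no_fork sKW bW anb tD _ _ ut ety euy); apply: (subsetP sSK).
    have [p [Pp Ap Sp Up]] := toB yK; exists y, t, p.
    have tK := subsetP sSK _ tS; rewrite /= yK tK Ap xu euy eut ety; split=> //.
      by rewrite (deg2_nbr_cubic tD _ ety) // (deg2_nbr_cubic tD _ (_ : e t u)) ?(subsetP sSW) // e_sym.
    have up : u \notin p by apply/negP => /Sp; rewrite uS.
    have tp : t \notin p by apply/negP => /Sp; rewrite tS.
    move: Up => /= /andP [yp ->]; rewrite !inE !negb_or ut up tp yp (edge_neq euy) andbT /=.
    by rewrite eq_sym (edge_neq ety).
  - exfalso; have [uS tS] : u \in S /\ t \in S by rewrite SE !inE !eqxx orbT.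
    by apply: (anchored_no_fork sKW aW ana tD _ _ (edge_neq eut) eta eua); apply: (subsetP sSK).
  have [uS vS tS] : [/\ u \in S, v \in S & t \in S] by rewrite SE !inE !eqxx !orbT.
  have [uW vW tW] : [/\ u \in W, v \in W & t \in W] by split; apply: (subsetP sSW).
  have nS z : z \in S -> z != y by move=> zS; apply: contraNneq yS => <-.
  have nSa z : z \in S -> a != z by move=> zS; apply: contraNneq aS => ->.
  have uv := edge_neq euv; have ut := edge_neq eut; have vt := edge_neq evt.
  have etv : e t v by rewrite e_sym. have etu : e t u by rewrite e_sym.
  have dv := deg2_nbr_cubic tD vW etv; have du := deg2_nbr_cubic tD uW etu.
  have xu : x = u.
    move: xS; rewrite SE !inE (xn_t t tD) orbF => /orP [/eqP //|/eqP xv]; exfalso.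
    have := @three_nbrs v u t y a dv uW tW yW ut (nS u uS) (nS t tS).
    rewrite e_sym euv evt evy aW e_sym -xv eax => /(_ isT isT isT isT isT).
    by rewrite (negPf (nSa u uS)) (negPf (nSa t tS)) (negPf ay).
  have [vK tK] : v \in K /\ t \in K by split; apply: (subsetP sSK).
  case: yKb => [yK|[yb _]]; last first.
    have U : uniq [:: u; v; t] by rewrite /= !inE negb_or uv ut vt.
    by exists v, t, [::]; rewrite /= vK tK -yb evy xu euv eut etv; split.
  have [p [Pp Ap Sp Up]] := toB yK.
  have np z : z \in S -> z \notin y :: p.
    by move=> zS; rewrite inE negb_or nS //; apply/negP => /Sp; rewrite zS.
  have U : uniq ([:: u; v; t] ++ y :: p).
    apply: uniq_cat_notin => //; first by rewrite /= !inE negb_or uv ut vt.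
    by move=> z; rewrite !inE => /or3P [] /eqP ->; apply: np.
  exists v, t, (y :: p); rewrite xu euv eut etv; split=> //; first by rewrite /= evy.
  by rewrite /= vK tK yK.
exfalso.
have fewR : #|R :&: deg2s W| <= 1.
  have : [disjoint S & R] by rewrite disjoint_sym disjoints_subset; apply/subsetP => z; rewrite in_setD in_setC !in_setU1 => /andP [/norP [_ /norP []]].
  by case/few_sides => // few; move: many; rewrite ltnNge few.
have shape : side_shape R a y.
  apply: two_cut => //; rewrite /R ?subsetDl //.
  - by rewrite -card_gt0; apply: leq_trans R3.
  - by rewrite in_setD in_setU1 eqxx.
  - by rewrite in_setD !in_setU1 eqxx orbT.
  - by move=> u v; apply: cut_complement.
  rewrite properE; apply/andP; split; first by rewrite !subUset !sub1set aW yW subsetDl.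
  apply/subsetPn; exists x => //; rewrite !in_setU1 in_setD !in_setU1 xS !orbT /= orbF.
  by rewrite negb_or; apply/andP; split; [apply: contraNneq aS => <-|apply: contraNneq yS => <-].
(* [R] has at least three vertices, so it is a triangle. Since [M] has five vertices, [y] must be
   [b]; then the anchoring of [a] gives a fourth vertex of degree 2 or the 4-cycle through [a], [u],
   [v] and [b]. *)
case: shape => [t tD RE eat ety|u t tD RE eut euy ety eau|u t tD RE eut eua eta euy|u v t tD RE eau euv eut evt evy].
- by move: R3; rewrite RE cards1.
- by move: R3; rewrite RE cards2; case: (_ != _).
- by move: R3; rewrite RE cards2; case: (_ != _).
have RE3 : #|R| <= 3.
  by rewrite RE setUC cardsU1 cards2; case: (_ \notin _); case: (_ != _).
have [uR vR tR] : [/\ u \in R, v \in R & t \in R] by rewrite RE !inE !eqxx !orbT.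
case: yKb => [yK|[yb SK]].
  have yM : y \notin M by apply: KM.
  have : #|M :\ a :\ y| <= #|R| by apply: subset_leq_card.
  move: M1; rewrite (cardsD1 y (M :\ a)) in_setD1 (negPf yM) andbF; arith.
have RW z : z \in R -> [/\ z \in W, a != z, z != y & z \notin S].
  by rewrite /R in_setD !in_setU1 !negb_or => /andP [/and3P [za zy zS] zW]; rewrite eq_sym.
have [uW au uy uS] := RW u uR; have [vW av vy vS] := RW v vR; have [tW at_ ty tS] := RW t tR.
have uv := edge_neq euv; have ut := edge_neq eut; have vt := edge_neq evt.
have etv : e t v by rewrite e_sym. have etu : e t u by rewrite e_sym.
have dv := deg2_nbr_cubic tD vW etv.
have [aD|d2] := ana.
  have [_ _ W3] := Wgood; have : t |: (a |: (S :&: deg2s W)) \subset deg2s W.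
    by rewrite !subUset !sub1set tD aD subsetIr.
  move/subset_leq_card; rewrite cardsU1 !inE eq_sym (negPf at_) (negPf tS) /= cardsU1 !inE (negPf aS) /=.
  by move: many W3; arith.
have sN : nbh W a :\: K \subset [set u; y].
  apply/subsetP => z; rewrite in_setD nbh_mem => /and3P [zK zW eaz]; rewrite !inE.
  case zy: (z == y); first by rewrite orbT.
  have : z \in R by rewrite /R in_setD !in_setU1 negb_or eq_sym (edge_neq eaz) zy SK zK zW.
  rewrite RE !inE; case: (z == u) => //= /orP [] /eqP E; rewrite E e_sym in eaz; exfalso.
    have := @three_nbrs v u t y a dv uW tW yW ut uy ty.
    rewrite e_sym euv evt evy aW eaz => /(_ isT isT isT isT isT).
    by rewrite (negPf au) (negPf at_) (negPf ay).
  have := @two_nbrs t u v a (deg2s_dg tD) uW vW uv etu etv aW eaz.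
  by rewrite (negPf au) (negPf av).
have eay : e a y.
  have E : nbh W a :\: K = [set u; y] by apply/eqP; rewrite eqEcard sN cards2 uy.
  have : y \in nbh W a :\: K by rewrite E !inE eqxx orbT.
  by rewrite in_setD nbh_mem => /and3P [].
have := @no_zero_cycle a [:: u; v; y] y [::]; rewrite /= eau euv evy eay !inE !negb_or !andbT.
by rewrite au av ay uv uy vy => /(_ isT erefl isT isT).
Qed.

(** The listed edges already give each vertex [degE g i] neighbours, and the degree bound leaves no
    room for others. *)
Lemma models_of_degrees g (f : nat -> V) : uniq (map f (iota 0 g.1)) -> W =i map f (iota 0 g.1) ->
  all (fun x => [&& x.1 < g.1, x.2 < g.1 & e (f x.1) (f x.2)]) g.2 ->
  (forall i, i < g.1 -> dg W (f i) <= degE g i) -> models e W g f.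
Proof.
move=> U WE Ed dle; split=> // i j ig jg.
have inj k l : k < g.1 -> l < g.1 -> f k = f l -> k = l.
  move=> kg lg; have nthf m : m < g.1 -> f m = nth (f 0) (map f (iota 0 g.1)) m.
    by move=> mg; rewrite (nth_map 0) ?size_iota // nth_iota.
  rewrite (nthf k) // (nthf l) // => /eqP; rewrite nth_uniq ?size_map ?size_iota // => /eqP.
  by [].
have fW k : k < g.1 -> f k \in W by move=> kg; rewrite WE map_f // mem_iota.
have adj k l : k < g.1 -> l < g.1 -> adjE g.2 k l -> e (f k) (f l).
  move=> kg lg /orP [] /(allP Ed) /= /and3P [_ _] //; by rewrite e_sym.
apply/idP/idP => [eij|]; last exact: adj.
pose A := [seq f k | k <- iota 0 g.1 & adjE g.2 i k].
have UA : uniq A.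
  rewrite map_inj_in_uniq ?filter_uniq ?iota_uniq // => k l.
  by rewrite !mem_filter !mem_iota => /andP [_ kg] /andP [_ lg]; apply: inj.
have sA : {subset A <= enum (nbh W (f i))}.
  move=> x /mapP [k]; rewrite mem_filter mem_iota mem_enum nbh_mem => /andP [aik kg] ->.
  by rewrite fW //= adj.
have sz : size (enum (nbh W (f i))) <= size A.
  by rewrite -cardE size_map size_filter; apply: dle.
have [_ E] := uniq_min_size UA sA sz.
have : f j \in enum (nbh W (f i)) by rewrite mem_enum nbh_mem fW.
rewrite -E => /mapP [k]; rewrite mem_filter mem_iota => /andP [aik kg] /(inj _ _ jg kg) ->; exact: aik.
Qed.

Lemma first_hit (M : {set V}) p y : y \notin M -> last y p \in M ->
  exists p1 w p2, [/\ p = p1 ++ w :: p2, w \in M & {in p1, forall z, z \notin M}].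
Proof.
elim: p y => [|z p IHp] y /=; first by move=> /negPf ->.
move=> yM L; have [zM|zM] := boolP (z \in M); first by exists [::], z, p.
have [p1 [w [p2 [-> wM H]]]] := IHp z zM L; exists (z :: p1), w, p2; split=> // u.
by rewrite inE => /predU1P [->|/H].
Qed.

(** [x] has a neighbour other than [n1] and [n2]; if it lies outside [M], a path that avoids [x]
    leads from it back to [M]. With [n1] and [n2] the known neighbours of [x], an ear without
    interior is a new edge. *)
Lemma weak_ear (M : {set V}) x n1 n2 w0 : M \subset W -> x \in M -> w0 \in M -> w0 != x -> x \notin deg2s W ->
  exists c w, [/\ path e x (rcons c w), w \in M, w != x, all (mem (W :\: M)) c & uniq c] /\
    (c == [::] -> w != n1 /\ w != n2).
Proof.
move=> sM xM w0M w0x xD; have xW := subsetP sM _ xM.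
have [y [yW exy y1 y2]] : exists y, [/\ y \in W, e x y, y != n1 & y != n2].
  have := deg_ge3 xW xD; rewrite /dg (cardsD1 n1) (cardsD1 n2) => H.
  have /card_gt0P [y] : 0 < #|nbh W x :\ n1 :\ n2| by move: H; case: (_ \in _); case: (_ \in _); arith.
  by rewrite !inE => /and4P [y2 y1 yW exy]; exists y.
have yx : y != x by rewrite eq_sym edge_neq.
have [yM|yM] := boolP (y \in M); first by exists [::], y; rewrite /= exy.
have yWx : y \in W :\ x by rewrite in_setD1 yx.
have w0W := subsetP sM _ w0M.
have [p [Pp Ap Lp Up]] := connect_insideP e w0 yWx (W_minus_connected yW w0W yx w0x).
have [|p1 [w [p2 [Ep wM Hp]]]] := @first_hit M p y yM; first by rewrite Lp.
exists (y :: p1), w; split=> //; split=> //.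
- by move: Pp; rewrite Ep -cat_rcons cat_path /= exy => /andP [].
- by have : w \in p; [rewrite Ep mem_cat inE eqxx orbT|move/(allP Ap); rewrite /= in_setD1 => /andP []].
- rewrite /= in_setD yM yW; apply/allP => z zp; rewrite /= in_setD Hp //.
  have : z \in p by rewrite Ep mem_cat zp.
  by move/(allP Ap); rewrite /= in_setD1 => /andP [].
by move: Up; rewrite Ep -cat_cons cat_uniq => /andP [].
Qed.

(** The graph is T3: two triangles joined by the edge from [v2] to [c] and by a path through [t]. *)
Lemma two_triangles_exc t c u t1 u2 v2 t2 :
  uniq [:: t; c; u; t1; u2; v2; t2] -> W =i [:: t; c; u; t1; u2; v2; t2] ->
  [/\ t \in deg2s W, t1 \in deg2s W & t2 \in deg2s W] -> e t u -> e t u2 ->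
  [/\ e u t1, e u c & e t1 c] -> [/\ e u2 v2, e u2 t2, e v2 t2 & e v2 c] -> is_exc W.
Proof.
move=> U WE [tD t1D t2D] etu etu2 [eut1 euc et1c] [eu2v2 eu2t2 ev2t2 ev2c].
have inW x : x \in [:: t; c; u; t1; u2; v2; t2] -> x \in W by rewrite WE.
have [uW cW u2W v2W] : [/\ u \in W, c \in W, u2 \in W & v2 \in W].
  by split; apply: inW; rewrite !inE eqxx ?orbT.
exists (7, T3_E), (nth t [:: u; c; t1; t2; u2; v2; t]); split=> //; apply: models_of_degrees.
- have U' : uniq [:: u; c; t1; t2; u2; v2; t] by uniq_by U.
  exact: U'.
- by move=> x; rewrite WE /= !inE; do 7! case: (x == _); rewrite ?orbT.
- by rewrite /= euc [e c t1]e_sym et1c [e t1 u]e_sym eut1 [e t2 u2]e_sym eu2t2 eu2v2 ev2t2 [e u2 t]e_sym etu2 etu ev2c.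
have cub y z k : y \in deg2s W -> z \in W -> e y z -> k = 3 -> dg W z <= k.
  by move=> yD zW eyz ->; rewrite (deg2_nbr_cubic yD).
move=> [|[|[|[|[|[|[|i]]]]]]] // _.
- by apply: (cub t1) => //; rewrite e_sym.
- exact: (cub t1).
- by rewrite (deg2s_dg t1D).
- by rewrite (deg2s_dg t2D).
- by apply: (cub t2) => //; rewrite e_sym.
- by apply: (cub t2) => //; rewrite e_sym.
- by rewrite (deg2s_dg tD).
Qed.

(** Otherwise some [c] forms a 2-cut with [t]. The other vertices of degree 2 are then one on each
    side, and both sides have known shapes, in which none of degree 2 is adjacent to [t]. Two forks
    would give [c] degree at least 4, and a fork with a triangle gives T3. *)
Lemma deg2_cycle t : t \in deg2s W ->
  exists p q, [/\ p != q, nbh W t = [set p; q] & linked_twice (inside (W :\ t)) p q].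
Proof.
move=> tD; have tW := deg2s_sub tD; have dt := deg2s_dg tD.
have /card_gt0P [p] : 0 < #|nbh W t| by move: dt; rewrite /dg => ->.
rewrite nbh_mem => /andP [pW etp]; have [q [qW etq qp N]] := dg2P dt pW etp.
have pq : p != q by rewrite eq_sym.
exists p, q; split=> //; have tp := edge_neq etp; have tq := edge_neq etq.
have pt : p != t by rewrite eq_sym. have qt : q != t by rewrite eq_sym.
apply: two_paths => //; first exact: inside_sym.
  exact: W_minus_connected.
move=> c cp cq; apply/negPn/negP => ncut.
have [cW ct] : c \in W /\ c != t.
  apply/andP/negPn/negP => cWt; case/negP: ncut.
  have := W_minus_connected pW qW pt qt; apply: connect_sub => u v uv; apply: connect1.
  move: uv => /=; rewrite !in_setD1 => /and3P [/andP [ut uW] /andP [vt vW] euv].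
  rewrite ut uW vt vW euv !andbT; apply/andP; split; apply: contraNneq cWt => <-; by rewrite ?ut ?uW ?vt ?vW.
have ncut' : ~~ connect (inside (W :\ t :\ c)) p q.
  apply: contra ncut; apply: connect_sub => u v; rewrite /= !in_setD1 => /and3P [/and3P [uc ut uW] /and3P [vc vt vW] euv].
  by apply: connect1; rewrite /= !in_setD1 uc ut uW vc vt vW.
pose S := component (W :\ t :\ c) p; pose R := W :\: (t |: (c |: S)).
have pS : p \in S by rewrite !inE eq_sym cp pt pW connect0.
have sS : S \subset W by apply/subsetP => z; rewrite !inE => /andP [/and3P []].
have tS : t \notin S by rewrite !inE eqxx /= andbF.
have cS : c \notin S by rewrite !inE eqxx.
have qR : q \in R.
  rewrite /R in_setD !in_setU1 (negPf qt) eq_sym (negPf cq) qW andbT /=.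
  by rewrite inE negb_and ncut' orbT.
have tc : t != c by rewrite eq_sym.
have cloS u v : u \in S -> v \in W -> e u v -> v \in t |: (c |: S).
  move=> uS vW euv; rewrite !in_setU1; case vt: (v == t) => //=; case vc: (v == c) => //=.
  by apply: component_closed uS _ euv; rewrite !in_setD1 vc vt.
have cloR u v : u \in R -> v \in W -> e u v -> v \in t |: (c |: R) by apply: cut_complement.
have [tR cR] : t \notin R /\ c \notin R by rewrite /R !in_setD !in_setU1 !eqxx !orbT.
have sR : R \subset W by apply: subsetDl.
have dSR : [disjoint S & R].
  by rewrite disjoint_sym disjoints_subset; apply/subsetP => z; rewrite in_setD in_setC !in_setU1 => /andP [/norP [_ /norP []]].
have [_ _ W3] := Wgood.
have D0 : (S :&: deg2s W) :&: (R :&: deg2s W) = set0.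
  apply/setP => z; rewrite in_set0 !in_setI; case zS: (z \in S) => //=.
  by rewrite (disjointFr dSR zS) andbF.
have cnt : #|S :&: deg2s W| + #|R :&: deg2s W| <= 2.
  have : t |: ((S :&: deg2s W) :|: (R :&: deg2s W)) \subset deg2s W by rewrite !subUset sub1set tD !subsetIr.
  move/subset_leq_card; rewrite cardsU1 cardsU !(in_setU, in_setI) (negPf tS) (negPf tR) /=.
  by rewrite D0 cards0; move: W3; arith.
have shS : #|S :&: deg2s W| <= 1 -> side_shape S t c.
  move=> few; apply: two_cut => //; first by apply/set0Pn; exists p.
  rewrite properE; apply/andP; split; first by rewrite !subUset !sub1set tW cW.
  by apply/subsetPn; exists q => //; move: qR; rewrite in_setD => /andP [].
have shR : #|R :&: deg2s W| <= 1 -> side_shape R t c.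
  move=> few; apply: two_cut => //; first by apply/set0Pn; exists q.
  rewrite properE; apply/andP; split; first by rewrite !subUset !sub1set tW cW.
  apply/subsetPn; exists p => //; rewrite !in_setU1 (negPf pt) eq_sym (negPf cp) /=.
  by rewrite (disjointFr dSR pS).
have pos (A : {set V}) : side_shape A t c -> 0 < #|A :&: deg2s W|.
  by move=> /side_shape_deg2 [z zA zD]; apply/card_gt0P; exists z; rewrite in_setI zA.
have [{}shS {}shR] : side_shape S t c /\ side_shape R t c.
  case: (few_sides dSR) => few.
    by have s := shS few; split=> //; apply: shR; have := pos _ s; move: cnt; arith.
  by have s := shR few; split=> //; apply: shS; have := pos _ s; move: cnt; arith.
have pS1 := pos _ shS; have pR1 := pos _ shR.
have nadj z : z \in deg2s W -> e t z -> False.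
  by move=> zD etz; have := adjacent_deg2 tD zD; rewrite etz.
have WE : W = t |: (c |: (S :|: R)).
  apply/setP => z; rewrite !in_setU1 in_setU /R in_setD !in_setU1 negb_or negb_or.
  have [->|zt] := eqVneq z t; first by rewrite tW.
  have [->|zc] := eqVneq z c; first by rewrite cW.
  by case zS: (z \in S) => //=; rewrite (subsetP sS).
have sep x y : x \in S -> y \in R -> x != y by move=> xS; apply: contraTneq => <-; rewrite (disjointFr dSR xS).
have nS x : x \in S -> [/\ t != x, c != x & x \in W].
  by move=> xS; rewrite (subsetP sS) //; split=> //; [apply: contraNneq tS => ->|apply: contraNneq cS => ->].
have nR x : x \in R -> [/\ t != x, c != x & x \in W].
  by move=> xR; rewrite (subsetP sR) //; split=> //; [apply: contraNneq tR => ->|apply: contraNneq cR => ->].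
have mixed (A B : {set V}) u t1 u2 v2 t2 : A = [set u; t1] -> B = [set u2; v2; t2] -> W = t |: (c |: (A :|: B)) ->
   (forall x y, x \in A -> y \in B -> x != y) -> (forall x, x \in A :|: B -> [/\ t != x, c != x & x \in W]) ->
   t1 \in deg2s W -> t2 \in deg2s W -> e t u -> e t u2 ->
   [/\ e u t1, e u c & e t1 c] -> [/\ e u2 v2, e u2 t2, e v2 t2 & e v2 c] -> False.
  move=> AE BE WE' sAB nAB t1D t2D etu etu2 H1 H2; apply: not_exc.
  apply: (@two_triangles_exc t c u t1 u2 v2 t2) => //.
    have [uA t1A] : u \in A /\ t1 \in A by rewrite AE !inE !eqxx orbT.
    have [u2B v2B t2B] : [/\ u2 \in B, v2 \in B & t2 \in B] by rewrite BE !inE !eqxx !orbT.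
    have inA x : x \in A -> x \in A :|: B by rewrite in_setU => ->.
    have inB x : x \in B -> x \in A :|: B by rewrite in_setU orbC => ->.
    case: (nAB _ (inA _ uA)) (nAB _ (inA _ t1A)) (nAB _ (inB _ u2B)) (nAB _ (inB _ v2B)) (nAB _ (inB _ t2B)).
    move=> a1 a2 _ [b1 b2 _] [c1 c2 _] [d1 d2 _] [f1 f2 _].
    case: H1 H2 => [/edge_neq h1 _ _] [/edge_neq g1 /edge_neq g2 /edge_neq g3 _].
    by rewrite /= !inE !negb_or tc a1 a2 b1 b2 c1 c2 d1 d2 f1 f2 h1 g1 g2 g3 !sAB.
  by move=> x; rewrite {1}WE' AE BE !inE; do 7! case: (x == _); rewrite ?orbT.
case: shS => [t1 t1D SE ett1 _|u t1 t1D SE eut1 euc et1c etu|u t1 t1D SE eut1 eut et1t _|u v t1 t1D SE etu euv eut1 evt1 evc].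
- exact: nadj ett1.
- case: shR => [t2 t2D RE ett2 _|u2 t2 t2D RE eut2 eu2c et2c etu2|u2 t2 t2D RE _ _ et2t _|u2 v2 t2 t2D RE etu2 eu2v2 eu2t2 ev2t2 ev2c].
  + exact: nadj ett2.
  + have [uS t1S] : u \in S /\ t1 \in S by rewrite SE !inE !eqxx orbT.
    have [u2R t2R] : u2 \in R /\ t2 \in R by rewrite RE !inE !eqxx orbT.
    have [_ _ uW] := nS _ uS; have [_ _ t1W] := nS _ t1S; have [_ _ u2W] := nR _ u2R; have [_ _ t2W] := nR _ t2R.
    have dc := deg2_nbr_cubic t1D cW et1c.
    have := three_nbrs dc uW t1W u2W (edge_neq eut1) (sep _ _ uS u2R) (sep _ _ t1S u2R) _ _ _ t2W.
    rewrite ![e c _]e_sym euc et1c eu2c et2c => /(_ isT isT isT isT).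
    by rewrite ![t2 == _]eq_sym (negPf (sep _ _ uS t2R)) (negPf (sep _ _ t1S t2R)) (negPf (edge_neq eut2)).
  + by apply: (nadj t2) => //; rewrite e_sym.
  apply: (mixed S R u t1 u2 v2 t2) => //.
  by move=> x; rewrite in_setU => /orP [/nS|/nR].
- by apply: (nadj t1) => //; rewrite e_sym.
case: shR => [t2 t2D RE ett2 _|u2 t2 t2D RE eut2 eu2c et2c etu2|u2 t2 t2D RE _ _ et2t _|u2 v2 t2 t2D RE etu2 eu2v2 eu2t2 ev2t2 ev2c].
- exact: nadj ett2.
- apply: (mixed R S u2 t2 u v t1) => //; first by rewrite [R :|: S]setUC.
    by move=> x y xR yS; rewrite eq_sym sep.
  by move=> x; rewrite in_setU => /orP [/nR|/nS].
- by apply: (nadj t2) => //; rewrite e_sym.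
have [uS vS t1S] : [/\ u \in S, v \in S & t1 \in S] by rewrite SE !inE !eqxx !orbT.
have [u2R v2R t2R] : [/\ u2 \in R, v2 \in R & t2 \in R] by rewrite RE !inE !eqxx !orbT.
have [tu cu uW] := nS _ uS; have [tv cv vW] := nS _ vS; have [tt1 ct1 t1W] := nS _ t1S.
have [tu2 cu2 u2W] := nR _ u2R; have [tv2 cv2 v2W] := nR _ v2R; have [tt2 ct2 t2W] := nR _ t2R.
have no_c x y z : x \in W -> y \in W -> z \in deg2s W -> e t x -> e x y -> e x z -> e y z -> t != y -> t != z ->
    c != y -> c != z -> ~~ e x c.
  move=> xW yW zD etx exy exz eyz ty tz cy cz; apply/negP => exc.
  have dx : dg W x = 3 by apply: (deg2_nbr_cubic zD) => //; rewrite e_sym.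
  have := three_nbrs dx tW yW (deg2s_sub zD) ty tz (edge_neq eyz) _ exy exz cW exc.
  by rewrite e_sym etx => /(_ isT); rewrite (negPf ct) (negPf cy) (negPf cz).
have no_c2 x y z : z \in deg2s W -> x \in W -> y \in W -> x != y -> e z x -> e z y -> c != x -> c != y -> ~~ e z c.
  move=> zD xW yW xy ezx ezy cx cy; apply/negP => ezc.
  have := two_nbrs (deg2s_dg zD) xW yW xy ezx ezy cW ezc; by rewrite (negPf cx) (negPf cy).
(* Two triangles leave [c] only the neighbours [v] and [v2], which makes it a fourth vertex of
   degree 2. *)
have sN : nbh W c \subset [set v; v2].
  apply/subsetP => z; rewrite nbh_mem !inE => /andP [zW]; rewrite e_sym => ezc.
  have zc := edge_neq ezc.
  move: zW ezc; rewrite {1}WE SE RE !inE (negPf zc) /= => zW ezc.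
  case zv: (z == v) => //=; case zv2: (z == v2) => //=; exfalso; move: zW ezc.
  rewrite zv zv2 /= ?orbF -?orbA; case/or4P => [/eqP|/eqP|/eqP|/orP [/eqP|/eqP]] ->; apply/negP.
  - by apply: (no_c2 u u2) => //; apply: sep.
  - exact: (no_c u v t1).
  - by apply: (no_c2 u v) => //; rewrite ?(edge_neq euv) // e_sym.
  - exact: (no_c u2 v2 t2).
  - by apply: (no_c2 u2 v2) => //; rewrite ?(edge_neq eu2v2) // e_sym.
have cD : c \in deg2s W.
  rewrite deg2s_mem cW eqn_leq W2 // andbT; apply: leq_trans (subset_leq_card sN) _.
  by rewrite cards2; case: (_ != _).
have : t |: (c |: ((S :&: deg2s W) :|: (R :&: deg2s W))) \subset deg2s W by rewrite !subUset !sub1set tD cD !subsetIr.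
move/subset_leq_card; rewrite !cardsU1 cardsU !(in_setU1, in_setU, in_setI) (negPf tS) (negPf tR) (negPf cS) (negPf cR) (negPf tc) /=.
by rewrite D0 cards0; move: pS1 pR1 W3; arith.
Qed.

(** * Subdivisions realizing a state *)

Definition branch := (edge * seq V)%type.
Definition no_branch : branch := ((0, 0, 4), [::]).
Definition branch_ok n (f : nat -> V) (x : branch) :=
  [&& x.1.1.1 < n, x.1.1.2 < n, x.1.2 == ty_of x.2 & path e (f x.1.1.1) (rcons x.2 (f x.1.1.2))].
Definition verts n (f : nat -> V) (L : seq branch) := map f (iota 0 n) ++ flatten (map snd L).

Lemma steps_fromP v j0 E w x j : (w, x, j) \in steps_from v j0 E ->
  exists t, [/\ j0 <= j, j - j0 < size E, x = lab t &
    nth (0,0,4) E (j - j0) = (v, w, t) \/ nth (0,0,4) E (j - j0) = (w, v, t)].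
Proof.
elim: E j0 => // [[[a b] t] E] IHE j0 /=.
have rec : (w, x, j) \in steps_from v j0.+1 E -> exists t', [/\ j0 <= j, j - j0 < (size E).+1, x = lab t' &
    nth (0,0,4) ((a, b, t) :: E) (j - j0) = (v, w, t') \/ nth (0,0,4) ((a, b, t) :: E) (j - j0) = (w, v, t')].
  move=> /IHE [t' [lt sz -> H]]; exists t'.
  have -> : j - j0 = (j - j0.+1).+1 by rewrite subnSK.
  by split=> //; apply: ltnW.
rewrite !eqnE; case: eqP rec => [->|_] rec.
  rewrite inE => /predU1P [[-> -> ->]|/rec //].
  by exists t; rewrite subnn leqnn; split=> //; left.
case: eqP rec => [->|_] rec; last exact: rec.
rewrite inE => /predU1P [[-> -> ->]|/rec //].
by exists t; rewrite subnn leqnn; split=> //; right.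
Qed.

Section Sums.
Variables (n : nat) (f : nat -> V) (L : seq branch).
Hypotheses (vU : uniq (verts n f L)) (Lok : all (branch_ok n f) L).
Notation int j := (nth no_branch L j).2.

Lemma f_vert i : i < n -> f i \in verts n f L.
Proof. by move=> il; rewrite mem_cat map_f // mem_iota. Qed.

Lemma int_vert j z : j < size L -> z \in int j -> z \in verts n f L.
Proof.
move=> jl zj; rewrite mem_cat; apply/orP; right; apply/flatten_mapP; exists (nth no_branch L j) => //.
exact: mem_nth.
Qed.

Lemma int_f j z : j < size L -> z \in int j -> z \notin map f (iota 0 n).
Proof.
move=> jl zj; have := vU; rewrite cat_uniq => /and3P [_ /hasPn H _]; apply: H.
by apply/flatten_mapP; exists (nth no_branch L j) => //; apply: mem_nth.
Qed.

Lemma f_int j i : i < n -> j < size L -> f i \notin int j.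
Proof. by move=> il jl; apply/negP => /(int_f jl); rewrite map_f // mem_iota. Qed.

Lemma int_inj i j z : i < size L -> j < size L -> z \in int i -> z \in int j -> i = j.
Proof.
have : uniq (flatten (map snd L)) by move: vU; rewrite cat_uniq => /and3P [].
elim: L i j => // x L' IHL [|i] [|j] //=; rewrite cat_uniq => /and3P [_ /hasPn H U]; rewrite ?ltnS => il jl zi zj.
- by have := H z; rewrite /= zi => /(_ _)/negP; case=> //; apply/flatten_mapP; exists (nth no_branch L' j); rewrite ?mem_nth.
- by have := H z; rewrite /= zj => /(_ _)/negP; case=> //; apply/flatten_mapP; exists (nth no_branch L' i); rewrite ?mem_nth.
by congr _.+1; apply: IHL.
Qed.

Lemma int_uniq j : j < size L -> uniq (int j).
Proof.
have : uniq (flatten (map snd L)) by move: vU; rewrite cat_uniq => /and3P [].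
by elim: L j => // x L' IHL [|j] /=; rewrite cat_uniq => /and3P [U1 _ U] // jl; apply: IHL.
Qed.

Lemma f_inj i j : i < n -> j < n -> f i = f j -> i = j.
Proof.
move=> il jl; have : uniq (map f (iota 0 n)) by move: vU; rewrite cat_uniq => /and3P [].
have nthf m : m < n -> f m = nth (f 0) (map f (iota 0 n)) m.
  by move=> mg; rewrite (nth_map 0) ?size_iota // nth_iota.
move=> U; rewrite (nthf i) // (nthf j) // => /eqP; rewrite nth_uniq ?size_map ?size_iota // => /eqP.
by [].
Qed.

Lemma branch_okP j : j < size L -> branch_ok n f (nth no_branch L j).
Proof. by move=> jl; apply: (allP Lok); apply: mem_nth. Qed.

Lemma branch_path j v w t : j < size L -> (nth no_branch L j).1 = (v, w, t) \/ (nth no_branch L j).1 = (w, v, t) ->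
  [/\ v < n, w < n & exists p, [/\ path e (f v) (rcons p (f w)), t = ty_of p, p =i int j, uniq p & size p = size (int j)]].
Proof.
move=> jl; have := branch_okP jl; have := int_uniq jl; case: (nth no_branch L j) => [[[a b] t'] p] /= U.
case/and4P => /= an bn /eqP tp P [[<- <- <-]|[<- <- <-]]; split=> //; first by exists p.
by exists (rev p); rewrite ty_rev size_rev rev_uniq; split=> //; [apply: path_flip|apply: mem_rev].
Qed.

Definition walk u w k (I : seq nat) := exists q, [/\ path e (f u) q, last (f u) q = f w, uniq (f u :: q),
  size q %% 4 = k & forall z, z \in q -> z \in map f (iota 0 n) \/ exists2 j, j \in I & z \in int j].

Definition entry_ok u (x : entry) := [/\ x.1.1 < n, x.1.2 < 4, all (fun j => j < size L) x.2 & walk u x.1.1 x.1.2 x.2].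

Let A := [seq steps_from v 0 (map fst L) | v <- iota 0 n].

(** The invariant is that every branch used has both ends in [vis]. A branch to an unvisited vertex
    is therefore new, and its interior is disjoint from the walk. *)
Lemma dfs_ok u fuel vis v k ids acc : u < n -> v < n -> k < 4 ->
  all (fun j => [&& j < size L, (nth no_branch L j).1.1.1 \in vis & (nth no_branch L j).1.1.2 \in vis]) ids ->
  (exists q, [/\ path e (f u) q, last (f u) q = f v, uniq (f u :: q), size q %% 4 = k &
     (forall z, z \in q -> z \in map f (iota 0 n) \/ exists2 j, j \in ids & z \in int j) /\
     (forall i, i < n -> f i \in f u :: q -> i \in vis)]) ->
  (forall x, x \in acc -> entry_ok u x) -> forall x, x \in dfs fuel A vis v k ids acc -> entry_ok u x.
Proof.
move=> un; elim: fuel vis v k ids acc => // fuel IHf vis v k ids acc vn k4 ids_ok [q [Pq Lq Uq Zq [Cq Vq]]] acc_ok.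
have v_vis : v \in vis.
  by apply: Vq => //; rewrite -Lq; apply: mem_last.
have {}acc_ok x : x \in (v, k, ids) :: acc -> entry_ok u x.
  rewrite inE => /predU1P [->|]; last exact: acc_ok.
  split=> //; last by exists q.
  by apply/allP => j /(allP ids_ok) /and3P [].
have : forall y, y \in nth [::] A v -> y \in steps_from v 0 (map fst L).
  by rewrite (nth_map 0) ?size_iota // nth_iota.
rewrite /=; move: ((v, k, ids) :: acc) acc_ok; elim: (nth [::] A v) => [|[[w x] j] l IHl] // acc' acc_ok l_ok.
apply: IHl; last by move=> y yl; apply: l_ok; rewrite inE yl orbT.
rewrite memnE; case wv: (w \in vis) => //.
have [t [_]] := steps_fromP (l_ok _ (mem_head _ _)); rewrite subn0 size_map => jl Ex Ej.
have Ej' : (nth no_branch L j).1 = (v, w, t) \/ (nth no_branch L j).1 = (w, v, t).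
  by rewrite -!(nth_map no_branch (0,0,4) fst).
have [_ wn [p [Pp tp pE Up sp]]] := branch_path jl Ej'.
have jids : j \notin ids.
  apply/negP => /(allP ids_ok) /and3P [_]; case: Ej' => -> /=; by rewrite wv ?andbF.
have x4 : x < 4 by rewrite Ex tp lab_lt4 ?ty_of_lt5.
have pq z : z \in p -> z \notin f u :: q.
  rewrite pE => zj; rewrite inE negb_or; apply/andP; split.
    by apply: contraTneq zj => ->; apply: f_int.
  apply/negP => zq; case: (Cq z zq) => [zF|[i iids zi]]; first by have := int_f jl zj; rewrite zF.
  have il : i < size L by have /and3P [] := allP ids_ok i iids.
  by have E := int_inj il jl zi zj; rewrite -E iids in jids.
have wq : f w \notin f u :: q by apply/negP => /(Vq w wn); rewrite wv.
have wp : f w \notin p by rewrite pE; apply: f_int.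
apply: IHf => //.
- by rewrite add4E // ltn_pmod.
- apply/andP; split; last first.
    by apply/allP => i /(allP ids_ok) /and3P [-> h1 h2]; rewrite !inE h1 h2 !orbT.
  by rewrite jl; case: Ej' => -> /=; rewrite !inE eqxx v_vis !orbT.
exists (q ++ rcons p (f w)); split.
- by rewrite cat_path Pq Lq.
- by rewrite last_cat last_rcons.
- rewrite -cat_cons; apply: uniq_cat_notin => //; first by rewrite rcons_uniq wp.
  move=> z zq; rewrite mem_rcons inE negb_or; apply/andP; split.
    by apply: contraTneq zq => ->.
  by apply: contraL zq => /pq.
- by rewrite size_cat size_rcons -modnDm Zq add4E // Ex tp lab_ty modnDmr.
split=> [z|i il].
  rewrite mem_cat mem_rcons inE => /orP [zq|/predU1P [->|zp]].
  - by case: (Cq z zq) => [|[i iids zi]]; [left|right; exists i; rewrite // inE iids orbT].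
  - by left; rewrite map_f // mem_iota.
  by right; exists j; rewrite ?mem_head // -pE.
rewrite -cat_cons mem_cat mem_rcons inE => /orP [iq|/predU1P [/f_inj E|ip]].
- by rewrite inE Vq ?orbT.
- by rewrite E ?mem_head.
by have := f_int il jl; rewrite -pE ip.
Qed.

Lemma entries_ok u x : u < n -> x \in entries n (map fst L) u -> entry_ok u x.
Proof.
move=> un; apply: dfs_ok => //; exists [::]; split=> //; split=> // i il.
by rewrite !inE => /eqP /f_inj ->.
Qed.

Lemma bucketsP u w : w < n -> forall x, x \in nth [::] (buckets n (entries n (map fst L) u)) w ->
  u < n -> [/\ x.1 < 4, all (fun j => j < size L) x.2 & walk u w x.1 x.2].
Proof.
move=> wn x; rewrite (nth_map 0) ?size_iota // nth_iota // => /mapP [y]; rewrite mem_filter eqnE => /andP [/eqP yw yE] -> un.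
by have [_ k4 sz] := entries_ok un yE; rewrite yw.
Qed.
End Sums.

Record realizes (s : state) (f : nat -> V) (L : seq branch) : Prop := Realizes {
  real_E : map fst L = sE s;
  real_U : uniq (verts (sn s) f L);
  real_W : all (mem W) (verts (sn s) f L);
  real_ok : all (branch_ok (sn s) f) L;
  real_T : all (fun t => (t < sn s) && (f t \in deg2s W)) (sT s);
  real_TU : uniq (sT s);
  real_C : all (fun c => (c < sn s) && (dg W (f c) == 3)) (sC s) }.

(** The neighbour of [f w] along the branch. A loop would be listed only once, but [well_formed]
    excludes loops. *)
Definition end_at (f : nat -> V) w (x : branch) : seq V :=
  if x.1.1.1 == w then [:: head (f x.1.1.2) x.2] else if x.1.1.2 == w then [:: last (f x.1.1.1) x.2] else [::].
Definition ends_at f w (L : seq branch) := flatten (map (end_at f w) L).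

Lemma size_ends_at f w L : size (ends_at f w L) = sdeg (map fst L) w.
Proof.
elim: L => //= [[[[a b] t] p] L IHL]; rewrite /ends_at /= size_cat -/(ends_at f w L) IHL /end_at /= !eqnE.
by case: eqP => //; case: eqP.
Qed.

Lemma end_at_ok n f w (x : branch) z : branch_ok n f x -> z \in end_at f w x ->
  e (f w) z /\ (z \in x.2 \/ x.2 = [::] /\ exists v, [/\ v < n, z = f v & x.1.1 = (w, v) \/ x.1.1 = (v, w)]).
Proof.
case: x => [[[a b] t] p]; rewrite /branch_ok /end_at /= => /and4P [an bn _ P].
case: eqP => [aw|_].
  rewrite inE => /eqP ->; rewrite -aw; case: p P => [|y p] /= /andP [ey _]; split=> //.
    by right; split=> //; exists b; split=> //; left.
  by left; rewrite mem_head.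
case: eqP => // bw; rewrite inE => /eqP ->; rewrite -bw; case: (lastP p) P => [|p' y] /=.
  by rewrite andbT e_sym => ey; split=> //; right; split=> //; exists a; split=> //; right.
by rewrite last_rcons rcons_path last_rcons e_sym => /andP [_ ey]; split=> //; left; rewrite mem_rcons mem_head.
Qed.

Lemma ends_at_ok n f w L z : all (branch_ok n f) L -> z \in ends_at f w L -> e (f w) z /\ z \in verts n f L.
Proof.
move=> ok /flatten_mapP [x xL zx]; have [ez H] := end_at_ok (allP ok x xL) zx; split=> //.
rewrite mem_cat; case: H => [zx2|[_ [v [vn -> _]]]]; last by rewrite map_f // mem_iota.
by apply/orP; right; apply/flatten_mapP; exists x.
Qed.

Lemma verts_cons n f (x : branch) L : perm_eq (verts n f (x :: L)) (x.2 ++ verts n f L).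
Proof. by rewrite /verts /= perm_catCA. Qed.

(** Interiors are disjoint, so two branches share a neighbour of [f w] only if both are single edges
    with the same ends. *)
Lemma ends_at_uniq n f w L : uniq (verts n f L) -> all (branch_ok n f) L -> no_parallel (map fst L) ->
  all (fun x : branch => x.1.1.1 != x.1.1.2) L -> w < n -> uniq (ends_at f w L).
Proof.
move=> + + + + wn; elim: L => // x L IHL.
rewrite (perm_uniq (verts_cons n f x L)) cat_uniq => /and3P [Ux /hasPn Hx UL] /andP [okx okL].
rewrite [map _ _]/= [no_parallel _]/=; case: ifP => // /negbT par npL /andP [dx dL].
rewrite /ends_at /= -/(ends_at f w L) cat_uniq IHL // andbT; apply/andP; split.
  by rewrite /end_at; case: eqP => // _; case: eqP.
apply/hasPn => z zL; apply/negP => zx.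
have [_ zv] := ends_at_ok okL zL; have [_ [zx2|[xnil [v [vn zv' xw]]]]] := end_at_ok okx zx.
  by have := Hx z zv; rewrite /= zx2.
move: zL => /flatten_mapP [y yL zy]; have [_ [zy2|[ynil [v' [vn' zv'' yw]]]]] := end_at_ok (allP okL y yL) zy.
  move: UL; rewrite /verts cat_uniq => /and3P [_ /hasPn H _]; have := H z; rewrite zv' /= map_f ?mem_iota // => /(_ _)/negP; case=> //.
  by apply/flatten_mapP; exists y; rewrite -?zv'.
have vv : v = v' by apply: (f_inj UL) => //; rewrite -zv' zv''.
case/negP: par; apply/hasP; exists y.1; first exact: map_f.
have [tx ty] : x.1.2 = 4 /\ y.1.2 = 4.
  by move: okx (allP okL y yL) => /and4P [_ _ /eqP -> _] /and4P [_ _ /eqP -> _]; rewrite xnil ynil.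
case: x xw tx dx {okx Hx zx xnil Ux} => [[[a b] t] p] /= xw -> dx; case: y yw ty {yL zy ynil} => [[[c d] t'] p'] /= yw ->.
rewrite !eqnE -vv {vv zv''} in yw *; case: xw dx => [[-> ->]|[-> ->]] dx; case: yw => [[-> ->]|[-> ->]]; rewrite !eqxx ?if_same //.
- by rewrite (negPf dx).
- by rewrite (negPf dx).
Qed.

Lemma realizes_vert s f L w : realizes s f L -> w < sn s -> f w \in W.
Proof. by move=> R wn; apply: (allP (real_W R)); apply: f_vert. Qed.

(** The listed neighbours are distinct and at least as many as the degree of [f w], so none is
    missing. *)
Lemma saturated_end s f L w y : realizes s f L -> well_formed s -> w < sn s -> saturated s w -> y \in W -> e (f w) y ->
  y \in ends_at f w L.
Proof.
move=> R /and3P [wf1 wf2 wf3] wn sat yW ey.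
have dL : all (fun x : branch => x.1.1.1 != x.1.1.2) L.
  by move: wf1; rewrite -(real_E R) all_map; apply: sub_all => -[[[a b] t] p] /= /and3P [_ _]; rewrite eqnE.
have U : uniq (ends_at f w L) by apply: ends_at_uniq (real_U R) (real_ok R) _ dL wn; rewrite (real_E R).
have sub : {subset ends_at f w L <= enum (nbh W (f w))}.
  move=> z /(ends_at_ok (real_ok R)) [ez zv]; rewrite mem_enum nbh_mem ez andbT; exact: (allP (real_W R)).
have sz : size (enum (nbh W (f w))) <= size (ends_at f w L).
  rewrite -cardE size_ends_at (real_E R); move: sat; rewrite /saturated !memnE.
  case: ifP => [wT _|_]; last case: ifP => // wC d3.
    have /andP [_ /deg2s_dg] := allP (real_T R) w wT; rewrite /dg => ->; exact: (allP wf3 w wT).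
  by have /andP [_ /eqP] := allP (real_C R) w wC; rewrite /dg => ->.
by have [_ ->] := uniq_min_size U sub sz; rewrite mem_enum nbh_mem yW.
Qed.

Definition upd (f : nat -> V) n x := fun k => if k == n then x else f k.

Lemma map_upd f n x : map (upd f n x) (iota 0 n.+1) = map f (iota 0 n) ++ [:: x].
Proof.
rewrite -addn1 iotaD map_cat /= add0n /upd eqxx; congr (_ ++ _).
by apply/eq_in_map => k; rewrite mem_iota => /andP [_ kn]; rewrite ltn_eqF.
Qed.

Lemma upd_lt f n x k : k < n -> upd f n x k = f k.
Proof. by move=> kn; rewrite /upd ltn_eqF. Qed.

Lemma upd_eq f n x : upd f n x n = x.
Proof. by rewrite /upd eqxx. Qed.

Lemma branch_ok_upd n f x L : all (branch_ok n f) L -> all (branch_ok n.+1 (upd f n x)) L.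
Proof.
apply: sub_all => -[[[a b] t] p] /and4P [/= an bn tp P].
by rewrite /branch_ok /= !upd_lt // tp P !ltnS (ltnW an) (ltnW bn).
Qed.

Lemma all_upd n f x (P : pred V) s : all (fun t => (t < n) && P (f t)) s ->
  all (fun t => (t < n.+1) && P (upd f n x t)) s.
Proof. by apply: sub_all => t /andP [tn Pt]; rewrite upd_lt // Pt ltnS ltnW. Qed.

(** [K] is any arrangement of the vertices, because a child regroups those known from its parent.
    The forced vertices are cubic by [deg2_nbr_cubic]. *)
Lemma realizes_mark n E T C f L K : map fst L = E -> perm_eq (verts n f L) K -> uniq K -> all (mem W) K ->
  all (branch_ok n f) L -> all (fun t => (t < n) && (f t \in deg2s W)) T -> uniq T ->
  all (fun c => (c < n) && (dg W (f c) == 3)) C -> realizes (mark n E T C) f L.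
Proof.
move=> LE pK UK WK ok TT UT CC.
have WL : all (mem W) (verts n f L) by rewrite (perm_all _ pK).
split=> //=; first by rewrite (perm_uniq pK).
rewrite all_cat CC andbT; apply/allP => c /flatten_mapP [[[u v] t] xE].
have cub a b : a < n -> b < n -> e (f a) (f b) -> a \in T -> (b < n) && (dg W (f b) == 3).
  move=> an bn eab aT; have /andP [_ aD] := allP TT a aT.
  rewrite bn (deg2_nbr_cubic aD _ eab) ?eqxx //; apply: (allP WL); exact: f_vert.
rewrite eqnE !memnE; case: eqP => // t4.
move: xE; rewrite -LE => /mapP [[x p] xL /= xE]; have := allP ok _ xL; rewrite /branch_ok -xE /= t4.
case/and4P => un vn /eqP tp P.
have p0 : p = [::] by apply/nilP; rewrite -ty_of4 -tp.
move: P; rewrite p0 /= andbT => euv; rewrite mem_cat.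
case uT: (u \in T); case vT: (v \in T); rewrite ?inE => // H.
- by case/orP: H => /eqP ->; [apply: cub euv uT|apply: cub vT => //; rewrite e_sym].
- by move: H; rewrite orbF => /eqP ->; apply: cub euv uT.
- by move/eqP: H => ->; apply: cub vT => //; rewrite e_sym.
Qed.

Lemma deg2_room s f L t : realizes s f L -> t \in deg2s W -> t \notin map f (sT s) -> size (sT s) <= 2.
Proof.
move=> R tD tv; have [_ _ W3] := Wgood.
have U : uniq (t :: map f (sT s)).
  rewrite /= tv map_inj_in_uniq ?(real_TU R) //.
  move=> a b aT bT; apply: (f_inj (real_U R)).
    by have /andP [] := allP (real_T R) a aT.
  by have /andP [] := allP (real_T R) b bT.
have : size (t :: map f (sT s)) <= size (enum (deg2s W)).
  apply: uniq_leq_size U _ => z; rewrite inE mem_enum => /predU1P [-> //|/mapP [k kT ->]].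
  by have /andP [] := allP (real_T R) k kT.
by rewrite -cardE /= size_map; move: W3; arith.
Qed.

(* A subdivision together with a path from [f en] through [x] and [p] to [f o]. *)
Record stage n (f : nat -> V) (L : seq branch) en o x p : Prop := Stage {
  st_en : en < n; st_o : o < n;
  st_U : uniq (verts n f L ++ x :: p);
  st_W : all (mem W) (verts n f L ++ x :: p);
  st_ok : all (branch_ok n f) L;
  st_e : e (f en) x;
  st_p : path e x (rcons p (f o)) }.

(** * Cycles closed by an ear *)

Section Reach.
Variables (n : nat) (f : nat -> V) (L : seq branch) (en o : nat) (x : V) (p : seq V).
Hypothesis st : stage n f L en o x p.
Notation int j := (nth no_branch L j).2.
Notation rest := (map fst L).

Lemma st_vU : uniq (verts n f L).
Proof. by move: (st_U st); rewrite cat_uniq => /and3P []. Qed.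

(* Excluding the interior of the [j]-th path; [j = size L] excludes nothing. *)
Definition off j z := z \in map f (iota 0 n) \/ exists2 i, i < size L /\ i != j & z \in int i.
Definition walk_off j u w k := exists q, [/\ path e (f u) q, last (f u) q = f w, uniq (f u :: q),
  size q %% 4 = k & forall z, z \in q -> off j z].
Definition reach j y k := exists q, [/\ path e x q, last x q = y, uniq (x :: q), size q %% 4 = k &
  forall z, z \in q -> z \in p \/ off j z].

Lemma off_vert j z : off j z -> z \in verts n f L.
Proof. by case=> [zF|[i [il _] zi]]; [rewrite mem_cat zF|apply: int_vert zi]. Qed.

Lemma x_vert z : z \in verts n f L -> z != x /\ z \notin p.
Proof.
move=> zv; have := st_U st; rewrite cat_uniq => /and3P [_ /hasPn H _].
by split; apply/negP => h; have := H z; rewrite /= zv inE ?h ?(eqP h) ?eqxx ?orbT => /(_ isT).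
Qed.

Lemma xp_uniq : uniq (x :: p).
Proof. by have := st_U st; rewrite cat_uniq => /and3P []. Qed.

Lemma sound_walk_off j u w : u < n -> w < n ->
  sound (residues_off j (nth [::] (buckets n (entries n rest u)) w)) (walk_off j u w).
Proof.
move=> un wn; apply: sound_residues_off => y yb jy.
have [y4 sz [q [Pq Lq Uq Zq Cq]]] := bucketsP st_vU (st_ok st) wn yb un.
split=> //; exists q; split=> // z /Cq [zF|[i iI zi]]; [by left|right; exists i => //].
by rewrite (allP sz) //; split=> //; apply: contraNneq jy => <-.
Qed.

Lemma sound_walk u w : u < n -> w < n ->
  sound (residues (nth [::] (buckets n (entries n rest u)) w)) (walk_off (size L) u w).
Proof.
move=> un wn; apply: sound_residues => y yb.
have [y4 sz [q [Pq Lq Uq Zq Cq]]] := bucketsP st_vU (st_ok st) wn yb un.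
split=> //; exists q; split=> // z /Cq [zF|[i iI zi]]; [by left|right; exists i => //].
by have il := allP sz i iI; rewrite il ltn_eqF.
Qed.

Lemma walk_en j w k : w < n -> walk_off j en w k -> reach j (f w) ((k + 1) %% 4).
Proof.
move=> wn [q [Pq Lq Uq Zq Cq]]; exists (f en :: q); split.
- by rewrite /= e_sym (st_e st).
- exact: Lq.
- have nx z : z \in f en :: q -> z != x.
    rewrite inE => zq; have /x_vert [] // : z \in verts n f L.
    by case/predU1P: zq => [->|/Cq /off_vert //]; apply: f_vert (st_en st).
  by rewrite cons_uniq Uq andbT; apply/negP => /nx; rewrite eqxx.
- by rewrite /= -Zq modnDml addn1.
move=> z; rewrite inE => /predU1P [->|/Cq]; right => //; left; rewrite map_f // mem_iota.
exact: st_en st.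
Qed.

Lemma walk_o j w k : w < n -> walk_off j o w k -> reach j (f w) ((k + lab (ty_of p)) %% 4).
Proof.
move=> wn [q [Pq Lq Uq Zq Cq]]; exists (rcons p (f o) ++ q); split.
- by rewrite cat_path (st_p st) last_rcons.
- by rewrite last_cat last_rcons.
- have nv z : z \in f o :: q -> z \in verts n f L.
    by rewrite inE => /predU1P [->|/Cq /off_vert //]; apply: f_vert (st_o st).
  rewrite cat_rcons -cat_cons; apply: uniq_cat_notin => //; first exact: xp_uniq.
  move=> z zp; apply/negP => /nv /x_vert [zx zp'].
  by move: zp; rewrite inE (negPf zx) (negPf zp').
- by rewrite size_cat size_rcons lab_ty -Zq modnDmr modnDml addnC.
move=> z; rewrite cat_rcons mem_cat inE => /orP [zp|/predU1P [->|/Cq]]; [by left|right|by right].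
by left; rewrite map_f // mem_iota (st_o st).
Qed.

Lemma lab_ty4 (q : seq V) : lab (ty_of q) < 4.
Proof. by rewrite lab_ty ltn_mod. Qed.

(** From [x], one edge leads back to [f en], and [p] leads on to [f o] with length [lab (ty_of p)]
    modulo 4; known walks continue from there. *)
Lemma sound_reach j w m1 m2 : w < n -> sound m1 (walk_off j en w) -> sound m2 (walk_off j o w) ->
  sound (orq (rotq 1 m1) (rotq (lab (ty_of p)) m2)) (reach j (f w)).
Proof.
move=> wn s1 s2; apply: sound_orq.
  by apply: sound_rotq s1 _ => // k _; apply: walk_en.
by apply: sound_rotq s2 _; rewrite ?lab_ty4 // => k _; apply: walk_o.
Qed.

Definition ear c r := path e x (rcons c r) /\ uniq ((verts n f L ++ x :: p) ++ c).

Lemma ear_notin c r z : ear c r -> z \in verts n f L ++ x :: p -> z \notin c.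
Proof.
by move=> [_]; rewrite cat_uniq => /and3P [_ /hasPn H _] zv; apply/negP => /H; rewrite /= zv.
Qed.

Lemma ear_closes c r q : ear c r -> path e x q -> last x q = r -> uniq (x :: q) ->
  (forall z, z \in q -> z \in p \/ z \in verts n f L) -> (size q + (size c).+1) %% 4 != 0.
Proof.
move=> E Pq Lq Uq Cq; rewrite addnS; apply: no_zero_cycle Pq Lq (E.1) _.
rewrite -cat_cons; apply: uniq_cat_notin => //; first by case: E => _; rewrite cat_uniq => /and3P [].
move=> z zq; apply: ear_notin E _; rewrite mem_cat inE; move: zq; rewrite inE.
by case/predU1P => [->|/Cq [->|->]]; rewrite ?eqxx ?orbT.
Qed.

Lemma reach_closes c r j : ear c r -> forall m, sound m (reach j r) -> ty_of c \in allowed m.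
Proof.
move=> E m s; apply: allowedP => k k4 /(s k k4) [q [Pq Lq Uq <- Cq]].
rewrite modnDml; apply: ear_closes E Pq Lq Uq _ => z /Cq [zp|/off_vert]; [by left|by right].
Qed.

(** Go from [x] to an end of the j-th branch without its interior, along the branch to [r], and back
    through the ear. *)
Lemma reach_inner c r j P1 P2 m1 m2 : ear c r -> j < size L -> int j = P1 ++ r :: P2 ->
  sound m1 (reach j (f (nth no_branch L j).1.1.1)) -> sound m2 (reach j (f (nth no_branch L j).1.1.2)) ->
  ty_of c \in allowed (orq (rotq (lab (ty_of P1)) m1) (rotq (lab (ty_of P2)) m2)).
Proof.
move=> E jl EP s1 s2; have := branch_okP (st_ok st) jl; have := int_uniq st_vU jl.
have vj z : z \in int j -> z \in verts n f L by apply: int_vert.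
have key w P m : sound m (reach j (f w)) -> path e (f w) (rcons P r) -> uniq (rcons P r) ->
    {subset rcons P r <= int j} -> sound (rotq (lab (ty_of P)) m) (fun k => (k + (size c).+1) %% 4 != 0).
  move=> s PP UP sP; apply: sound_rotq s _; rewrite ?lab_ty4 // => k k4 [q [Pq Lq Uq <- Cq]].
  have -> : ((size q %% 4 + lab (ty_of P)) %% 4 + (size c).+1) %% 4 = (size (q ++ rcons P r) + (size c).+1) %% 4.
    by rewrite lab_ty modnDm modnDml size_cat size_rcons.
  apply: ear_closes E _ _ _ _.
  - by rewrite cat_path Pq Lq.
  - by rewrite last_cat last_rcons.
  - rewrite -cat_cons; apply: uniq_cat_notin => // z zq; apply/negP => /sP zj.
    have [zx zp] := x_vert (vj z zj); move: zq; rewrite inE (negPf zx) /= => /Cq [zp'|[zF|[i [il ij] zi]]].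
    + by rewrite zp' in zp.
    + by have := int_f st_vU jl zj; rewrite zF.
    + by have ji := int_inj st_vU il jl zi zj; rewrite ji eqxx in ij.
  move=> z; rewrite mem_cat => /orP [/Cq [|/off_vert]|/sP /vj]; by [left|right].
rewrite /branch_ok EP => U /and4P [_ _ _]; rewrite rcons_cat /= -cat_rcons cat_path last_rcons => /andP [Pa Pb].
apply: allowedP; apply: sound_orq.
  apply: key s1 Pa _ _; first by move: U; rewrite -cat_rcons cat_uniq => /and3P [].
  by move=> z; rewrite EP -cat_rcons mem_cat => ->.
rewrite -ty_rev; apply: key s2 _ _ _.
- by apply: path_flip.
- by rewrite -rev_cons rev_uniq; move: U; rewrite cat_uniq => /and3P [].
by move=> z; rewrite -rev_cons mem_rev EP mem_cat => ->; rewrite orbT.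
Qed.

(** The ear closes one cycle with [P1], and others with the detour through [f en], a walk to [f o]
    and [P2] backwards. *)
Lemma ear_tail c r P1 P2 m : ear c r -> p = P1 ++ r :: P2 -> sound m (walk_off (size L) en o) ->
  ty_of c \in allowed (addq (lab (ty_of P1)) (rotq 1 (rotq (lab (ty_of P2)) m))).
Proof.
move=> E Ep s; have Up := xp_uniq; have PP := st_p st; rewrite Ep rcons_cat /= -cat_rcons cat_path last_rcons in PP.
case/andP: PP => Pa Pb.
apply: allowedP; apply: sound_addq; rewrite ?lab_ty4 //.
  apply: (@sound_rotq 1 _ (fun k => (k + 1 + (size c).+1) %% 4 != 0)) => //; last first.
    by move=> k _; rewrite -[in X in _ -> X]modnDml modn_mod modnDml.
  apply: sound_rotq s _; rewrite ?lab_ty4 // => k k4 [q [Pq Lq Uq <- Cq]].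
  have -> : ((size q %% 4 + lab (ty_of P2)) %% 4 + 1 + (size c).+1) %% 4 =
     (size (f en :: q ++ rcons (rev P2) r) + (size c).+1) %% 4.
    rewrite lab_ty modnDm -addnA modnDml /= size_cat size_rcons size_rev.
    by congr (_ %% 4); lia.
  have qv z : z \in f en :: q -> z \in verts n f L.
    by rewrite inE => /predU1P [->|/Cq /off_vert //]; apply: f_vert (st_en st).
  have sub z : z \in rcons (rev P2) r -> z \in p.
    by rewrite Ep mem_cat mem_rcons !inE mem_rev => ->; rewrite orbT.
  apply: ear_closes E _ _ _ _.
  - rewrite /= e_sym (st_e st) /= cat_path Pq Lq /=; exact: path_flip.
  - by rewrite /= last_cat last_rcons.
  - rewrite cons_uniq -cat_cons; apply/andP; split.
      rewrite mem_cat negb_or; apply/andP; split; first by apply/negP => /qv /x_vert []; rewrite eqxx.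
      by apply/negP => /sub xp; move: Up; rewrite /= xp.
    apply: uniq_cat_notin => //.
      by rewrite -rev_cons rev_uniq; move: Up; rewrite Ep cons_uniq cat_uniq => /and4P [].
    by move=> z /qv /x_vert [_ zp]; apply: contra zp; apply: sub.
  move=> z; rewrite -cat_cons mem_cat => /orP [/qv|/sub]; by [right|left].
rewrite lab_ty modnDml; have -> : (size P1).+1 = size (rcons P1 r) by rewrite size_rcons.
apply: ear_closes E Pa _ _ _; first by rewrite last_rcons.
  by move: Up; rewrite Ep -cat_rcons -cat_cons cat_uniq => /and3P [].
by move=> z zP; left; rewrite Ep -cat_rcons mem_cat zP.
Qed.

Lemma tail_closes m d : sound m (walk_off (size L) en o) -> d < 4 ->
  (forall k, k < 4 -> walk_off (size L) en o k -> (k + lab (ty_of p) + d) %% 4 != 0) ->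
  getq (rotq d (rotq (lab (ty_of p)) m)) 0 = false.
Proof.
move=> s d4 H; apply/negP => g0.
have s1 : sound (rotq (lab (ty_of p)) m) (fun k => (k + d) %% 4 != 0).
  by apply: sound_rotq s _; rewrite ?lab_ty4 // => k k4 w; rewrite modnDml; apply: H.
have s2 : sound (rotq d (rotq (lab (ty_of p)) m)) (fun k => k != 0).
  by apply: sound_rotq s1 _.
by have := s2 0 isT g0.
Qed.

Lemma walk_closes k r : walk_off (size L) en o k -> path e (f en) (rcons r (f o)) -> uniq r ->
  (forall z, z \in r -> z \notin verts n f L) -> (k + (size r).+1) %% 4 != 0.
Proof.
move=> [q [Pq Lq Uq <- Cq]] Pr Ur nr; rewrite modnDml addnS; apply: no_zero_cycle Pq Lq Pr _.
rewrite -cat_cons; apply: uniq_cat_notin => // z; rewrite inE => zq; apply/negP => /nr /negP; apply.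
by case/predU1P: zq => [->|/Cq /off_vert //]; apply: f_vert (st_en st).
Qed.

Lemma tail_type1 m : sound m (walk_off (size L) en o) -> getq (rotq 1 (rotq (lab (ty_of p)) m)) 0 = false.
Proof.
move=> s; apply: tail_closes s _ _ => // k k4 w.
have := walk_closes (r := x :: p) w; rewrite /= (st_e st) (st_p st) => /(_ isT xp_uniq) H.
rewrite -modnDml -(modnDmr k) lab_ty modn_mod modnDmr modnDml -addnA addn1; apply: H => z.
by rewrite inE => zxp; apply/negP => /x_vert [zx zp]; move: zxp; rewrite (negPf zx) (negPf zp).
Qed.
End Reach.

(** * Every event is among the options *)

Section Options.
Variables (s : state) (f : nat -> V) (L : seq branch) (en o t : nat) (x : V) (p : seq V).
Hypothesis st : stage (sn s) f L en o x p.
Hypothesis t_ok : strong_at s en o (map fst L) \/ t = ty_of (x :: p).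
Notation n := (sn s).
Notation rest := (map fst L).
Notation off_walks j u w := (residues_off j (nth [::] (buckets n (entries n rest u)) w)).
Notation walks u w := (residues (nth [::] (buckets n (entries n rest u)) w)).

(** In the strong case [p] may be rerouted and unrelated to [t]; its type is then limited only by
    cycles through [x :: p]. *)
Lemma tail_in : ty_of p \in tail_types s t en o rest (walks en o).
Proof.
rewrite /tail_types; case: ifP => [_|ns]; last first.
  by case: t_ok => [|->]; [rewrite ns|apply: restsP].
rewrite mem_filter (tail_type1 st (sound_walk st (st_en st) (st_o st))).
by have := ty_of_lt5 p; case: (ty_of p) => [|[|[|[|[|]]]]].
Qed.

Lemma option_deg2 : t = ty_of (x :: p) -> size (sT s) <= 2 -> en \notin sT s -> ~~ ((p == [::]) && (o \in sT s)) ->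
  [:: 0; ty_of p] \in options_at s t en o rest.
Proof.
move=> -> b enT oT; rewrite /options_at; cbv zeta; rewrite mem_cat; apply/orP; left.
case: ifP => [_|]; last by rewrite b memnE enT.
apply: (map_f (fun q => [:: 0; q])); rewrite mem_filter restsP andbT memnE eqnE ty_of4.
by move: oT; case: (p).
Qed.

Lemma option_ear c w : w < n -> ~~ saturated s w -> (strong_at s en o rest -> w != en /\ w != o) ->
  ear n f L x p c (f w) -> ~~ ((c == [::]) && ((w == en) || (w == o) && (p == [::]))) ->
  [:: 1; ty_of p; w; ty_of c] \in options_at s t en o rest.
Proof.
move=> wn wsat wstr E deg; rewrite /options_at; cbv zeta; rewrite 2!mem_cat; apply/orP; right; apply/orP; left.
apply/flatten_mapP; exists (ty_of p); first exact: tail_in.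
rewrite mem_cat; apply/orP; left; apply/flatten_mapP; exists (w, walks en w, walks o w).
  apply: (map_f (fun w => (w, walks en w, walks o w))); rewrite mem_filter mem_iota wn andbT (negPf wsat).
  by case: ifP => // /wstr [wen wo]; rewrite !eqnE (negPf wen) (negPf wo).
apply: (map_f (fun et => [:: 1; ty_of p; w; et])); rewrite mem_filter !eqnE !ty_of4; apply/andP; split.
  by move: deg; case: (c); case: (p).
apply: (reach_closes E); apply: (sound_reach st wn); apply: (sound_walk st) => //; [exact: st_en st|exact: st_o st].
Qed.

Lemma option_inner c j P1 r P2 : j < size L -> (nth no_branch L j).2 = P1 ++ r :: P2 -> ear n f L x p c r ->
  [:: 2; ty_of p; j; ty_of P1; ty_of P2; ty_of c] \in options_at s t en o rest.
Proof.
move=> jl EP E; rewrite /options_at; cbv zeta; rewrite 2!mem_cat; apply/orP; right; apply/orP; left.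
apply/flatten_mapP; exists (ty_of p); first exact: tail_in.
rewrite 2!mem_cat; apply/orP; right; apply/orP; left.
have ok := branch_okP (st_ok st) jl; have rE : nth (0,0,4) rest j = (nth no_branch L j).1 by rewrite (nth_map no_branch).
set a := (nth no_branch L j).1.1.1; set b := (nth no_branch L j).1.1.2.
have tE : (nth no_branch L j).1.2 = ty_of (P1 ++ r :: P2) by case/and4P: ok => _ _ /eqP -> _; rewrite EP.
have tN : ty_of (P1 ++ r :: P2) != 4 by rewrite ty_of4; case: (P1).
have [an bn] : a < n /\ b < n by case/and4P: ok.
apply/flatten_mapP; exists (j, ty_of (P1 ++ r :: P2), (off_walks j en a, off_walks j o a), (off_walks j en b, off_walks j o b)).
  apply/mapP; exists j; last by rewrite rE -tE /a /b; case: (nth no_branch L j) => [[[? ?] ?] ?].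
  by rewrite mem_filter mem_iota size_map jl rE tE eqnE tN.
apply/flatten_mapP; exists (ty_of P1, ty_of P2); first exact: piecesP.
apply: (map_f (fun et => [:: 2; ty_of p; j; ty_of P1; ty_of P2; et])).
apply: (reach_inner st E jl EP); apply: (sound_reach st) => //; apply: (sound_walk_off st) => //; first [exact: st_en st|exact: st_o st].
Qed.

Lemma option_tail c P1 r P2 : strong_at s en o rest = false -> p = P1 ++ r :: P2 -> ear n f L x p c r ->
  ~~ ((c == [::]) && (P1 == [::])) ->
  [:: 3; ty_of p; ty_of P1; ty_of P2; ty_of c] \in options_at s t en o rest.
Proof.
move=> ns Ep E deg; rewrite /options_at; cbv zeta; rewrite 2!mem_cat; apply/orP; right; apply/orP; left.
apply/flatten_mapP; exists (ty_of p); first exact: tail_in.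
rewrite 2!mem_cat; apply/orP; right; apply/orP; right; rewrite ns.
apply/flatten_mapP; exists (ty_of P1, ty_of P2); first by rewrite Ep piecesP.
apply: (map_f (fun et => [:: 3; ty_of p; ty_of P1; ty_of P2; et])); rewrite mem_filter !eqnE !ty_of4; apply/andP; split.
  by move: deg; case: (c); case: (P1).
exact: (ear_tail st E Ep (sound_walk st (st_en st) (st_o st))).
Qed.
End Options.

Lemma option_triangle s f L en o t x v u p : strong_at s en o (map fst L) -> size (sT s) <= 2 ->
  stage (sn s) f L en o x (v :: p) -> e x u -> e u v -> u \notin verts (sn s) f L -> u \notin x :: v :: p ->
  [:: 4; ty_of p] \in options_at s t en o (map fst L).
Proof.
move=> str b st exu euv uL up; rewrite /options_at; cbv zeta; rewrite 2!mem_cat; apply/orP; right; apply/orP; right.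
case: ifP => [_|]; last by rewrite str b.
apply: (map_f (fun q => [:: 4; q])); rewrite mem_filter; apply/andP; split; last first.
  by have := ty_of_lt5 p; case: (ty_of p) => [|[|[|[|[|]]]]].
have s0 := sound_walk st (st_en st) (st_o st).
(* The triangle offers two routes from [f en] to [f o]: [d] is 2 for the one through [v] alone and 3
   for the one through [u] and [v]. *)
have key d r : d < 4 -> path e (f en) (rcons r (f o)) -> uniq r -> (forall z, z \in r -> z \notin verts (sn s) f L) ->
    size r = size p + d -> getq (rotq d (rotq (lab (ty_of p)) (residues (nth [::] (buckets (sn s) (entries (sn s) (map fst L) en)) o)))) 0 = false.
  move=> d4 Pr Ur nr sr; apply: (tail_closes s0) => // k k4 w.
  have := walk_closes st w Pr Ur nr; rewrite sr lab_ty.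
  have -> // : (k + (size p).+1 %% 4 + d) %% 4 = (k + (size p + d).+1) %% 4.
  by rewrite -modnDml modnDmr modnDml -addnA addSn.
have nx z : z \in x :: v :: p -> z \notin verts (sn s) f L.
  rewrite inE => zx; apply/negP => /(x_vert st) [h1 h2]; move: zx; by rewrite (negPf h1) (negPf h2).
have U := xp_uniq st; have := st_p st; have ex := st_e st.
rewrite /= => /andP [exv Pv].
rewrite (key 2 [:: x, v & p]) ?(key 3 [:: x, u, v & p]) //=; rewrite ?ex ?exv ?exu ?euv ?Pv ?addn2 ?addn3 //.
- by move: up U; rewrite /= !inE !negb_or [u == x]eq_sym => /and3P [-> -> ->] /and3P [/andP [-> ->] -> ->].
- by move=> z; rewrite !inE => /or3P [/eqP ->|/eqP -> //|zp]; apply: nx; rewrite !inE ?eqxx ?zp ?orbT.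
Qed.

(** * The child state of an event is realized *)

Section Children.
Variables (s : state) (f : nat -> V) (L0 L : seq branch) (en o : nat) (x : V).
Hypothesis R : realizes s f L0.
Notation n := (sn s).
Notation rest := (map fst L).

Lemma extend_T y : y \in deg2s W -> all (fun t => (t < n.+1) && (upd f n y t \in deg2s W)) (n :: sT s).
Proof. by move=> yD; rewrite /= upd_eq yD ltnSn; exact: (all_upd _ (P := mem (deg2s W)) (real_T R)). Qed.

Lemma new_T m : n <= m -> uniq (m :: sT s).
Proof.
move=> nm; rewrite cons_uniq (real_TU R) andbT; apply/negP => /(allP (real_T R)) /andP [mn _].
by move: mn; rewrite ltnNge nm.
Qed.

Lemma child_deg2 p : stage n f L en o x p -> x \in deg2s W ->
  realizes (child s en o rest [:: 0; ty_of p]) (upd f n x) [:: ((en, n, 4), [::]), ((n, o, ty_of p), p) & L].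
Proof.
move=> st xD; apply: (realizes_mark _ _ (st_U st) (st_W st) _ (extend_T xD) (new_T (leqnn n)) _) => //.
- by apply/permP => a; rewrite /verts map_upd /= !count_cat /=; arith.
- apply/and3P; split; last exact: branch_ok_upd (st_ok st).
    by rewrite /branch_ok /= upd_eq upd_lt ?(st_en st) // (st_e st) ltnSn ltnW // ltnS (st_en st).
  by rewrite /branch_ok /= upd_eq upd_lt ?(st_o st) // (st_p st) ltnSn eqxx ltnW // ltnS (st_o st).
exact: (all_upd _ (P := fun y => dg W y == 3) (real_C R)).
Qed.

Lemma child_ear p c w : stage n f L en o x p -> ear n f L x p c (f w) -> all (mem W) c -> w < n ->
  realizes (child s en o rest [:: 1; ty_of p; w; ty_of c]) (upd f n x)
    [:: ((n, w, ty_of c), c), ((en, n, 4), [::]), ((n, o, ty_of p), p) & L].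
Proof.
move=> st [Pc U] cW wn; apply: (realizes_mark (K := (verts n f L ++ x :: p) ++ c) _ _ U _ _ _ (real_TU R) _) => //.
- by apply/permP => a; rewrite /verts map_upd /= !count_cat /=; arith.
- by rewrite all_cat (st_W st).
- apply/and4P; split; last exact: branch_ok_upd (st_ok st).
  + by rewrite /branch_ok /= upd_eq upd_lt // Pc ltnSn eqxx ltnW // ltnS.
  + by rewrite /branch_ok /= upd_eq upd_lt ?(st_en st) // (st_e st) ltnSn ltnW // ltnS (st_en st).
  by rewrite /branch_ok /= upd_eq upd_lt ?(st_o st) // (st_p st) ltnSn eqxx ltnW // ltnS (st_o st).
- exact: (all_upd _ (P := mem (deg2s W)) (real_T R)).
exact: (all_upd _ (P := fun y => dg W y == 3) (real_C R)).
Qed.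

Lemma map_upd2 r : map (upd (upd f n x) n.+1 r) (iota 0 n.+2) = map f (iota 0 n) ++ [:: x; r].
Proof. by rewrite !map_upd -catA. Qed.

Lemma upd2_lt r k : k < n -> upd (upd f n x) n.+1 r k = f k.
Proof. by move=> kn; rewrite upd_lt ?upd_lt // ltnS ltnW. Qed.

Lemma upd2_eq r : upd (upd f n x) n.+1 r n = x.
Proof. by rewrite upd_lt ?upd_eq. Qed.

Lemma child_inner p c j P1 r P2 : stage n f L en o x p -> ear n f L x p c r -> all (mem W) c -> j < size L ->
  (nth no_branch L j).2 = P1 ++ r :: P2 ->
  realizes (child s en o rest [:: 2; ty_of p; j; ty_of P1; ty_of P2; ty_of c]) (upd (upd f n x) n.+1 r)
    [:: ((n, n.+1, ty_of c), c), ((en, n, 4), [::]), ((n, o, ty_of p), p),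
        (((nth no_branch L j).1.1.1, n.+1, ty_of P1), P1), ((n.+1, (nth no_branch L j).1.1.2, ty_of P2), P2) & remove_nth j L].
Proof.
move=> st [Pc U] cW jl EP; have := allP (st_ok st) _ (mem_nth no_branch jl).
have pL := remove_nth_perm no_branch jl; have rE := nth_map no_branch (0,0,4) fst jl.
rewrite /child rE; case: (nth no_branch L j) pL EP => [[[a b] t] q] /= pL EP.
rewrite {q}EP in pL *; rewrite /branch_ok /= => /and4P [an bn _ Pq].
have [PP1 PP2] : path e (f a) (rcons P1 r) /\ path e r (rcons P2 (f b)).
  by move: Pq; rewrite rcons_cat /= -cat_rcons cat_path last_rcons => /andP.
have okr : all (branch_ok n f) (remove_nth j L).
  by move: (st_ok st); rewrite (perm_all _ pL) => /andP [].
have lt2 k : k < n -> k < n.+2 by move=> kn; rewrite !ltnS ltnW // ltnW.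
have pV := perm_flatten (perm_map snd pL).
apply: (realizes_mark (K := (verts n f L ++ x :: p) ++ c) _ _ U _ _ _ (real_TU R) _) => //.
- by rewrite /= map_remove_nth.
- apply/permP => h; rewrite /verts map_upd2 /=; have /permP/(_ h) := pV.
  rewrite /= !count_cat /= => ->.
  move: (count h c) (count h p) (count h P1) (count h P2) (count h (flatten _)) (count h (map f _)); clear; lia.
- by rewrite all_cat (st_W st).
- rewrite /= /branch_ok /= !eqxx !upd2_eq !upd_eq !(upd2_lt _ an) !(upd2_lt _ bn) !(upd2_lt _ (st_en st)) !(upd2_lt _ (st_o st)).
  rewrite (lt2 _ an) (lt2 _ bn) (lt2 _ (st_en st)) (lt2 _ (st_o st)) !ltnS leqnn leqnSn Pc (st_e st) (st_p st) PP1 PP2 /=.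
  exact: branch_ok_upd (branch_ok_upd _ okr).
- exact: (all_upd _ (P := mem (deg2s W)) (all_upd _ (P := mem (deg2s W)) (real_T R))).
exact: (all_upd _ (P := fun y => dg W y == 3) (all_upd _ (P := fun y => dg W y == 3) (real_C R))).
Qed.

Lemma child_tail c P1 r P2 : stage n f L en o x (P1 ++ r :: P2) -> ear n f L x (P1 ++ r :: P2) c r -> all (mem W) c ->
  realizes (child s en o rest [:: 3; ty_of (P1 ++ r :: P2); ty_of P1; ty_of P2; ty_of c]) (upd (upd f n x) n.+1 r)
    [:: ((n, n.+1, ty_of c), c), ((en, n, 4), [::]), ((n, n.+1, ty_of P1), P1), ((n.+1, o, ty_of P2), P2) & L].
Proof.
move=> st [Pc U] cW; have lt2 k : k < n -> k < n.+2 by move=> kn; rewrite !ltnS ltnW // ltnW.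
have [PP1 PP2] : path e x (rcons P1 r) /\ path e r (rcons P2 (f o)).
  by move: (st_p st); rewrite rcons_cat /= -cat_rcons cat_path last_rcons => /andP.
apply: (realizes_mark (K := (verts n f L ++ x :: P1 ++ r :: P2) ++ c) _ _ U _ _ _ (real_TU R) _) => //.
- apply/permP => h; rewrite /verts map_upd2 /= !count_cat /= !count_cat /=.
  move: (count h c) (count h P1) (count h P2) (count h (flatten _)) (count h (map f _)); clear; lia.
- by rewrite all_cat (st_W st).
- rewrite /= /branch_ok /= !eqxx !upd2_eq !upd_eq !(upd2_lt _ (st_en st)) !(upd2_lt _ (st_o st)).
  rewrite (lt2 _ (st_en st)) (lt2 _ (st_o st)) !ltnS leqnn leqnSn Pc (st_e st) PP1 PP2 /=.
  exact: branch_ok_upd (branch_ok_upd _ (st_ok st)).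
- exact: (all_upd _ (P := mem (deg2s W)) (all_upd _ (P := mem (deg2s W)) (real_T R))).
exact: (all_upd _ (P := fun y => dg W y == 3) (all_upd _ (P := fun y => dg W y == 3) (real_C R))).
Qed.

Lemma child_triangle v u p : stage n f L en o x (v :: p) -> e x u -> e u v -> u \notin verts n f L -> u \notin x :: v :: p ->
  u \in deg2s W -> dg W x = 3 -> dg W v = 3 ->
  realizes (child s en o rest [:: 4; ty_of p]) (upd (upd (upd f n x) n.+1 v) n.+2 u)
    [:: ((en, n, 4), [::]), ((n, n.+1, 4), [::]), ((n, n.+2, 4), [::]), ((n.+2, n.+1, 4), [::]), ((n.+1, o, ty_of p), p) & L].
Proof.
move=> st exu euv uV up uD dx dv; have := st_p st; rewrite /= => /andP [exv Pv].
have lt3 k : k < n -> k < n.+3 by move=> kn; rewrite !ltnS ltnW // ltnW // ltnW.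
have uf k : k < n -> upd (upd (upd f n x) n.+1 v) n.+2 u k = f k.
  by move=> kn; rewrite upd_lt ?upd2_lt // ltnS ltnW // ltnS ltnW.
have un : upd (upd (upd f n x) n.+1 v) n.+2 u n = x by rewrite upd_lt ?upd2_eq.
have un1 : upd (upd (upd f n x) n.+1 v) n.+2 u n.+1 = v by rewrite upd_lt ?upd_eq.
apply: (realizes_mark (K := u :: (verts n f L ++ x :: v :: p)) _ _ _ _ _ _ _ _) => //.
- apply/permP => h; rewrite /verts map_upd map_upd2 /= !count_cat /=.
  move: (count h p) (count h (flatten _)) (count h (map f _)); clear; lia.
- by rewrite cons_uniq (st_U st) mem_cat negb_or uV up.
- by rewrite /= (st_W st) (deg2s_sub uD).
- rewrite /= /branch_ok /= !eqxx !upd_eq !un !un1 !(uf _ (st_en st)) !(uf _ (st_o st)).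
  rewrite (lt3 _ (st_en st)) (lt3 _ (st_o st)) !ltnS !leqnn !leqnSn !leqW // (st_e st) exv exu euv Pv /=.
  exact: branch_ok_upd (branch_ok_upd _ (branch_ok_upd _ (st_ok st))).
- rewrite /= upd_eq uD ltnSn /=.
  by do 3!apply: (all_upd _ (P := mem (deg2s W))); exact: (real_T R).
- by apply: new_T; rewrite ltnW // ltnW.
rewrite /= un un1 dx dv !eqxx !ltnS leqnSn ltnW // /=.
by do 3!apply: (all_upd _ (P := fun y => dg W y == 3)); exact: (real_C R).
Qed.
End Children.

(** * Expanding a path at its first interior vertex *)

Section Expand.
Variables (s : state) (f : nat -> V) (L : seq branch) (i en o t : nat) (x : V) (p : seq V).
Hypotheses (R : realizes s f L) (wf : well_formed s) (il : i < size L).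
Hypothesis br : nth no_branch L i = ((en, o, t), x :: p) \/ nth no_branch L i = ((o, en, t), rev (x :: p)).
Notation n := (sn s).
Notation Lr := (remove_nth i L).

(** The second form of [br] reads the branch from its far end, so that either end can be
    expanded. *)
Lemma expand_stage : stage n f Lr en o x p /\ t = ty_of (x :: p).
Proof.
have pL := remove_nth_perm no_branch il.
have pV : perm_eq (verts n f L) (verts n f Lr ++ x :: p).
  have := perm_flatten (perm_map snd pL); rewrite /= => pF; rewrite perm_sym perm_catC /verts perm_catCA perm_cat2l perm_sym.
  by apply: perm_trans pF _; rewrite perm_cat2r; case: br => ->; rewrite ?perm_rev.
have /and4P [an bn /eqP tE P] := allP (real_ok R) _ (mem_nth no_branch il).
have okr : all (branch_ok n f) Lr by move: (real_ok R); rewrite (perm_all _ pL) => /andP [].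
have [enn on tt Pen] : [/\ en < n, o < n, t = ty_of (x :: p) & path e (f en) (rcons (x :: p) (f o))].
  case: br an bn tE P => -> /= an bn -> P; first by split.
  by split=> //; [exact: ty_rev|have := path_flip P; rewrite revK].
split=> //; move: Pen => /= /andP [ex Px]; split=> //.
  by rewrite -(perm_uniq pV) (real_U R).
by rewrite -(perm_all _ pV) (real_W R).
Qed.

Lemma expand_neq : en != o.
Proof.
have /and3P [/allP H _ _] := wf; have := H (nth no_branch L i).1; rewrite -(real_E R) => /(_ (map_f _ (mem_nth _ il))).
by case: br => -> /= /and3P [_ _]; rewrite eqnE // eq_sym.
Qed.

Lemma end_of_expanded w y : y \in end_at f w (nth no_branch L i) -> (w = en /\ y = x) \/ (w = o /\ y = last x p).
Proof.
case: br => -> /=; rewrite /end_at /=.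
  case: eqP => [->|_]; first by rewrite inE => /eqP ->; left.
  by case: eqP => [->|//]; rewrite inE => /eqP ->; right.
case: eqP => [->|_].
  rewrite inE rev_cons headI /= => /eqP ->; right; split=> //.
  by case: (lastP p) => // q z; rewrite rev_rcons last_rcons.
by case: eqP => [->|//]; rewrite inE rev_cons last_rcons => /eqP ->; left.
Qed.

Lemma end_rest w y : y \in ends_at f w L -> y \in verts n f Lr \/ (w = en /\ y = x) \/ (w = o /\ y = last x p).
Proof.
have [st _] := expand_stage.
move=> /flatten_mapP [b]; rewrite (perm_mem (remove_nth_perm no_branch il)) inE => /predU1P [->|bL] yb.
  by right; apply: end_of_expanded.
left; have [] // := ends_at_ok (w := w) (z := y) (st_ok st); by apply/flatten_mapP; exists b.
Qed.

Lemma ear_last p' c w : ear n f Lr x p' c (f w) -> all (mem W) c -> x \in W ->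
  [/\ last x c \in W, e (f w) (last x c) & last x c \notin verts n f Lr].
Proof.
have [st _] := expand_stage; move=> E cW xW; have := E.1; rewrite rcons_path => /andP [_ el].
split; rewrite 1?e_sym //; first by case: (lastP c) cW => // c' z; rewrite all_rcons last_rcons => /andP [].
case: (lastP c) E => [|c' z] E; first by apply/negP => /(x_vert st) []; rewrite eqxx.
rewrite last_rcons; apply/negP => zv; have [_] := E; rewrite cat_uniq => /and3P [_ /hasPn H _].
by have := H z; rewrite mem_rcons mem_head mem_cat zv => /(_ isT).
Qed.

(** At a saturated vertex, the ear would arrive from a neighbour listed in [L]. Away from [en] and
    [o] such a neighbour lies in the remaining subdivision, which the ear avoids, even if the tail
    [p'] is a new one. *)
Lemma unsaturated_other p' c w : ear n f Lr x p' c (f w) -> all (mem W) c -> w < n -> w != en -> w != o -> ~~ saturated s w.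
Proof.
have [st _] := expand_stage; move=> E cW wn wen wo; apply/negP => sat.
have xW : x \in W by have := st_W st; rewrite all_cat => /andP [_ /andP []].
have [lW el lv] := ear_last E cW xW.
case: (end_rest (saturated_end R wf wn sat lW el)) => [|[[E1 _]|[E1 _]]]; first by rewrite (negPf lv).
- by rewrite E1 eqxx in wen.
- by rewrite E1 eqxx in wo.
Qed.

(** [w] may be an end of the expanded path here: the ear is disjoint from the original tail, so it
    could arrive by a listed edge only if it were an edge of that path. *)
Lemma unsaturated_end c w : ear n f Lr x p c (f w) -> all (mem W) c -> w < n ->
  ~~ ((c == [::]) && ((w == en) || (w == o) && (p == [::]))) -> ~~ saturated s w.
Proof.
have [st _] := expand_stage; move=> E cW wn deg; apply/negP => sat.
have xW : x \in W by have := st_W st; rewrite all_cat => /andP [_ /andP []].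
have [lW el lv] := ear_last E cW xW.
have cx z : z \in c -> z \notin x :: p.
  move=> zc; apply/negP => zp; have [_] := E; rewrite cat_uniq => /and3P [_ /hasPn H _].
  by have := H z zc; rewrite /= mem_cat zp orbT.
have lc : c != [::] -> last x c \in c by case: (c) => // a l _; rewrite [last _ _]/= mem_last.
case: (end_rest (saturated_end R wf wn sat lW el)) => [|[[E1 E2]|[E1 E2]]]; first by rewrite (negPf lv).
- move: deg; rewrite E1 eqxx andbT => /lc /cx; by rewrite E2 mem_head.
have [c0|/lc /cx] := altP (c =P [::]); last by rewrite E2 mem_last.
move: deg E2; rewrite c0 E1 eqxx /= negb_or => /andP [_ p0] E2.
have := xp_uniq st; case: (p) p0 E2 => // a l _ /= E2; by rewrite E2 mem_last.
Qed.

Definition expands := exists op f' L', [/\ op \in options_at s t en o (map fst Lr) &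
  realizes (child s en o (map fst Lr) op) f' L'].

Lemma expand_deg2 : x \in deg2s W -> expands.
Proof.
have [st tE] := expand_stage; move=> xD; have := child_deg2 R st xD.
exists [:: 0; ty_of p], (upd f n x), [:: ((en, n, 4), [::]), ((n, o, ty_of p), p) & Lr]; split=> //.
apply: (option_deg2 _ tE).
- apply: (deg2_room R xD); apply/negP => /mapP [k kT xE].
  have kn : k < n by have /andP [] := allP (real_T R) k kT.
  by have [] := x_vert st (f_vert f Lr kn); rewrite -xE eqxx.
- apply/negP => enT; have /andP [_ aD] := allP (real_T R) en enT.
  by have := adjacent_deg2 aD xD; rewrite (st_e st).
apply/negP => /andP [/eqP p0 oT]; have /andP [_ oD] := allP (real_T R) o oT.
by have := adjacent_deg2 xD oD; have := st_p st; rewrite p0 /= andbT => ->.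
Qed.

(** Serves both the ear beside the original tail and the one that comes with a rerouted tail
    [p']. *)
Lemma expand_ear p' c r : stage n f Lr en o x p' -> strong_at s en o (map fst Lr) \/ p' = p ->
  ear n f Lr x p' c r -> all (mem W) c -> r \in verts n f Lr ->
  (strong_at s en o (map fst Lr) -> r != f en /\ r != f o) ->
  (p' = p -> ~~ ((c == [::]) && ((r == f en) || (r == f o) && (p == [::])))) -> expands.
Proof.
move=> st tp E cW; have [_ tE] := expand_stage.
have t_ok : strong_at s en o (map fst Lr) \/ t = ty_of (x :: p') by case: tp => [|->]; [left|right].
rewrite /verts mem_cat => /orP [/mapP [w]|/flatten_mapP [b bL rb] _ _].
  rewrite mem_iota /= => wn rE rs deg; rewrite {r}rE in E rs deg.
  have deg' : ~~ ((c == [::]) && ((w == en) || (w == o) && (p' == [::]))).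
    case: tp => [str|pE].
      have [h1 h2] := rs str; case: (w =P en) h1 => [->|_]; first by rewrite eqxx.
      by case: (w =P o) h2 => [->|_]; rewrite ?eqxx ?andbF.
    by move: (deg pE); rewrite pE; apply: contra => /andP [-> /orP [/eqP ->|/andP [/eqP -> ->]]]; rewrite eqxx ?orbT.
  exists [:: 1; ty_of p'; w; ty_of c]; do 2!eexists; split; last exact: (child_ear R st E cW wn).
  apply: (option_ear st t_ok wn _ _ E deg'); last first.
    by move=> /rs [h1 h2]; split; [apply: contraNneq h1 => ->|apply: contraNneq h2 => ->].
  case: tp => [/rs [h1 h2]|pE]; last by rewrite pE in E deg'; apply: unsaturated_end E cW wn deg'.
  by apply: unsaturated_other E cW wn _ _; [apply: contraNneq h1 => ->|apply: contraNneq h2 => ->].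
have [j jl bE] : exists2 j, j < size Lr & b = nth no_branch Lr j.
  by exists (index b Lr); rewrite ?index_mem ?nth_index.
rewrite {}bE {b bL} in rb; move: rb (erefl (nth no_branch Lr j).2) => /path.splitPr.
case EP: _ / => [P1 P2] _.
exists [:: 2; ty_of p'; j; ty_of P1; ty_of P2; ty_of c]; do 2!eexists; split; last exact: (child_inner R st E cW jl EP).
exact: (option_inner st t_ok jl EP E).
Qed.

Lemma verts_size k f' (K : seq branch) : all (branch_ok k f') K ->
  k + sumn [seq least_interior y.2 | y <- map fst K] <= size (verts k f' K).
Proof.
move=> ok; rewrite size_cat size_map size_iota leq_add2l.
elim: K ok => //= b K IHK /andP [/and4P [_ _ /eqP -> _] /IHK H]; rewrite size_cat leq_add //.
exact: least_interiorP.
Qed.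

(** [M] is the subdivision without the expanded path and [K] the component of [x] outside it.
    [strong_exposure] then yields a new tail with an ear, or the triangle. *)
Lemma expand_strong : x \notin deg2s W -> strong_at s en o (map fst Lr) -> expands.
Proof.
move=> xD str; have [st _] := expand_stage.
have UV := st_vU st; have WV : all (mem W) (verts n f Lr) by have := st_W st; rewrite all_cat => /andP [].
have xW : x \in W by have := st_W st; rewrite all_cat => /andP [_ /andP []].
pose M := [set z in verts n f Lr]; pose K := component (W :\: M) x.
have MW : M \subset W by apply/subsetP => z; rewrite inE => /(allP WV).
have xM : x \in W :\: M by rewrite !inE xW andbT; apply/negP => /(x_vert st) []; rewrite eqxx.
have xK : x \in K by rewrite inE xM connect0.
have sK : K \subset W :\: M by apply/subsetP => z; rewrite inE => /andP [].
have fM k : k < n -> f k \in M by move=> kn; rewrite inE f_vert.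
have ab : f en != f o.
  by apply: contraNneq expand_neq => /(f_inj UV (st_en st) (st_o st)) ->.
(* Two branches at an end have distinct first vertices there; these lie in [M], hence outside
   [K]. *)
have anch k : k \in [:: en; o] -> k < n -> anchored K (f k).
  move=> kM kn; have /andP [_ /allP /(_ k kM)] := str; rewrite memnE => /orP [kT|d2].
    by left; have /andP [] := allP (real_T R) k kT.
  right; have Ue : uniq (ends_at f k Lr).
    have sub : subseq (map fst Lr) (sE s) by rewrite -(real_E R) map_subseq // remove_nth_sub.
    have /and3P [wf1 wf2 _] := wf; apply: (ends_at_uniq UV (st_ok st)) => //.
      have sub_np (E E' : seq edge) : subseq E E' -> no_parallel E' -> no_parallel E.
        elim: E' E => [|y E' IHE] [|z E] //= ; case: eqP => [->|_] sb; case: ifP => // h /=.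
          move=> /(IHE _ sb) ->; case: ifP => // /hasP [u uE pu].
          by move/negP: h; case; apply/hasP; exists u => //; apply: mem_subseq sb _ uE.
        by move=> /(IHE _ sb).
      exact: sub_np sub wf2.
    apply/allP => b bL; have := allP wf1 b.1 (mem_subseq sub (map_f _ bL)).
    by case: (b) => [[[u v] k'] q] /= /and3P [_ _]; rewrite eqnE.
  apply: leq_trans d2 _; rewrite -(size_ends_at f) -(card_uniqP Ue); apply/subset_leq_card/subsetP => z.
  move=> /(ends_at_ok (st_ok st)) [ez zv]; have zW : z \in W := allP WV z zv; rewrite in_setD nbh_mem ez zW !andbT.
  by apply/negP => /(subsetP sK); rewrite !inE zv.
have pK q z : path e x q -> all (mem (W :\: M)) q -> z \in x :: q -> z \in K.
  move=> Pq Aq; rewrite inE => /predU1P [-> //|zq].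
  have : forall y, y \in K -> path e y q -> z \in K.
    elim: q zq Aq {Pq} => // a q IHq; rewrite inE => zq /= /andP [aA Aq] y yK /andP [eya Pq].
    have aK : a \in K by apply: component_closed yK aA eya.
    by case/predU1P: zq => [->//|zq]; apply: IHq zq Aq _ aK Pq.
  by move/(_ x xK Pq).
have pA : all (mem (W :\: M)) p.
  apply/allP => z zp; have zW : z \in W.
    by have := st_W st; rewrite all_cat => /andP [_ /andP [_ /allP H]]; apply: H.
  by rewrite !inE zW andbT; apply/negP => /(x_vert st) []; rewrite zp.
have [Px el] : path e x p /\ e (last x p) (f o) by apply/andP; rewrite -rcons_path (st_p st).
(* [strong_at] estimates the interiors from their types, so its count is a lower bound for the size
   of [M]. *)
have M5 : 4 < #|M|.
  by rewrite cardsE (card_uniqP UV); have /andP [h _] := str; apply: leq_trans h (verts_size (st_ok st)).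
have KM z : z \in K -> z \in W /\ z \notin verts n f Lr.
  by move=> /(subsetP sK); rewrite !inE => /andP [].
have clo u v : u \in K -> v \in W -> e u v -> v \in M :|: K.
  move=> uK vW euv; rewrite in_setU; case: (boolP (v \in M)) => //= vM.
  by apply: component_closed uK _ euv; rewrite in_setD vM.
have b0 : exists2 b0, b0 \in K & e b0 (f o) by exists (last x p) => //; apply: pK Px pA (mem_last _ _).
have stp p' : path e x (rcons p' (f o)) -> all (mem K) p' -> uniq (x :: p') -> stage n f Lr en o x p'.
  move=> P1 A1 U1; split=> //; [exact: st_en st|exact: st_o st| | |exact: st_ok st|exact: st_e st].
    apply: uniq_cat_notin => // z zv; rewrite inE negb_or; have [zx zp] := x_vert st zv; rewrite zx.
    by apply/negP => /(allP A1) /KM []; rewrite zv.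
  rewrite all_cat WV /= xW; apply/allP => z /(allP A1) /KM [].
  by [].
have := strong_exposure MW (fM _ (st_en st)) (fM _ (st_o st)) ab M5 sK clo
  (fun u v => @component_connected _ x u v xM) xK (st_e st) b0 xD (anch _ (mem_head _ _) (st_en st)) (anch o _ (st_o st)).
case=> [|[p1 [p2 [r [P1 P2 [rM ra rb] A U]]]]|[v [u [p1 [[exv exu euv] [uD dx dv] P1 A U]]]]].
- by rewrite !inE eqxx orbT.
- have [A1 A2] : all (mem K) p1 /\ all (mem K) p2 by apply/andP; rewrite -all_cat.
  have st1 : stage n f Lr en o x p1.
    by apply: stp => //; move: U; rewrite -cat_cons cat_uniq => /and3P [].
  apply: (expand_ear (p' := p1) (c := p2) (r := r) st1) => //.
  + by left.
  + split=> //; rewrite -catA; apply: uniq_cat_notin => // z zv.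
    have [zx _] := x_vert st1 zv; rewrite /= inE negb_or zx mem_cat.
    by apply/negP => /orP [/(allP A1)|/(allP A2)] /KM []; rewrite zv.
  + by apply/allP => z /(allP A2) /KM [].
  + by move: rM; rewrite inE.
  by move=> _; rewrite (negPf ra) (negPf rb) andbF.
have /and3P [vK uK A1] := A.
have st1 : stage n f Lr en o x (v :: p1).
  apply: stp; [by rewrite /= exv|by apply/andP|].
  by move: U; rewrite /= !inE !negb_or => /and4P [/and3P [-> _ ->] /andP [_ ->] _ ->].
have uv : u \notin verts n f Lr by have [] := KM u uK.
have up : u \notin x :: v :: p1.
  by move: U; rewrite /= !inE !negb_or [u == x]eq_sym [u == v]eq_sym => /and4P [/and3P [_ -> _] /andP [-> _] -> _].
have evu : e v u by rewrite e_sym euv.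
have ru : size (sT s) <= 2.
  apply: (deg2_room R uD); apply/negP => /mapP [k kT uE].
  have kn : k < n by have /andP [] := allP (real_T R) k kT.
  by move: uv; rewrite uE f_vert.
exists [:: 4; ty_of p1]; do 2!eexists; split; last exact: (child_triangle R st1 exu euv uv up uD dx dv).
exact: (option_triangle t str ru st1 exu euv uv up).
Qed.

Lemma expand_weak : x \notin deg2s W -> strong_at s en o (map fst Lr) = false -> expands.
Proof.
move=> xD ns; have [st tE] := expand_stage.
pose M := [set z in verts n f Lr ++ x :: p].
have MW : M \subset W by apply/subsetP => z; rewrite inE => /(allP (st_W st)).
have xM : x \in M by rewrite inE mem_cat mem_head orbT.
have nM : f en \in M by rewrite inE mem_cat f_vert // (st_en st).
have nx : f en != x by have [] := x_vert st (f_vert f Lr (st_en st)).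
(* The excluded neighbours are those of [x] on its path; the second one is [f o] when [p] is
   empty. *)
have [c [r [[Pc rM rx cA Uc] deg]]] := weak_ear (f en) (head (f o) p) MW xM nM nx xD.
have cM z : z \in c -> z \in W /\ z \notin verts n f Lr ++ x :: p.
  by move=> /(allP cA); rewrite !inE => /andP [].
have E : ear n f Lr x p c r.
  split=> //; apply: uniq_cat_notin => //; first exact: st_U st.
  by move=> z zv; apply/negP => /cM []; rewrite zv.
have cW : all (mem W) c by apply/allP => z /cM [].
move: rM; rewrite inE mem_cat inE (negPf rx) => /orP [rv|rp].
  apply: expand_ear st _ E cW rv _ _; rewrite ?ns //; first by right.
  move=> _; apply/negP => /andP [c0]; have [h1 h2] := deg c0; rewrite (negPf h1) => /andP [/eqP rE /eqP p0].
  by move: h2; rewrite rE p0 /= eqxx.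
move: (erefl p) => pE; have [P1 [P2 pE']] : exists P1 P2, p = P1 ++ r :: P2.
  by case/path.splitPr: rp => P1 P2; exists P1, P2.
have st' := st; have E' := E; rewrite pE' in st' E'.
exists [:: 3; ty_of p; ty_of P1; ty_of P2; ty_of c]; do 2!eexists; split.
  apply: (option_tail st (or_intror tE) ns pE' E); apply/negP => /andP [c0 /eqP P0]; have [_ h2] := deg c0.
  by move: h2; rewrite pE' P0 /= eqxx.
rewrite pE'; exact: (child_tail R st' E' cW).
Qed.

Lemma expand : expands.
Proof.
have [xD|xD] := boolP (x \in deg2s W); first exact: expand_deg2.
by case str: (strong_at s en o (map fst Lr)); [apply: expand_strong|apply: expand_weak].
Qed.
End Expand.

Lemma step_realized s f L i side : realizes s f L -> well_formed s -> i < size (sE s) -> (nth (0,0,4) (sE s) i).2 != 4 ->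
  exists op f' L', op \in options s i side /\ realizes (next s i side op) f' L'.
Proof.
move=> R wf; rewrite -(real_E R) size_map => il.
have bE := nth_map no_branch (0,0,4) fst il; rewrite /options /next /sides -(real_E R) bE -map_remove_nth.
have /and4P [_ _ /eqP tE _] := allP (real_ok R) _ (mem_nth no_branch il).
case E: (nth no_branch L i) tE => [[[a b] t] q] /= tE t4.
have : q != [::] by move: t4; rewrite tE ty_of4; case: (q).
case: side.
  case: q tE E => // x p tE E _; have [op [f' [L' [h1 h2]]]] := expand R wf il (or_introl E).
  by exists op, f', L'.
case: (lastP q) tE E => // q' x tE E _; have E' : nth no_branch L i = ((a, b, t), rev (x :: rev q')).
  by rewrite rev_cons revK.
have [op [f' [L' [h1 h2]]]] := expand R wf il (or_intror E').
by exists op, f', L'.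
Qed.

(** No interior vertices are left. Since all vertices are saturated and [W] is connected, [W] has no
    further vertices, and the degree bounds leave no further edges. *)
Lemma final_exc s f L : realizes s f L -> well_formed s -> final s -> is_exc W.
Proof.
move=> R wf /and3P [/allP t4 /allP sat exc].
have [W0 _ _] := Wgood.
have satw w : w < sn s -> saturated s w /\ (if w \in sT s then 2 else 3) <= degE (underlying s) w.
  by move=> wn; have := sat w; rewrite mem_iota memnE => /(_ wn) /andP.
have n0 : 0 < sn s.
  move: exc => /hasP [h hT]; case: eqnP => //= -> _.
  by have : all (fun g : nat * seq (nat * nat) => 0 < g.1) exceptional by []; move/allP; apply.
have nil b : b \in L -> b.2 = [::].
  move=> bL; have := t4 b.1; rewrite -(real_E R) map_f // => /(_ isT).
  have /and4P [_ _ /eqP -> _] := allP (real_ok R) b bL.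
  by rewrite eqnE ty_of4 => /nilP.
have vE : verts (sn s) f L = map f (iota 0 (sn s)).
  rewrite /verts [flatten _](_ : _ = [::]) ?cats0 //.
  by elim: L nil {R} => //= b K IHK nil; rewrite nil ?mem_head // IHK // => c cK; apply: nil; rewrite inE cK orbT.
have WE : W =i map f (iota 0 (sn s)).
  move=> y; apply/idP/idP => [yW|ys]; last by apply: (allP (real_W R)); rewrite vE.
  have f0 : f 0 \in W by apply: realizes_vert R _.
  suff : y \in [set z in map f (iota 0 (sn s))] by rewrite inE.
  apply: (connect_closed (W_connected f0 yW)); first by rewrite inE map_f ?mem_iota.
  move=> u v; rewrite !inE => /mapP [w]; rewrite mem_iota => /andP [_ wn] -> vW ev.
  have [sw _] := satw w wn; have := saturated_end R wf wn sw vW ev.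
  by move=> /(ends_at_ok (real_ok R)) []; rewrite vE.
have M : models e W (underlying s) f.
  apply: models_of_degrees => //=.
  - by have := real_U R; rewrite vE.
  - apply/allP => x /mapP [b bE ->]; move: bE; rewrite -(real_E R) => /mapP [c cL ->].
    have /and4P [-> -> _] := allP (real_ok R) c cL; by rewrite (nil c cL) /= andbT.
  move=> i iN; have [] := satw i iN; rewrite /saturated !memnE; case: ifP => [iT _|_].
    by have /andP [_ /deg2s_dg ->] := allP (real_T R) i iT.
  by case: ifP => // iC _; have /andP [_ /eqP ->] := allP (real_C R) i iC.
move: exc => /hasP [h hT]; case: eqnP => // _ /hasP [k _ rel].
by exists h; eexists; split=> //; apply: models_relabelled M rel.
Qed.

Lemma all2_witness (A C : Type) (B : eqType) (P : A -> C -> bool) (h : B -> C) s1 s2 y :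
  all2 P s1 (map h s2) -> y \in s2 -> exists x, P x (h y).
Proof.
elim: s1 s2 => [|x s1 IHs] [|z s2] //= /andP [Pxz H]; rewrite inE => /predU1P [->|/(IHs _ H) //].
by exists x.
Qed.

(** At each node the graph realizes one of the options, so the proof descends into its subtree until
    a leaf. *)
Lemma verify_exc fuel tr s f L : verify fuel tr s -> realizes s f L -> is_exc W.
Proof.
elim: fuel tr s f L => // fuel IHf tr s f L /=; case: ifP => // wf.
case: tr => [|i side ts] H R; first exact: final_exc R wf H.
move: H; case: ifP => // il; rewrite eqnE; case: ifP => // /negbT t4 H.
have [op [f' [L' [opo R']]]] := step_realized side R wf il t4.
rewrite -[options _ _ _]map_id in H; have [tr vt] := all2_witness H opo; exact: IHf vt R'.
Qed.

(** * The initial theta graph *)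

(** [deg2_cycle] may return the edge between [p] and [q] twice. Then an ear at [p] supplies the
    other path: it cannot end at [t], which has no further neighbour, so it ends at [q], and it is
    not a single edge. *)
Lemma start_paths : exists t p q q1 q2, [/\ t \in deg2s W, p \in W, q \in W, e p t & e t q] /\
  [/\ path e p (rcons q1 q), path e p (rcons q2 q), q1 != [::], uniq (t :: p :: q :: q1 ++ q2) & all (mem W) (q1 ++ q2)].
Proof.
have [t tD] := exists_deg2; have [p [q [pq N [q1 [q2 [Q1 Q2 U]]]]]] := deg2_cycle tD.
have inN z : z \in [set p; q] -> z \in W /\ e t z by rewrite -N nbh_mem => /andP.
have [pW etp] := inN p (set21 _ _); have [qW etq] := inN q (set22 _ _); have ept : e p t by rewrite e_sym.
have pWt : p \in W :\ t by rewrite !inE pW andbT eq_sym edge_neq.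
have qt : q != t by rewrite eq_sym edge_neq.
have pt : p != t by rewrite edge_neq.
move: Q1 Q2; rewrite !path_inside // => /andP [P1 A1] /andP [P2 A2].
have [B1 B2] : all (mem (W :\ t)) q1 /\ all (mem (W :\ t)) q2.
  by move: A1 A2; rewrite !all_rcons => /andP [_ ->] /andP [_ ->].
have C0 : all (mem W) (q1 ++ q2).
  rewrite all_cat; apply/andP; split; apply/allP => z /=.
    by move/(allP B1); rewrite !inE => /andP [].
  by move/(allP B2); rewrite !inE => /andP [].
have T0 : t \notin p :: q :: q1 ++ q2.
  rewrite !inE mem_cat !negb_or ![t == _]eq_sym pt qt /=.
  by apply/andP; split; apply/negP; [move/(allP B1)|move/(allP B2)]; rewrite !inE eqxx.
have U0 : uniq (t :: p :: q :: q1 ++ q2) by rewrite cons_uniq T0 U.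
have [q10|q1n] := altP (q1 =P [::]); last by exists t, p, q, q1, q2; split; split.
have [q20|q2n] := altP (q2 =P [::]); last first.
  exists t, p, q, q2, q1; split; split=> //; last by rewrite all_cat andbC -all_cat.
  by rewrite -(perm_uniq (s1 := [:: t, p, q & q1 ++ q2])) // !perm_cons perm_catC.
have pD : p \notin deg2s W by apply/negP => pD; have := adjacent_deg2 pD tD; rewrite ept.
have tW := deg2s_sub tD.
have M3 : [set p; q; t] \subset W by apply/subsetP => z; rewrite !inE => /orP [/orP []|] /eqP ->.
have pM : p \in [set p; q; t] by rewrite !inE eqxx.
have qM : q \in [set p; q; t] by rewrite !inE eqxx orbT.
have qp : q != p by rewrite eq_sym.
have [c [w [[Pc wM wp cA Uc] deg]]] := weak_ear q t M3 pM qM qp pD.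
have cn : c != [::].
  apply/negP => /deg [wq wt]; move: wM; by rewrite !inE (negPf wp) (negPf wq) (negPf wt).
have cM z : z \in c -> z \in W /\ z \notin [set p; q; t] by move=> /(allP cA) /setDP [].
have wt : w != t.
  apply/eqP => wt; move: Pc; rewrite wt rcons_path => /andP [_ el].
  have lc : last p c \in c by case: (c) cn => // a l _; rewrite [last _ _]/= mem_last.
  have [lW lM] := cM _ lc; have : last p c \in nbh W t by rewrite nbh_mem lW e_sym.
  by rewrite N => h; move: lM; rewrite in_setU h.
have wq : w = q by apply/eqP; move: wM; rewrite !inE (negPf wp) (negPf wt) orbF.
exists t, p, q, c, [::]; split; split=> //.
- by rewrite -wq.
- by move: P2; rewrite q20.
- rewrite cats0; move: U0; rewrite q10 q20 -[uniq _]/(uniq ([:: t; p; q])) => U0.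
  rewrite -[_ :: _]/([:: t; p; q] ++ c); apply: uniq_cat_notin => // z zt.
  apply/negP => /cM [_]; rewrite !inE; by move: zt; rewrite !inE => /or3P [] /eqP ->; rewrite eqxx ?orbT.
by rewrite cats0; apply/allP => z /cM [].
Qed.

Lemma start_realized t p q q1 q2 : t \in deg2s W -> p \in W -> q \in W -> e p t -> e t q ->
  path e p (rcons q1 q) -> path e p (rcons q2 q) -> uniq (t :: p :: q :: q1 ++ q2) -> all (mem W) (q1 ++ q2) ->
  exists f L, realizes (start (ty_of q1) (ty_of q2)) f L.
Proof.
move=> tD pW qW ept etq P1 P2 U A.
exists (nth t [:: p; q; t]), [:: ((0, 1, ty_of q1), q1); ((0, 1, ty_of q2), q2); ((0, 2, 4), [::]); ((2, 1, 4), [::])].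
apply: (realizes_mark (K := [:: t, p, q & q1 ++ q2]) _ _ U) => //.
- by apply/permP => h; rewrite /= !count_cat /= ?count_cat /=; move: (count h q1) (count h q2); clear; lia.
- by rewrite /= A pW qW (deg2s_sub tD).
- by rewrite /= /branch_ok /= !eqxx P1 P2 ept etq.
by rewrite /= tD.
Qed.

(** [starts] lists pairs without regard to order, so both orders of the two paths are tried. Any
    other pair closes a cycle, except two single edges, which [q1n] excludes. *)
Lemma minimal_false : False.
Proof.
have [t [p [q [q1 [q2 [[tD pW qW ept etq] [P1 P2 q1n U A]]]]]]] := start_paths.
have U' : uniq (t :: p :: q :: q2 ++ q1).
  by rewrite -(perm_uniq (s1 := [:: t, p, q & q1 ++ q2])) // !perm_cons perm_catC.
have A' : all (mem W) (q2 ++ q1) by rewrite all_cat andbC -all_cat.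
have [f1 [L1 R1]] := start_realized tD pW qW ept etq P1 P2 U A.
have [f2 [L2 R2]] := start_realized tD pW qW ept etq P2 P1 U' A'.
have H a b : (a, b) \in [:: (0,1); (0,3); (0,4); (1,1); (1,4); (3,3)] -> exists tr, verify 20 tr (start a b).
  by move=> ab; exact: (all2_witness verified ab).
have H1 : (ty_of q1, ty_of q2) \notin [:: (0,1); (0,3); (0,4); (1,1); (1,4); (3,3)].
  by apply/negP => /H [tr v]; apply: not_exc; exact: verify_exc v R1.
have H2 : (ty_of q2, ty_of q1) \notin [:: (0,1); (0,3); (0,4); (1,1); (1,4); (3,3)].
  by apply/negP => /H [tr v]; apply: not_exc; exact: verify_exc v R2.
have via r : path e p (rcons r q) -> uniq (t :: p :: q :: r) -> (lab (ty_of r) + 2) %% 4 != 0.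
  move=> Pr Ur; have Pt : path e p (rcons [:: t] q) by rewrite /= ept etq.
  have Ut : uniq (p :: rcons r q ++ [:: t]) by uniq_by Ur.
  by have := no_zero_cycle Pr (last_rcons _ _ _) Pt Ut; rewrite lab_ty modnDml size_rcons !addnS.
have Z1 : (lab (ty_of q1) + 2) %% 4 != 0 by apply: via P1 _; uniq_by U.
have Z2 : (lab (ty_of q2) + 2) %% 4 != 0 by apply: via P2 _; uniq_by U.
have Z3 : (lab (ty_of q1) + lab (ty_of q2)) %% 4 != 0.
  rewrite !lab_ty modnDm; have := no_zero_cycle P1 (last_rcons _ _ _) P2.
  by rewrite size_rcons addnS; apply; uniq_by U.
have n4 : ty_of q1 != 4 by rewrite ty_of4; case: (q1) q1n.
move: Z1 Z2 Z3 H1 H2 n4; have := ty_of_lt5 q1; have := ty_of_lt5 q2.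
by case: (ty_of q1) => [|[|[|[|[|a]]]]] //; case: (ty_of q2) => [|[|[|[|[|b]]]]].
Qed.

End Minimal.
End Graph.

(** * From induced subgraphs to the whole graph *)

Lemma zero_free_exc (V : finType) (e : rel V) : symmetric e -> irreflexive e ->
  (forall s, is_cycle e s -> ~~ (4 %| size s)) -> forall W, good e W -> is_exc e W.
Proof.
move=> es ei zero_free W; have [m] := ubnP #|W|; elim: m W => // m IHm W; rewrite ltnS => lm gW.
case: (classic (is_exc e W)) => // not_exc; case: (minimal_false es ei zero_free gW _ not_exc) => W' gW' lt.
by apply: IHm gW'; apply: leq_trans lt lm.
Qed.

Lemma iso_models (V : finType) (e : rel V) n E : 0 < #|V| -> iso_to e n E ->
  exists f, models e [set: V] (n, E) f.
Proof.
move=> /card_gt0P [x0 _] [F [[G FK GK] Fe]].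
(* [x0] is the value at numbers that are not below [n]. *)
pose f k := oapp G x0 (insub k); exists f.
have fE (i : 'I_n) : f i = G i by rewrite /f valK.
have fV : map f (iota 0 n) = map G (enum 'I_n).
  by rewrite -val_enum_ord -map_comp; apply: eq_map => i; rewrite /= fE.
split.
- by rewrite /= fV map_inj_uniq ?enum_uniq //; apply: can_inj GK.
- by move=> x; rewrite inE /= fV -[x]FK map_f // mem_enum.
move=> i j /= il jl; rewrite -[i]/(val (Ordinal il)) -[j]/(val (Ordinal jl)) !fE Fe !GK.
by [].
Qed.

Lemma models_iso (V : finType) (e : rel V) n E f : models e [set: V] (n, E) f -> iso_to e n E.
Proof.
move=> M; have [U VE Me] := M; rewrite /= in U VE Me.
have ix x : index x (map f (iota 0 n)) < n.
  by have := index_mem x (map f (iota 0 n)); rewrite -VE inE size_map size_iota.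
have fi x : f (index x (map f (iota 0 n))) = x.
  have xs : x \in map f (iota 0 n) by rewrite -VE inE.
  by rewrite -[RHS](nth_index x xs) (nth_map 0) ?size_iota // nth_iota.
exists (fun x => Ordinal (ix x)); split; last first.
  by move=> x y; rewrite -{1}[x]fi -{1}[y]fi Me.
exists (fun i : 'I_n => f i) => [x|i]; first exact: fi.
apply: val_inj; apply: (models_inj M) => //=.
Qed.

Theorem theorem1p7 (V : finType) (e : rel V) :
  simple_graph e ->
  0 < #|V| ->
  (forall x : V, 2 <= deg e x) ->
  #|[set x : V | deg e x == 2]| <= 3 ->
  ((exists s : seq V, is_cycle e s /\ 4 %| size s) <->
   ~ (is_T1 e \/ is_T2 e \/ is_T3 e \/ is_T4 e \/ is_T5 e)).
Proof.
move=> [es ei] V0 d2 d3; split.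
  move=> [s [cs s4]] T.
  have [g gT I] : exists2 g, g \in exceptional & iso_to e g.1 g.2.
    case: T => [|[|[|[|]]]] T; [exists (3, T1_E)|exists (7, T2_E)|exists (7, T3_E)|exists (8, T4_E)|exists (8, T5_E)] => //.
  have [f M] := iso_models V0 I; rewrite -surjective_pairing in M.
  have := models_no_cycle gT M (s := s) _ cs; rewrite s4 => /(_ _)/negP; apply=> //.
  by apply/allP => x _; rewrite /= inE.
move=> nT; apply: NNPP => nC.
have zero_free s : is_cycle e s -> ~~ (4 %| size s) by move=> cs; apply/negP => s4; apply: nC; exists s.
have dE x : dg e [set: V] x = deg e x by apply: eq_card => y; rewrite !inE.
have gV : good e [set: V].
  split; first by rewrite -card_gt0 cardsT.
    by move=> x _; rewrite dE.
  apply: leq_trans d3; rewrite leq_eqVlt; apply/orP; left; apply/eqP/eq_card => x.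
  by rewrite !inE dE.
have [g [f [gT M]]] := zero_free_exc es ei zero_free gV.
apply: nT; move: gT M; rewrite !inE => /or4P [|||/orP []] /eqP -> /models_iso I.
- by left.
- by right; left.
- by do 2!right; left.
- by do 3!right; left.
by do 4!right.
Qed.
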